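(* Let $\mu$ be a positive finite Borel measure on $[0,1)$ and let $X$ be a Banach space of analytic functions. In each of the following cases, the operator $I_\mu:X\to H(\mathbb{D})$ is well defined and continuous, admits the expression $I_\mu(f)(z)=\sum_{n=0}^\infty\left((A)\text{-}\sum_{k=0}^\infty\mu_{n+k}a_k\right)z^n$ for $f(z)=\sum_{n=0}^\infty a_nz^n\in X$, and $I_\mu(f)=H_\mu(f)$ whenever $\sum_{k=0}^\infty\mu_{n+k}a_k$ converges for each $n\ge0$: (i) $X=H^\infty_v$, where $v$ is a weight on $\mathbb{D}$ with $1/v\in L_1([0,1),\mu)$. If the weight $v$ is essential, then the condition $1/v\in L_1([0,1),\mu)$ is also necessary for $I_\mu:H^\infty_v\to H(\mathbb{D})$ to be well defined. (ii) $X=H^1$ and $\mu$ is a Carleson measure.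
   Context: $\mathbb{D}$ is the open unit disc, $H(\mathbb{D})$ the holomorphic functions on $\mathbb{D}$ with the topology of uniform convergence on compact sets. A Banach space of analytic functions is a Banach space $X\subseteq H(\mathbb{D})$ containing the polynomials with continuous inclusion into $H(\mathbb{D})$. $\mu_n=\int_0^1t^n\,d\mu(t)$; $H_\mu(f)(z)=\sum_n(\sum_k\mu_{n+k}a_k)z^n$ and $I_\mu(f)(z)=\int_0^1\frac{f(t)}{1-tz}\,d\mu(t)$ whenever these define holomorphic functions. A series $\sum a_n$ is Abel summable to $S$, written $S=(A)\text{-}\sum a_n$, if $\sum a_nr^n$ converges for all $0<r<1$ and tends to $S$ as $r\to1^-$. A weight is a function $v:\mathbb{D}\to(0,\infty)$ that is radial, continuous, non-increasing in $|z|$, with $\lim_{r\to1^-}v(r)=0$; $H^\infty_v=\{f\in H(\mathbb{D}):\sup_zv(z)|f(z)|<\infty\}$. $v$ is essential if there is $c>0$ with $c/v(z)\le\sup\{|f(z)|:\sup_\zeta v(\zeta)|f(\zeta)|\le1\}\le1/v(z)$ for all $z$. $H^1$ is the classical Hardy space. $\mu$ is Carleson if $\mu([t,1))=O(1-t)$ as $t\to1^-$. *)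

(* Defs.v *)
From mathcomp Require Import all_boot all_order all_algebra.
From mathcomp Require Import all_classical all_reals all_analysis.
From mathcomp.real_closed Require Export complex.
Export Order.TTheory GRing.Theory Num.Theory.
Export numFieldNormedType.Exports.

Set Implicit Arguments.
Unset Strict Implicit.
Unset Printing Implicit Defensive.

Local Open Scope ring_scope.
Local Open Scope classical_set_scope.

Section Defs.
Variable R : realType.

(* the complex plane, as a normed module over itself (so that [derivable]
   below is complex differentiability) *)
Definition Cx : Type := (R[i])^o.

Definition rC (t : R) : Cx := (t%:C)%C.

Definition cmod (z : Cx) : R := Num.sqrt (complex.Re z ^+ 2 + complex.Im z ^+ 2).

Definition disc : set Cx := [set z | cmod z < 1].

Definition holo (f : Cx -> Cx) : Prop := forall z, disc z -> derivable f z 1.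

Definition taylor_coeffs (a : nat -> Cx) (f : Cx -> Cx) : Prop :=
  forall z, disc z -> series (fun n => a n * z ^+ n) @ \oo --> f z.

Definition abel_summable (s : nat -> Cx) (S : Cx) : Prop :=
  (forall r : R, 0 < r < 1 -> cvg (series (fun n => s n * rC r ^+ n) @ \oo)) /\
  ((fun r : R => lim (series (fun n => s n * rC r ^+ n) @ \oo)) r @[r --> (1:R)^'-] --> S).

Variable mu : {measure set R -> \bar R}.

Definition moment (n : nat) : R := Rintegral mu `[0, 1[ (fun t => t ^+ n).

Definition cintegrable (A : set R) (g : R -> Cx) : Prop :=
  mu.-integrable A (fun t => (complex.Re (g t))%:E) /\
  mu.-integrable A (fun t => (complex.Im (g t))%:E).

Definition cintegral (A : set R) (g : R -> Cx) : Cx :=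
  ((Rintegral mu A (fun t => complex.Re (g t)))%:C
   + 'i * (Rintegral mu A (fun t => complex.Im (g t)))%:C)%C.

Definition Imu_kernel (f : Cx -> Cx) (z : Cx) (t : R) : Cx :=
  f (rC t) / (1 - rC t * z).

Definition Imu (f : Cx -> Cx) (z : Cx) : Cx := cintegral `[0, 1[ (Imu_kernel f z).

Definition Imu_well_defined (X : set (Cx -> Cx)) : Prop :=
  forall f, X f ->
    (forall z, disc z -> cintegrable `[0, 1[ (Imu_kernel f z)) /\ holo (Imu f).

(* I_mu : (X, nrm) -> H(D) is continuous, H(D) carrying the topology of
   uniform convergence on compact subsets of D *)
Definition Imu_continuous (X : set (Cx -> Cx)) (nrm : (Cx -> Cx) -> \bar R) :=
  forall f, X f -> forall K : set Cx, compact K -> K `<=` disc ->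
  forall eps : R, 0 < eps -> exists2 delta : R, 0 < delta &
    forall g, X g -> (nrm (g \- f)%R < delta%:E)%E ->
      forall z, K z -> cmod (Imu g z - Imu f z) <= eps.

Definition Imu_expression (X : set (Cx -> Cx)) : Prop :=
  forall f, X f -> forall a, taylor_coeffs a f ->
  exists b : nat -> Cx,
    (forall n, abel_summable (fun k => rC (moment (n + k)) * a k) (b n)) /\
    (forall z, disc z -> series (fun n => b n * z ^+ n) @ \oo --> Imu f z).

Definition Imu_eq_Hmu (X : set (Cx -> Cx)) : Prop :=
  forall f, X f -> forall a, taylor_coeffs a f ->
  (forall n, cvg (series (fun k => rC (moment (n + k)) * a k) @ \oo)) ->
  forall z, disc z ->
    series (fun n => lim (series (fun k => rC (moment (n + k)) * a k) @ \oo) * z ^+ n)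
      @ \oo --> Imu f z.

Definition Imu_conclusions (X : set (Cx -> Cx)) (nrm : (Cx -> Cx) -> \bar R) :=
  [/\ Imu_well_defined X, Imu_continuous X nrm, Imu_expression X & Imu_eq_Hmu X].

Definition carleson : Prop :=
  exists c : R, \forall t \near (1:R)^'-, (mu `[t, 1%R[ <= (c * (1 - t))%:E)%E.

End Defs.

Section Spaces.
Variable R : realType.

Definition weight (v : Cx R -> R) : Prop :=
  [/\ (forall z, disc z -> 0 < v z),
      (forall z w, disc z -> disc w -> cmod z = cmod w -> v z = v w),
      (forall z, disc z -> {for z, continuous v}),
      (forall z w, disc z -> disc w -> cmod z <= cmod w -> v w <= v z) &
      (v (rC r) @[r --> (1:R)^'-] --> 0)].

Definition Hinfv_norm (v : Cx R -> R) (f : Cx R -> Cx R) : \bar R :=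
  ereal_sup [set (v z * cmod (f z))%:E | z in disc (R:=R)].

Definition Hinfv (v : Cx R -> R) : set (Cx R -> Cx R) :=
  [set f | holo f /\ (Hinfv_norm v f < +oo)%E].

Definition essential (v : Cx R -> R) : Prop :=
  exists2 c : R, 0 < c & forall z, disc z ->
    ((c / v z)%:E <=
       ereal_sup [set (cmod (f z))%:E | f in
                    [set f | Hinfv v f /\ (Hinfv_norm v f <= 1%:E)%E]] <=
     (v z)^-1%:E)%E.

Definition circle_mean (f : Cx R -> Cx R) (r : R) : \bar R :=
  (((2 * pi)^-1)%:E *
   \int[lebesgue_measure]_(th in `[0%R, (2 * pi)%R]) (cmod (f ((r * cos th) +i* (r * sin th))%C))%:E)%E.

Definition H1_norm (f : Cx R -> Cx R) : \bar R :=
  ereal_sup [set circle_mean f r | r in `]0, 1[].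

Definition H1 : set (Cx R -> Cx R) := [set f | holo f /\ (H1_norm f < +oo)%E].

End Spaces.

(* Main.v *)
Require Import Defs.
From mathcomp Require Import all_boot all_order all_algebra.
From mathcomp Require Import all_classical all_reals all_analysis.
From mathcomp.real_closed Require Import complex.
From mathcomp Require Import measurable_realfun ring lra.
Import Order.TTheory GRing.Theory Num.Theory numFieldNormedType.Exports.
Local Open Scope ring_scope.
Local Open Scope classical_set_scope.
Set Implicit Arguments.
Unset Strict Implicit.
Unset Printing Implicit Defensive.

(** On both spaces the restriction of [f] to a radius has a nondecreasing
    majorant [N] in L^1(mu) whose integral is controlled by the norm of [f].
    Then [I_mu f] has the Taylor coefficients [b_n], the integral of
    [t^n f(t)] against mu, because 1/(1 - tz) is a geometric series; the Abel
    means of [sum_k mu_(n+k) a_k] are the integrals of [t^n f(rt)], which tend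
    to [b_n] by dominated convergence since |f(rt)| <= N(t), and Abel's limit
    theorem identifies [b_n] with the ordinary sum when that one exists.

    For [H^infty_v] one takes [N = M / v].  For [H^1], Cauchy's formula for
    z |-> f(rho z) (1 - z) (1 + t) / (1 - tz) gives
    |f(rho t)| <= C int |f(rho z)| |1 - z| / (1 - t + |1 - z|)^2 over |z| = 1;
    this kernel increases with t, and summed over the points t = 1 - 2^-j with
    the weights 2^-j allowed by the Carleson condition it is bounded uniformly
    in z.

    For the necessity of [1/v] in L^1(mu), Hadamard's three circles theorem
    turns essentiality of [v] into: at every r >= 1/2 some monomial
    [A s^k <= 1/v(s)] is comparable to [1/v(r)].  A sparse sequence of such
    monomials has a sum in [H^infty_v] that is comparable to [1/v] on [1/2, 1). *)

(** * Complex numbers and complex differentiability *)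

(** Holomorphy is given as pointwise differentiability, so the Cauchy theory is built here, as far
    as the estimates require. Green's formula is used in the coordinates (s, th) of exp(s + i th):
    they turn an annulus into a rectangle and the Cauchy integral of h(z)/z into the plain mean of h
    over a circle. The origin is out of reach of these coordinates, so Cauchy's formula carries an
    inner circle. In the [H^1] estimate that circle is shrunk until its contribution vanishes; in
    the three circles theorem it is the smallest of the three.

    The [H^1] estimate works with a dilation rho < 1 and finitely many dyadic points, with constants
    independent of both.

    For necessity, three circles gives an alternative for each k: the monomial of degree k with
    value |f(t)| at t stays below 1/v on at least one side of t. Degree 0 does so on the right by
    monotonicity, high degrees fail there; hence for some k degree k works on the right and degree k
    + 1 on the left, and the factor t makes degree k + 1 work on both. The coefficients are
    nonnegative, so the sum dominates each of its monomials on the radius. *)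

Section ComplexModulus.
Variable R : realType.
Implicit Types (z w : Cx R) (x y : R).

Lemma cmodE z : (cmod z)%:C%C = `|z| :> R[i].
Proof. by rewrite normc_def. Qed.

Lemma cmod_normc z : cmod z = ComplexField.Normc.normc z.
Proof. by case: z. Qed.

Lemma cmod_ge0 z : 0 <= cmod z.
Proof. exact: sqrtr_ge0. Qed.

Lemma cmodM z w : cmod (z * w) = cmod z * cmod w.
Proof. by rewrite !cmod_normc ComplexField.Normc.normcM. Qed.

Lemma cmodV z : cmod z^-1 = (cmod z)^-1.
Proof. by rewrite !cmod_normc; exact: ComplexField.Normc.normcV. Qed.

Lemma cmod_div z w : cmod (z / w) = cmod z / cmod w.
Proof. by rewrite cmodM cmodV. Qed.

Lemma cmodN z : cmod (- z) = cmod z.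
Proof. by rewrite !cmod_normc normcN. Qed.

Lemma cmodD z w : cmod (z + w) <= cmod z + cmod w.
Proof. by rewrite !cmod_normc le_normcD. Qed.

Lemma cmodB z w : cmod (z - w) <= cmod z + cmod w.
Proof. by rewrite -(cmodN w) cmodD. Qed.

Lemma cmod_distC z w : cmod (z - w) = cmod (w - z).
Proof. by rewrite -cmodN opprB. Qed.

Lemma cmod_ger_dist z w : cmod z - cmod w <= cmod (z - w).
Proof. by rewrite lerBlDr -{1}(subrK w z) cmodD. Qed.

Lemma cmod0 : cmod (0 : Cx R) = 0.
Proof. by rewrite cmod_normc ComplexField.Normc.normc0. Qed.

Lemma cmod1 : cmod (1 : Cx R) = 1.
Proof. by rewrite cmod_normc ComplexField.Normc.normc1. Qed.

Lemma cmod_eq0 z : (cmod z == 0) = (z == 0).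
Proof.
apply/eqP/eqP => [|->]; last exact: cmod0.
by rewrite cmod_normc; exact: ComplexField.Normc.eq0_normc.
Qed.

Lemma cmod_gt0 z : (0 < cmod z) = (z != 0).
Proof. by rewrite lt_def cmod_ge0 andbT cmod_eq0. Qed.

Lemma cmodX z n : cmod (z ^+ n) = cmod z ^+ n.
Proof. by elim: n => [|n IH]; rewrite ?cmod1 // !exprS cmodM IH. Qed.

Lemma cmod_rC x : cmod (rC x) = `|x|.
Proof. by rewrite /cmod /= expr0n addr0 sqrtr_sqr. Qed.

Lemma rCM x y : rC (x * y) = rC x * rC y.
Proof. exact: rmorphM. Qed.
Lemma rCD x y : rC (x + y) = rC x + rC y.
Proof. exact: rmorphD. Qed.
Lemma rCB x y : rC (x - y) = rC x - rC y.
Proof. exact: rmorphB. Qed.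
Lemma rCX x n : rC (x ^+ n) = rC x ^+ n.
Proof. exact: rmorphXn. Qed.
Lemma rC0 : rC (0 : R) = 0.
Proof. by []. Qed.
Lemma rC1 : rC (1 : R) = 1.
Proof. by []. Qed.

Lemma ReD z w : complex.Re (z + w) = complex.Re z + complex.Re w.
Proof. by case: z w => a b [c d]. Qed.
Lemma ImD z w : complex.Im (z + w) = complex.Im z + complex.Im w.
Proof. by case: z w => a b [c d]. Qed.
Lemma ReN z : complex.Re (- z) = - complex.Re z.
Proof. by case: z. Qed.
Lemma ImN z : complex.Im (- z) = - complex.Im z.
Proof. by case: z. Qed.
Lemma ReB z w : complex.Re (z - w) = complex.Re z - complex.Re w.
Proof. by rewrite ReD ReN. Qed.
Lemma ImB z w : complex.Im (z - w) = complex.Im z - complex.Im w.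
Proof. by rewrite ImD ImN. Qed.
Lemma ReM z w : complex.Re (z * w) =
  complex.Re z * complex.Re w - complex.Im z * complex.Im w.
Proof. by case: z w => a b [c d]. Qed.
Lemma ImM z w : complex.Im (z * w) =
  complex.Re z * complex.Im w + complex.Im z * complex.Re w.
Proof. by case: z w => a b [c d]. Qed.

Lemma Cx_eq z w : complex.Re z = complex.Re w -> complex.Im z = complex.Im w -> z = w.
Proof. by case: z w => a b [c d] /= -> ->. Qed.

Lemma sqr_cmod z : cmod z ^+ 2 = complex.Re z ^+ 2 + complex.Im z ^+ 2.
Proof. by rewrite sqr_sqrtr // addr_ge0 ?sqr_ge0. Qed.

Lemma Re_le_cmod z : `|complex.Re z| <= cmod z.
Proof.
by rewrite -sqrtr_sqr ler_wsqrtr// lerDl sqr_ge0.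
Qed.

Lemma Im_le_cmod z : `|complex.Im z| <= cmod z.
Proof.
by rewrite -sqrtr_sqr ler_wsqrtr// lerDr sqr_ge0.
Qed.

Lemma cmod_le_ReIm z : cmod z <= `|complex.Re z| + `|complex.Im z|.
Proof.
rewrite -(ler_pXn2r (_ : (0 < 2)%N)) ?nnegrE ?cmod_ge0 ?addr_ge0//.
rewrite sqr_cmod sqrrD -!normrX (ger0_norm (sqr_ge0 _)) (ger0_norm (sqr_ge0 _)).
by rewrite lerD2r lerDl mulrn_wge0// mulr_ge0.
Qed.

(** The norm of [R[i]] takes its values in [R[i]], so the library's epsilons are complex. Positive
    elements of [R[i]] are real, which reduces convergence to real epsilons and [cmod]. *)
Lemma cvg_cxP (T : Type) (F : set_system T) (u : T -> Cx R) (z : Cx R) : Filter F ->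
  (u @ F --> z) <-> (forall e : R, 0 < e -> \forall t \near F, cmod (u t - z) < e).
Proof.
move=> FF; split=> [Fz e e0|H].
  have e0' : 0 < (e%:C)%C by rewrite ltcR.
  move/cvgrPdist_lt : Fz => /(_ _ e0').
  by apply: filterS => t; rewrite -cmodE ltcR cmod_distC.
apply/cvgrPdist_lt => e e0.
have [r er] : exists r : R, e = (r%:C)%C.
  by apply/complex_realP; exact: gtr0_real.
have r0 : 0 < r by rewrite -ltcR -er.
by apply: filterS (H _ r0) => t; rewrite -cmodE er ltcR cmod_distC.
Qed.

(** The first-order expansion is written without a quotient, so that [w = z] is no special case and
    real coordinates can be substituted directly. *)
Definition cderiv (f : Cx R -> Cx R) (z d : Cx R) : Prop :=
  forall e : R, 0 < e -> exists2 del : R, 0 < del &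
    forall w, cmod (w - z) < del ->
      cmod (f w - f z - d * (w - z)) <= e * cmod (w - z).

Lemma nbhs_cmod_ball z (e : R) : 0 < e -> nbhs z [set w : Cx R | cmod (w - z) < e].
Proof.
move=> e0; have : (fun w : Cx R => w) @ z --> z by exact: cvg_id.
by move/cvg_cxP => /(_ e e0).
Qed.

Lemma nbhs_cmodE z (A : set (Cx R)) : nbhs z A ->
  exists2 e : R, 0 < e & forall w, cmod (w - z) < e -> A w.
Proof.
move=> /nbhs_ballP[e /= e0 eA].
have [r er] : exists r : R, e = (r%:C)%C.
  by apply/complex_realP; exact: gtr0_real.
have r0 : 0 < r by rewrite -ltcR -er.
exists r => // w wr; apply: eA.
by rewrite /ball /= -cmodE er ltcR cmod_distC.
Qed.

Lemma derivable_cderiv (f : Cx R -> Cx R) z :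
  derivable f z 1 <-> exists d, cderiv f z d.
Proof.
split.
  move=> /cvg_ex[/= d /cvg_cxP Hd]; exists d => e e0.
  have /nbhs_cmodE[del del0 H] := Hd _ e0.
  exists del => // w wz.
  have [->|wzn] := eqVneq w z.
    by rewrite !subrr mulr0 subr0 cmod0 mulr0.
  have wz0 : w - z != 0 by rewrite subr_eq0.
  have := H (w - z).
  rewrite subr0 => /(_ wz wz0).
  have -> : (w - z) *: (1 : Cx R) + z = w.
    by rewrite /GRing.scale /= mulr1 subrK.
  move=> /ltW.
  rewrite -(ler_pM2r (_ : 0 < cmod (w - z))); last by rewrite cmod_gt0.
  rewrite -cmodM; apply: le_trans; rewrite le_eqVlt; apply/orP; left; apply/eqP.
  congr cmod; rewrite mulrBl; congr (_ - _).
  by rewrite /GRing.scale /= mulrC mulrA mulfV ?mul1r.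
move=> [d Hd]; apply/cvg_ex; exists d; apply/cvg_cxP => e e0.
have [del del0 H] := Hd _ (divr_gt0 e0 (ltr0n _ 2)).
near=> h.
have h0 : h != 0 by near: h; exact: nbhs_dnbhs_neq.
have hdel : cmod (h - 0) < del.
  by near: h; apply: nbhs_dnbhs; exact: nbhs_cmod_ball.
rewrite subr0 in hdel.
rewrite /=; have -> : h *: (1 : Cx R) + z = z + h by rewrite /GRing.scale /= mulr1 addrC.
have -> : h^-1 *: (f (z + h) - f z) - d = h^-1 * (f (z + h) - f z - d * ((z + h) - z)).
  rewrite /GRing.scale /= [RHS]mulrBr; congr (_ - _).
  by rewrite [z + h]addrC addrK mulrCA mulVf ?mulr1.
rewrite cmodM cmodV mulrC ltr_pdivrMr ?cmod_gt0//.
have := H (z + h); rewrite addrAC subrr add0r => /(_ hdel) /le_lt_trans; apply.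
by rewrite ltr_pM2r ?cmod_gt0// ltr_pdivrMr// ltr_pMr// ltr1n.
Unshelve. all: by end_near.
Qed.

End ComplexModulus.

(** * Green's formula without continuity of the derivative *)

Section Bisection.
Variable R : realType.
Variables (J : R -> R -> R -> R -> R) (A B C D : R).
Hypotheses (AB : A <= B) (CD : C <= D).
Hypothesis J_splitl : forall a m b c d, A <= a -> a <= m -> m <= b -> b <= B ->
  C <= c -> c <= d -> d <= D -> J a b c d = J a m c d + J m b c d.
Hypothesis J_splitr : forall a b c m d, A <= a -> a <= b -> b <= B ->
  C <= c -> c <= m -> m <= d -> d <= D -> J a b c d = J a b c m + J a b m d.
Hypothesis J_small : forall x y, A <= x <= B -> C <= y <= D ->
  forall e : R, 0 < e -> exists2 del : R, 0 < del & forall a b c d,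
    A <= a <= x -> x <= b <= B -> C <= c <= y -> y <= d <= D ->
    b - a < del -> d - c < del -> `|J a b c d| <= e * ((b - a) + (d - c)) ^+ 2.

Let rect : Type := (R * R * R * R)%type.
Let good (Q : rect) := let: (a, b, c, d) := Q in
  [/\ A <= a, a <= b, b <= B, C <= c & c <= d <= D].
Let JQ (Q : rect) := let: (a, b, c, d) := Q in J a b c d.
Let half_of (Q Q' : rect) := let: (a, b, c, d) := Q in let: (a', b', c', d') := Q' in
  [/\ a <= a', b' <= b, c <= c' & d' <= d] /\
  (b' - a' = (b - a) / 2 /\ d' - c' = (d - c) / 2).

(** Of four quarters, one carries at least a quarter of [|J|]. The existential stands outside
    [good Q] so that [choice] yields a step function on all rectangles. *)
Let quarter (Q : rect) : exists Q', good Q ->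
  [/\ good Q', half_of Q Q' & `|JQ Q| <= 4 * `|JQ Q'|].
Proof.
case: Q => [[[a b] c] d].
set m := (a + b) / 2; set n := (c + d) / 2.
have [[Q' HQ']|H] := pselect (exists Q', good (a, b, c, d) ->
  [/\ good Q', half_of (a, b, c, d) Q' & `|JQ (a, b, c, d)| <= 4 * `|JQ Q'|]).
  by exists Q'.
exists (a, b, c, d) => gQ; exfalso; apply: H.
have [Aa ab bB Cc /andP[cd dD]] := gQ.
have am : a <= m by rewrite /m; lra.
have mb : m <= b by rewrite /m; lra.
have cn : c <= n by rewrite /n; lra.
have nd : n <= d by rewrite /n; lra.
have E : J a b c d = (J a m c n + J a m n d) + (J m b c n + J m b n d).
  rewrite (J_splitl Aa am mb bB Cc (le_trans cn nd) dD).
  by rewrite (J_splitr Aa am (le_trans mb bB) Cc cn nd dD) (J_splitr (le_trans Aa am) mb bB Cc cn nd dD).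
have [h1|h1] := leP `|J a b c d| (4 * `|J a m c n|).
  exists (a, m, c, n) => _; split=> //; last by rewrite /half_of /m /n; split; split; lra.
  by split; rewrite ?cn; lra.
have [h2|h2] := leP `|J a b c d| (4 * `|J a m n d|).
  exists (a, m, n, d) => _; split=> //; last by rewrite /half_of /m /n; split; split; lra.
  by split; rewrite ?nd; lra.
have [h3|h3] := leP `|J a b c d| (4 * `|J m b c n|).
  exists (m, b, c, n) => _; split=> //; last by rewrite /half_of /m /n; split; split; lra.
  by split; rewrite ?cn; lra.
exists (m, b, n, d) => _; split=> //.
- by split; rewrite ?nd; lra.
- by rewrite /half_of /m /n; split; split; lra.
- rewrite [JQ _]/= [JQ _]/= E.
  have := ler_normD (J a m c n + J a m n d) (J m b c n + J m b n d).
  have := ler_normD (J a m c n) (J a m n d).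
  have := ler_normD (J m b c n) (J m b n d).
  by move: h1 h2 h3; rewrite -E; lra.
Qed.

(** Goursat's argument: nested quarters shrink to a point (x, y), the [n]-th one having perimeter of
    order [2^-n] and [|J|] at least [4^-n] times the initial value. This contradicts the smallness
    [J_small] at (x, y), which is of second order in the perimeter. *)
Lemma bisection_eq0 : J A B C D = 0.
Proof.
apply/eqP; rewrite -normr_le0 leNgt; apply/negP => J0.
have [step stepP] := choice quarter.
pose Q := fix Q n := if n is n'.+1 then step (Q n') else (A, B, C, D).
have gQ n : good (Q n).
  elim: n => [|n IH]; first by split; rewrite ?CD ?lexx.
  by have [] := stepP _ IH.
pose a n := (Q n).1.1.1; pose b n := (Q n).1.1.2; pose c n := (Q n).1.2; pose d n := (Q n).2.
have QE n : Q n = (a n, b n, c n, d n) by rewrite /a /b /c /d; case: (Q n) => [[[]]].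
have hQ n : half_of (Q n) (Q n.+1) by have [] := stepP _ (gQ n).
have JE n : `|J A B C D| <= 4 ^+ n * `|J (a n) (b n) (c n) (d n)|.
  elim: n => [|n /le_trans]; first by rewrite mul1r.
  apply; rewrite exprSr -mulrA ler_wpM2l ?exprn_ge0//.
  have [_ _] := stepP _ (gQ n); rewrite -/(Q n.+1).
  by rewrite (QE n) (QE n.+1).
have sizeb n : b n - a n = (B - A) / 2 ^+ n.
  elim: n => [|n IH]; first by rewrite divr1.
  have := hQ n; rewrite (QE n) (QE n.+1) => -[_ [-> _]].
  by rewrite IH exprSr invfM mulrA.
have sized n : d n - c n = (D - C) / 2 ^+ n.
  elim: n => [|n IH]; first by rewrite divr1.
  have := hQ n; rewrite (QE n) (QE n.+1) => -[_ [_ ->]].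
  by rewrite IH exprSr invfM mulrA.
have mono (u v : nat -> R) : (forall n, u n <= u n.+1) -> (forall n, v n.+1 <= v n) ->
    (forall n, u n <= v n) -> exists x, forall n, u n <= x <= v n.
  move=> uS vS uv.
  have um : {homo u : n m / (n <= m)%N >-> n <= m} by apply: homo_leq => // y x z; exact: le_trans.
  have vm : {homo v : n m / (n <= m)%N >-> n >= m}.
    by apply: homo_leq => // y x z yx zy; exact: le_trans zy yx.
  have uv' n m : u n <= v m.
    have [nm|mn] := leqP n m; first exact: le_trans (um _ _ nm) (uv m).
    exact: le_trans (uv n) (vm _ _ (ltnW mn)).
  have ubd m : ubound (range u) (v m) by move=> _ [n _ <-].
  exists (sup (range u)) => n; apply/andP; split.
    apply: ub_le_sup; last by exists n.
    by exists (v 0%N).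
  by apply: ge_sup => //; exists (u 0%N); exists 0%N.
have [x xab] : exists x, forall n, a n <= x <= b n.
  apply: mono => n.
  - by have := hQ n; rewrite (QE n) (QE n.+1) => -[[]].
  - by have := hQ n; rewrite (QE n) (QE n.+1) => -[[]].
  - by have := gQ n; rewrite (QE n) => -[].
have [y ycd] : exists y, forall n, c n <= y <= d n.
  apply: mono => n.
  - by have := hQ n; rewrite (QE n) (QE n.+1) => -[[]].
  - by have := hQ n; rewrite (QE n) (QE n.+1) => -[[]].
  - by have := gQ n; rewrite (QE n) => -[_ _ _ _ /andP[]].
pose S := (B - A) + (D - C).
have S0 : 0 <= S by rewrite addr_ge0 ?subr_ge0.
(* Chosen so that [e * S ^+ 2] is less than half of [|J A B C D|], while the bisection gives
   [|J A B C D| <= e * S ^+ 2]. *)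
pose e := `|J A B C D| / (2 * (S ^+ 2 + 1)).
have e0 : 0 < e by rewrite divr_gt0// mulr_gt0// ltr_wpDl ?sqr_ge0.
have [del del0 Hdel] := J_small (xab 0%N) (ycd 0%N) e0.
have [n nS] : exists n, S / 2 ^+ n < del.
  have [n Sn] : exists n : nat, S / del < n%:R.
    by eexists; apply: archi_boundP; rewrite divr_ge0// ltW.
  exists n; rewrite ltr_pdivrMr ?exprn_gt0// mulrC -ltr_pdivrMr//.
  apply: lt_trans Sn _.
  by rewrite -natrX ltr_nat ltn_expl.
have p2 : 0 < (2 : R) ^+ n by rewrite exprn_gt0.
have Sn : (b n - a n) + (d n - c n) = S / 2 ^+ n by rewrite sizeb sized -mulrDl.
have [Aa ab bB Cc /andP[cd dD]] : [/\ A <= a n, a n <= b n, b n <= B, C <= c n & c n <= d n <= D].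
  by have := gQ n; rewrite (QE n).
have := Hdel (a n) (b n) (c n) (d n).
have /andP[ax xb] := xab n; have /andP[cy yd] := ycd n.
rewrite Aa ax xb bB Cc cy yd dD => /(_ isT isT isT isT).
have -> : b n - a n < del by lra.
have -> : d n - c n < del by lra.
move=> /(_ isT isT); rewrite Sn => H.
have : `|J A B C D| <= 4 ^+ n * (e * (S / 2 ^+ n) ^+ 2).
  by apply: le_trans (JE n) _; rewrite ler_wpM2l ?exprn_ge0.
have -> : 4 ^+ n * (e * (S / 2 ^+ n) ^+ 2) = e * S ^+ 2.
  have -> : (4 : R) = 2 ^+ 2 by rewrite -natrX.
  by rewrite -exprM mulnC exprM; field; rewrite gt_eqF.
rewrite /e.
have S2 : 0 <= S ^+ 2 by exact: sqr_ge0.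
rewrite mulrAC ler_pdivlMr; last by lra.
rewrite ler_pM2l//; lra.
Qed.

End Bisection.

Lemma integrable_EFinB (R : realType) d (T : measurableType d)
    (mu : {measure set T -> \bar R}) (D : set T) (f g : T -> R) : measurable D ->
  mu.-integrable D (EFin \o f) -> mu.-integrable D (EFin \o g) ->
  mu.-integrable D (EFin \o (fun x => f x - g x)).
Proof. by move=> mD fi gi; apply: (integrableB _ fi gi). Qed.

(* [holo] is mere pointwise differentiability, so Green's formula is proved as
   in Goursat's lemma: the defect is additive on rectangles and is
   o(diameter^2) at each point. *)
Section Green.
Variable R : realType.
Notation leb := (@lebesgue_measure R).
Implicit Types (f : R -> R) (a b c d k e : R).

Lemma integrable_subitv f a b a' b' : a <= a' -> b' <= b ->
  leb.-integrable `[a, b] (EFin \o f) -> leb.-integrable `[a', b'] (EFin \o f).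
Proof.
move=> aa' bb'; apply: integrableS => //; apply: subset_itv; rewrite bnd_simp//.
Qed.

Lemma Rintegral_itv_split f a m b : a <= m -> m <= b ->
  leb.-integrable `[a, b] (EFin \o f) ->
  \int[leb]_(x in `[a, b]) f x =
  \int[leb]_(x in `[a, m]) f x + \int[leb]_(x in `[m, b]) f x.
Proof.
move=> am mb fi; have := @Rintegral_itvB R f (BLeft a) (BRight b) m fi.
rewrite !bnd_simp => /(_ am mb).
rewrite Rintegral_itv_obnd_cbnd; last first.
  by apply: integrableS fi => //; apply: subset_itv; rewrite bnd_simp//.
by move/eqP; rewrite subr_eq addrC => /eqP.
Qed.

Lemma Rintegral_itv_cst a b k : a <= b -> \int[leb]_(x in `[a, b]) k = k * (b - a).
Proof.
move=> ab; rewrite Rintegral_cst//= lebesgue_measure_itv/= lte_fin.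
by case: ltgtP ab => //= -> _; rewrite subrr.
Qed.

Lemma integrable_itv_cst a b k : leb.-integrable `[a, b] (EFin \o (fun=> k)).
Proof.
by apply: continuous_compact_integrable; [exact: segment_compact|
  apply: continuous_subspaceT => x; exact: cvg_cst].
Qed.

Lemma Rintegral_itv_bound f a b k e : a <= b ->
  leb.-integrable `[a, b] (EFin \o f) ->
  (forall x, a <= x <= b -> `|f x - k| <= e) ->
  `|\int[leb]_(x in `[a, b]) f x - k * (b - a)| <= e * (b - a).
Proof.
move=> ab fi fk.
have ci := integrable_itv_cst a b k.
rewrite -Rintegral_itv_cst// -RintegralB//.
have fki : leb.-integrable `[a, b] (EFin \o (fun x => f x - k)).
  exact: integrable_EFinB.
apply: le_trans (le_normr_Rintegral _ fki) _ => //.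
rewrite -Rintegral_itv_cst//; apply: le_Rintegral => //.
  exact: (integrable_norm fki).
exact: integrable_itv_cst.
Qed.

(** Differentiability in two real variables with partial derivatives [p] and [q], tested on the
    points of [dom] only. *)
Definition diff2 (F : R -> R -> R) (x0 y0 p q : R) (dom : R -> R -> Prop) := forall e : R, 0 < e ->
  exists2 del : R, 0 < del & forall x y, dom x y ->
    `|x - x0| < del -> `|y - y0| < del ->
    `|F x y - F x0 y0 - p * (x - x0) - q * (y - y0)| <= e * (`|x - x0| + `|y - y0|).

Section rectangle.
Variables (P Q : R -> R -> R) (A B C D : R).
Hypotheses (AB : A <= B) (CD : C <= D).
Hypothesis Pi : forall x, A <= x <= B -> leb.-integrable `[C, D] (EFin \o P x).
Hypothesis Qi : forall y, C <= y <= D -> leb.-integrable `[A, B] (EFin \o Q ^~ y).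
Let dom x y := A <= x <= B /\ C <= y <= D.

(** This is the counterclockwise integral of [Q dx + P dy] along the boundary of the rectangle;
    Green's formula would equate it with the double integral of [P_x - Q_y]. *)
Definition green_defect a b c d :=
  \int[leb]_(y in `[c, d]) (P b y - P a y) - \int[leb]_(x in `[a, b]) (Q x d - Q x c).
Local Notation J := green_defect.

Let Pi' x c d : A <= x <= B -> C <= c -> d <= D -> leb.-integrable `[c, d] (EFin \o P x).
Proof. by move=> xAB Cc dD; apply: integrable_subitv Cc dD (Pi xAB). Qed.
Let Qi' y a b : C <= y <= D -> A <= a -> b <= B -> leb.-integrable `[a, b] (EFin \o Q ^~ y).
Proof. by move=> xAB Cc dD; apply: integrable_subitv Cc dD (Qi xAB). Qed.
Let PBi a b c d : A <= a -> a <= b -> b <= B -> C <= c -> d <= D ->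
  leb.-integrable `[c, d] (EFin \o (fun y => P b y - P a y)).
Proof.
move=> Aa ab bB Cc dD; apply: integrable_EFinB => //; apply: Pi' => //; lra.
Qed.
Let QBi a b c d : A <= a -> b <= B -> C <= c -> c <= d -> d <= D ->
  leb.-integrable `[a, b] (EFin \o (fun x => Q x d - Q x c)).
Proof.
move=> Aa bB Cc cd dD; apply: integrable_EFinB => //; apply: Qi' => //; lra.
Qed.

Lemma green_splitl a m b c d : A <= a -> a <= m -> m <= b -> b <= B ->
  C <= c -> c <= d -> d <= D -> J a b c d = J a m c d + J m b c d.
Proof.
move=> Aa am mb bB Cc cd dD; rewrite /J.
have := Rintegral_itv_split am mb (QBi Aa bB Cc cd dD) => ->.
have -> : \int[leb]_(y in `[c, d]) (P b y - P a y) =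
   \int[leb]_(y in `[c, d]) (P m y - P a y) + \int[leb]_(y in `[c, d]) (P b y - P m y).
  rewrite -RintegralD//; last 2 first.
  - by apply: PBi => //; lra.
  - by apply: PBi => //; lra.
  by apply: eq_Rintegral => y _; ring.
ring.
Qed.

Lemma green_splitr a b c m d : A <= a -> a <= b -> b <= B ->
  C <= c -> c <= m -> m <= d -> d <= D -> J a b c d = J a b c m + J a b m d.
Proof.
move=> Aa ab bB Cc cm md dD; rewrite /J.
have := Rintegral_itv_split cm md (PBi Aa ab bB Cc dD) => ->.
have -> : \int[leb]_(x in `[a, b]) (Q x d - Q x c) =
   \int[leb]_(x in `[a, b]) (Q x m - Q x c) + \int[leb]_(x in `[a, b]) (Q x d - Q x m).
  rewrite -RintegralD//; last 2 first.
  - by apply: QBi => //; lra.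
  - by apply: QBi => //; lra.
  by apply: eq_Rintegral => y _; ring.
ring.
Qed.

(** Since [p = q'] says [P_x = Q_y] at the point, the linear parts contribute the same product
    [p * (b - a) * (d - c)] to both integrals and cancel. Each integrand is a difference of two
    values, whence the choice of [e / 2] for the remainders. *)
Lemma green_small x y p p' q q' : A <= x <= B -> C <= y <= D ->
  p = q' -> diff2 P x y p p' dom -> diff2 Q x y q q' dom ->
  forall e : R, 0 < e -> exists2 del : R, 0 < del & forall a b c d,
    A <= a <= x -> x <= b <= B -> C <= c <= y -> y <= d <= D ->
    b - a < del -> d - c < del -> `|J a b c d| <= e * ((b - a) + (d - c)) ^+ 2.
Proof.
move=> xAB yCD pq HP HQ e e0.
have e20 : 0 < e / 2 by rewrite divr_gt0.
have [d1 d10 H1] := HP _ e20; have [d2 d20 H2] := HQ _ e20.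
exists (Num.min d1 d2); first by rewrite lt_min d10.
move=> a b c d /andP[Aa ax] /andP[xb bB] /andP[Cc cy] /andP[yd dD].
rewrite !lt_min => /andP[ba1 ba2] /andP[dc1 dc2].
have ab : a <= b by lra.
have cd : c <= d by lra.
set S := (b - a) + (d - c).
have S0 : 0 <= S by rewrite addr_ge0 ?subr_ge0.
have normx u : a <= u <= b -> `|u - x| <= b - a.
  by move=> /andP[au ub]; rewrite ler_norml; lra.
have normy u : c <= u <= d -> `|u - y| <= d - c.
  by move=> /andP[au ub]; rewrite ler_norml; lra.
have EP u v : a <= u <= b -> c <= v <= d ->
    `|P u v - P x y - p * (u - x) - p' * (v - y)| <= e / 2 * S.
  move=> uab vcd; apply: le_trans (H1 u v _ _ _) _.
  - by split; move: uab vcd; lra.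
  - by apply: le_lt_trans (normx _ uab) _.
  - by apply: le_lt_trans (normy _ vcd) _.
  - by rewrite ler_wpM2l ?(ltW e20)//; apply: lerD; [exact: normx|exact: normy].
have EQ u v : a <= u <= b -> c <= v <= d ->
    `|Q u v - Q x y - q * (u - x) - q' * (v - y)| <= e / 2 * S.
  move=> uab vcd; apply: le_trans (H2 u v _ _ _) _.
  - by split; move: uab vcd; lra.
  - by apply: le_lt_trans (normx _ uab) _.
  - by apply: le_lt_trans (normy _ vcd) _.
  - by rewrite ler_wpM2l ?(ltW e20)//; apply: lerD; [exact: normx|exact: normy].
have aab : a <= a <= b by rewrite lexx ab.
have bab : a <= b <= b by rewrite lexx ab.
have ccd : c <= c <= d by rewrite lexx cd.
have dcd : c <= d <= d by rewrite lexx cd.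
have I1 := Rintegral_itv_bound (k := p * (b - a)) (e := e * S) cd (PBi Aa ab bB Cc dD).
have I2 := Rintegral_itv_bound (k := q' * (d - c)) (e := e * S) ab (QBi Aa bB Cc cd dD).
have {}I1 : `|\int[leb]_(y in `[c, d]) (P b y - P a y) - p * (b - a) * (d - c)| <= e * S * (d - c).
  apply: I1 => v vcd; have := EP b v bab vcd; have := EP a v aab vcd.
  rewrite !ler_norml; lra.
have {}I2 : `|\int[leb]_(x in `[a, b]) (Q x d - Q x c) - q' * (d - c) * (b - a)| <= e * S * (b - a).
  apply: I2 => v vcd; have := EQ v d vcd dcd; have := EQ v c vcd ccd.
  rewrite !ler_norml; lra.
rewrite /J.
have -> : e * S ^+ 2 = e * S * (d - c) + e * S * (b - a) by rewrite /S; ring.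
have E1 : p * (b - a) * (d - c) = q' * (d - c) * (b - a) by rewrite pq; ring.
move: I1 I2; rewrite E1 !ler_norml; lra.
Qed.

Lemma green_defect_eq0 :
  (forall x y, A <= x <= B -> C <= y <= D ->
    exists p p' q q', [/\ p = q', diff2 P x y p p' dom & diff2 Q x y q q' dom]) ->
  J A B C D = 0.
Proof.
move=> H; apply: (@bisection_eq0 R J A B C D) => //.
- exact: green_splitl.
- exact: green_splitr.
- move=> x y xAB yCD; have [p [p' [q [q' [pq HP HQ]]]]] := H x y xAB yCD.
  exact: green_small pq HP HQ.
Qed.

End rectangle.

End Green.

(** * Green's formula with exceptional boundary points *)

Section GreenException.
Variable R : realType.
Notation leb := (@lebesgue_measure R).
Variables (P Q : R -> R -> R) (A B C D t : R).
Hypotheses (AB : A <= B) (CD : C < D) (At : A < t) (tB : t < B).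
Hypothesis Pi : forall x, A <= x <= B -> leb.-integrable `[C, D] (EFin \o P x).
Hypothesis Qi : forall y, C <= y <= D -> leb.-integrable `[A, B] (EFin \o Q ^~ y).
Let dom x y := A <= x <= B /\ C <= y <= D.

Lemma green_defect_osc a b c d p q (e : R) : A <= a -> a <= b -> b <= B ->
  C <= c -> c <= d -> d <= D ->
  (forall x y, a <= x <= b -> c <= y <= d -> `|P x y - p| <= e /\ `|Q x y - q| <= e) ->
  `|green_defect P Q a b c d| <= 2 * e * ((b - a) + (d - c)).
Proof.
move=> Aa ab bB Cc cd dD H.
have Pi' x : a <= x <= b -> leb.-integrable `[c, d] (EFin \o P x).
  by move=> xab; apply: integrable_subitv Cc dD (Pi _); move: xab; lra.
have Qi' y : c <= y <= d -> leb.-integrable `[a, b] (EFin \o Q ^~ y).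
  by move=> xab; apply: integrable_subitv Aa bB (Qi _); move: xab; lra.
have I1 : `|\int[leb]_(y in `[c, d]) (P b y - P a y) - 0 * (d - c)| <= 2 * e * (d - c).
  apply: Rintegral_itv_bound => //.
    by apply: integrable_EFinB => //; apply: Pi'; lra.
  move=> y ycd; have [h1 _] := H b y ltac:(lra) ycd; have [h2 _] := H a y ltac:(lra) ycd.
  by move: h1 h2; rewrite !ler_norml; lra.
have I2 : `|\int[leb]_(x in `[a, b]) (Q x d - Q x c) - 0 * (b - a)| <= 2 * e * (b - a).
  apply: Rintegral_itv_bound => //.
    by apply: integrable_EFinB => //; apply: Qi'; lra.
  move=> y ycd; have [_ h1] := H y d ycd ltac:(lra); have [_ h2] := H y c ycd ltac:(lra).
  by move: h1 h2; rewrite !ler_norml; lra.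
by move: I1 I2; rewrite /green_defect !ler_norml !mul0r !subr0; lra.
Qed.

(* The exceptional points are the two ends of a side, where the point t > 0 of
   the annulus appears in polar coordinates; boundedness there suffices, since
   the corner cells have vanishing perimeter. *)
Lemma green_defect_exception :
  (forall x y, A <= x <= B -> C <= y <= D -> ~ (x = t /\ (y = C \/ y = D)) ->
    exists p p' q q', [/\ p = q', diff2 P x y p p' dom & diff2 Q x y q q' dom]) ->
  (exists del M : R, 0 < del /\ forall x y, dom x y -> `|x - t| <= del ->
     (y - C <= del \/ D - y <= del) -> `|P x y| <= M /\ `|Q x y| <= M) ->
  green_defect P Q A B C D = 0.
Proof.
move: (AB) (CD) (At) (tB) => AB' CD' At' tB' Hd [del [M [del0 HM]]].
have zero a b c d : A <= a -> a <= b -> b <= B -> C <= c -> c <= d -> d <= D ->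
    (forall x y, a <= x <= b -> c <= y <= d -> ~ (x = t /\ (y = C \/ y = D))) ->
    green_defect P Q a b c d = 0.
  move=> Aa ab bB Cc cd dD ne; apply: green_defect_eq0 => //.
  - by move=> x xab; apply: integrable_subitv Cc dD (Pi _); move: xab; lra.
  - by move=> y ycd; apply: integrable_subitv Aa bB (Qi _); move: ycd; lra.
  move=> x y xab ycd; have [||p [p' [q [q' [pq HP HQ]]]]] := Hd x y _ _ (ne x y xab ycd).
  - by move: xab; lra.
  - by move: ycd; lra.
  exists p, p', q, q'; split=> //.
    move=> e /HP[de de0 H]; exists de => // u v [uab vcd]; apply: H.
    by move: uab vcd; rewrite /dom; split; lra.
  move=> e /HQ[de de0 H]; exists de => // u v [uab vcd]; apply: H.
  by move: uab vcd; rewrite /dom; split; lra.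
have M0 : 0 <= M.
  have [] : `|P t C| <= M /\ `|Q t C| <= M.
    apply: HM; [split; lra | |].
      by rewrite subrr normr0 ltW.
    by left; rewrite subrr ltW.
  by move=> /(le_trans (normr_ge0 _)).
apply/eqP; rewrite -normr_le0 leNgt; apply/negP => J0.
set J0' := `|_| in J0.
(* The two corner cells have sides [2 * eta] and [eta], so their defects add up to at most
   [12 * M * eta], which is less than [13 * (M + 1) * eta <= J0']. The other bounds keep the cells
   inside the rectangle, disjoint, and within the region where [M] applies. *)
pose eta := Num.min (Num.min del ((D - C) / 3)) (Num.min (Num.min (t - A) (B - t)) (J0' / (13 * (M + 1)))).
have eta0 : 0 < eta.
  have h1 : 0 < (D - C) / 3 by lra.
  have h2 : 0 < J0' / (13 * (M + 1)) by rewrite divr_gt0// mulr_gt0// ltr_wpDl.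
  by rewrite !lt_min del0 h1 h2 !subr_gt0 At tB.
have eta1 : eta <= del by rewrite /eta !ge_min lexx.
have eta2 : eta <= (D - C) / 3 by rewrite /eta !ge_min lexx !orbT.
have eta3 : eta <= t - A by rewrite /eta !ge_min lexx !orbT.
have eta4 : eta <= B - t by rewrite /eta !ge_min lexx !orbT.
have eta5 : 13 * (M + 1) * eta <= J0'.
  by rewrite mulrC -ler_pdivlMr ?mulr_gt0 ?ltr_wpDl// /eta !ge_min lexx !orbT.
have a1 : A <= t - eta by lra.
have a2 : t - eta <= t + eta by lra.
have a3 : t + eta <= B by lra.
have a4 : t - eta <= B by exact: le_trans a2 a3.
have a5 : A <= t + eta by exact: le_trans a1 a2.
have b1 : C <= C + eta by lra.
have b2 : C + eta <= D - eta by lra.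
have b3 : D - eta <= D by lra.
have b4 : C + eta <= D by exact: le_trans b2 b3.
have b5 : C <= D - eta by exact: le_trans b1 b2.
have CD2 : C <= D by exact: ltW.
(* Cutting at [t - eta], [t + eta] and then the middle column at [C + eta], [D - eta] leaves two
   cells that contain exceptional points; all others have defect 0. *)
have E : green_defect P Q A B C D =
    green_defect P Q (t - eta) (t + eta) C (C + eta) +
    green_defect P Q (t - eta) (t + eta) (D - eta) D.
  rewrite (green_splitl Pi Qi (lexx A) a1 a4 (lexx B) (lexx C) CD2 (lexx D)).
  rewrite (green_splitl Pi Qi a1 a2 a3 (lexx B) (lexx C) CD2 (lexx D)).
  rewrite (zero _ _ _ _ (lexx A) a1 a4 (lexx C) CD2 (lexx D)); last first.
    by move=> x y /andP[_ h] _ [xt _]; move: h eta0; rewrite xt; lra.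
  rewrite (zero _ _ _ _ a5 a3 (lexx B) (lexx C) CD2 (lexx D)); last first.
    by move=> x y /andP[h _] _ [xt _]; move: h eta0; rewrite xt; lra.
  rewrite (green_splitr Pi Qi a1 a2 a3 (lexx C) b1 b4 (lexx D)).
  rewrite (green_splitr Pi Qi a1 a2 a3 b1 b2 b3 (lexx D)).
  rewrite (zero _ _ _ _ a1 a2 a3 b1 b2 b3); last first.
    by move=> x y _ /andP[h1 h2] [_ [] yE]; move: h1 h2 eta0; rewrite yE; lra.
  by rewrite add0r addr0 add0r.
have near_t x : t - eta <= x <= t + eta -> A <= x <= B /\ `|x - t| <= del.
  move=> /andP[h1 h2]; rewrite (le_trans a1 h1) (le_trans h2 a3); split=> //.
  by move: h1 h2 eta1; rewrite ler_norml; lra.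
have B1 : `|green_defect P Q (t - eta) (t + eta) C (C + eta)| <= 2 * M * ((t + eta - (t - eta)) + (C + eta - C)).
  apply: (green_defect_osc (p := 0) (q := 0) a1 a2 a3 (lexx C) b1 b4).
  move=> x y /near_t[xAB xt] /andP[h1 h2]; rewrite !subr0; apply: HM => //.
    by split=> //; rewrite h1 (le_trans h2 b4).
  by left; move: h2 eta1; lra.
have B2 : `|green_defect P Q (t - eta) (t + eta) (D - eta) D| <= 2 * M * ((t + eta - (t - eta)) + (D - (D - eta))).
  apply: (green_defect_osc (p := 0) (q := 0) a1 a2 a3 b5 b3 (lexx D)).
  move=> x y /near_t[xAB xt] /andP[h1 h2]; rewrite !subr0; apply: HM => //.
    by split=> //; rewrite h2 (le_trans b5 h1).
  by right; move: h1 eta1; lra.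
have : J0' <= 12 * M * eta.
  rewrite /J0' E; apply: le_trans (ler_normD _ _) _.
  by apply: le_trans (lerD B1 B2) _; lra.
have : 0 <= M * eta by rewrite mulr_ge0// ltW.
lra.
Qed.

End GreenException.

(** * Polar coordinates and means over circles *)

Section Polar.
Variable R : realType.
Notation leb := (@lebesgue_measure R).
Implicit Types (r s th : R) (h : Cx R -> Cx R).

Definition polar (r th : R) : Cx R := ((r * cos th) +i* (r * sin th))%C.

Lemma cmod_polar r th : 0 <= r -> cmod (polar r th) = r.
Proof.
move=> r0; rewrite /cmod /= !exprMn -mulrDr cos2Dsin2 mulr1 sqrtr_sqr ger0_norm//.
Qed.

Lemma polarM r s a b : polar r a * polar s b = polar (r * s) (a + b).
Proof. by apply: Cx_eq; rewrite ?ReM ?ImM /= ?cosD ?sinD; ring. Qed.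

Lemma polar0 r : polar r 0 = rC r.
Proof. by apply: Cx_eq; rewrite /= ?cos0 ?sin0 ?mulr1 ?mulr0. Qed.

Lemma polar2pi r : polar r (2 * pi) = rC r.
Proof.
have -> : 2 * pi = pi *+ 2 :> R by rewrite mulr_natl.
by apply: Cx_eq; rewrite /= ?cos2pi ?sin2pi ?mulr1 ?mulr0.
Qed.

Lemma polar_eq_rC r s th : 0 < r -> 0 < s -> 0 <= th <= 2 * pi -> polar r th = rC s ->
  r = s /\ (th = 0 \/ th = 2 * pi).
Proof.
move=> r0 s0 th2 E.
have rs : r = s by rewrite -(cmod_polar th (ltW r0)) E cmod_rC gtr0_norm.
split=> //; have c1 : cos th = 1.
  have := congr1 (@complex.Re R) E; rewrite /= rs => /(canRL (mulKf _)) -> //.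
    by rewrite mulVf ?gt_eqF.
  by rewrite gt_eqF.
have [thpi|pith] := leP th pi.
  left; have : cos th = cos 0 by rewrite cos0.
  by apply: cos_inj; rewrite in_itv/= ?lexx ?pi_ge0//; move: th2; lra.
right; have : cos (2 * pi - th) = cos 0.
  have -> : 2 * pi - th = pi + (pi - th) by ring.
  by rewrite cosD cospi sinpi cosB cospi sinpi cos0 c1; ring.
move/cos_inj; rewrite !in_itv/= lexx pi_ge0 => H.
suff : 2 * pi - th = 0 by move/eqP; rewrite subr_eq0 => /eqP.
by apply: H => //; move: th2; lra.
Qed.

Lemma is_derive_eps (f : R -> R) (x d : R) : is_derive x 1 f d ->
  forall e : R, 0 < e -> exists2 del : R, 0 < del &
    forall u, `|u| < del -> `|f (x + u) - f x - d * u| <= e * `|u|.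
Proof.
move=> [fd <-] e e0.
move/cvgrPdist_lt : fd => /(_ _ e0); rewrite near_withinE => -[del /= del0 H].
exists del => // u udel.
have [->|u0] := eqVneq u 0; first by rewrite addr0 subrr mulr0 subr0 normr0 mulr0.
have := H u; rewrite /= sub0r normrN => /(_ udel u0).
rewrite [u%:A]mulr1 [u + x]addrC distrC => /ltW.
rewrite -(ler_pM2r (_ : 0 < `|u|)) ?normr_gt0// -normrM; apply: le_trans.
rewrite le_eqVlt; apply/orP; left; apply/eqP; congr `|_|.
by rewrite mulrBl /GRing.scale/= mulrAC mulVf// mul1r.
Qed.

(** Since [polar (expR u) v] is exp(u + iv), this is the expansion exp(u + iv) = 1 + (u + iv) +
    o(|u| + |v|), obtained from the real derivatives of [expR], [cos] and [sin] at 0. *)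
Lemma polar_expR_near0 (e : R) : 0 < e -> exists2 del : R, 0 < del &
  forall u v, `|u| < del -> `|v| < del ->
    cmod (polar (expR u) v - 1 - (u +i* v)%C) <= e * (`|u| + `|v|).
Proof.
move=> e0.
have d1 : is_derive (0 : R) 1 expR (expR 0) by exact: is_derive_expR.
have d2 : is_derive (0 : R) 1 (@cos R) (- sin 0) by exact: is_derive_cos.
have d3 : is_derive (0 : R) 1 (@sin R) (cos 0) by exact: is_derive_sin.
pose e' := e / 10; have e'0 : 0 < e' by rewrite divr_gt0.
have [x1 x10 H1] := is_derive_eps d1 (ltac:(by rewrite lt_min ltr01 e'0) : 0 < Num.min 1 e').
have [x2 x20 H2] := is_derive_eps d2 e'0.
have [x3 x30 H3] := is_derive_eps d3 e'0.
pose x4 := Num.min (1/2) (e' / 2).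
have x40 : 0 < x4 by rewrite lt_min !divr_gt0.
exists (Num.min (Num.min x1 x2) (Num.min x3 x4)).
  by rewrite !lt_min x10 x20 x30 !divr_gt0.
move=> u v; rewrite !lt_min => /andP[/andP[u1 _] /andP[_ u4]] /andP[/andP[_ v2] /andP[v3 v4]].
have {}H1 := H1 _ u1; have {}H2 := H2 _ v2; have {}H3 := H3 _ v3.
move: H1 H2 H3; rewrite !add0r expR0 cos0 sin0 !mul1r oppr0 mul0r subr0 addr0 => H1 H2 H3.
have u0 : 0 <= `|u| by []. have v0 : 0 <= `|v| by [].
have {}H1 : `|expR u - 1 - u| <= e' * `|u| /\ `|expR u - 1 - u| <= `|u|.
  have m1 : Num.min 1 e' <= 1 by rewrite ge_min lexx.
  have m2 : Num.min 1 e' <= e' by rewrite ge_min lexx orbT.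
  split; apply: le_trans H1 _; first exact: ler_wpM2r.
  by have := ler_wpM2r u0 m1; rewrite mul1r.
have [H1a H1b] := H1.
have E1 : `|expR u - 1| <= 2 * `|u| by have := ler_norm u; have := ler_norm (- u); move: H1b; rewrite normrN !ler_norml; lra.
have [u5 u6] := andP u4.
have E2 : 0 <= expR u <= 2.
  by rewrite expR_ge0 /=; move: E1 u5; rewrite ler_norml; lra.
have EN : `|expR u| <= 2 by have /andP[h1 h2] := E2; rewrite ger0_norm.
have E3 : `|expR u - 1| <= e' by apply: le_trans E1 _; lra.
apply: le_trans (cmod_le_ReIm _) _.
rewrite /= oppr0 addr0.
have -> : expR u * cos v - 1 - u = (expR u - 1 - u) + expR u * (cos v - 1) by ring.
have -> : expR u * sin v - v = expR u * (sin v - v) + (expR u - 1) * v by ring.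
have B1 : `|expR u * (cos v - 1)| <= 2 * (e' * `|v|).
  by rewrite normrM; apply: ler_pM.
have B2 : `|expR u * (sin v - v)| <= 2 * (e' * `|v|).
  by rewrite normrM; apply: ler_pM.
have B3 : `|(expR u - 1) * v| <= e' * `|v| by rewrite normrM ler_wpM2r.
apply: le_trans (lerD (ler_normD _ _) (ler_normD _ _)) _.
have -> : e * (`|u| + `|v|) = 10 * (e' * `|u|) + 10 * (e' * `|v|) by rewrite /e'; field.
have := mulr_ge0 (ltW e'0) u0; have := mulr_ge0 (ltW e'0) v0; lra.
Qed.

Lemma cderiv_cont h z d : cderiv h z d ->
  forall e : R, 0 < e -> exists2 del : R, 0 < del &
    forall w, cmod (w - z) < del -> cmod (h w - h z) < e.
Proof.
move=> hd e e0; have [del del0 H] := hd 1 ltr01.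
have c0 : 0 < cmod d + 1 by rewrite ltr_wpDl ?cmod_ge0.
exists (Num.min del (e / (cmod d + 1))); first by rewrite lt_min del0 divr_gt0.
move=> w; rewrite lt_min ltr_pdivlMr// => /andP[/H H1 H2].
have -> : h w - h z = (h w - h z - d * (w - z)) + d * (w - z) by rewrite subrK.
apply: le_lt_trans (cmodD _ _) _; rewrite cmodM.
by move: H1 H2; lra.
Qed.

Lemma cderiv_continuous h z d : cderiv h z d -> {for z, continuous h}.
Proof.
move=> hd; apply/(@cvg_cxP _ _ (nbhs z)) => e e0.
have [del del0 H] := cderiv_cont hd e0.
by have := nbhs_cmod_ball z del0; apply: filterS => w /H.
Qed.

Lemma cvg_ReIm (T : Type) (F : set_system T) (u : T -> Cx R) (l : Cx R) : Filter F ->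
  (fun t => complex.Re (u t)) @ F --> complex.Re l ->
  (fun t => complex.Im (u t)) @ F --> complex.Im l -> u @ F --> l.
Proof.
move=> FF ur ui; apply/cvg_cxP => e e0.
have e2 : 0 < e / 2 by rewrite divr_gt0.
move/cvgrPdist_lt : ur => /(_ _ e2) ur; move/cvgrPdist_lt : ui => /(_ _ e2) ui.
apply: filterS2 ur ui => t rt it.
apply: le_lt_trans (cmod_le_ReIm _) _; rewrite ReB ImB.
rewrite distrC in rt; rewrite distrC in it; lra.
Qed.

Lemma cvg_Re (T : Type) (F : set_system T) (u : T -> Cx R) (l : Cx R) : Filter F ->
  u @ F --> l -> (fun t => complex.Re (u t)) @ F --> complex.Re l.
Proof.
move=> FF /cvg_cxP ul; apply/cvgrPdist_lt => e e0.
apply: filterS (ul e e0) => t; apply: le_lt_trans.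
by rewrite cmod_distC -ReB Re_le_cmod.
Qed.

Lemma cvg_Im (T : Type) (F : set_system T) (u : T -> Cx R) (l : Cx R) : Filter F ->
  u @ F --> l -> (fun t => complex.Im (u t)) @ F --> complex.Im l.
Proof.
move=> FF /cvg_cxP ul; apply/cvgrPdist_lt => e e0.
apply: filterS (ul e e0) => t; apply: le_lt_trans.
by rewrite cmod_distC -ImB Im_le_cmod.
Qed.

Lemma continuous_polar (T : topologicalType) (r th : T -> R) (x : T) :
  {for x, continuous r} -> {for x, continuous th} ->
  {for x, continuous (fun t => polar (r t) (th t))}.
Proof.
move=> cr cth; apply: cvg_ReIm => /=.
- apply: cvgM => //; apply: continuous_comp; [exact: cth|exact: continuous_cos].
- apply: cvgM => //; apply: continuous_comp; [exact: cth|exact: continuous_sin].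
Qed.

End Polar.

(** * Invariance of means over concentric circles *)

Section CircleMeans.
Variable R : realType.
Notation leb := (@lebesgue_measure R).
Implicit Types (r s th t : R) (h f g : Cx R -> Cx R) (z w : Cx R).

Definition cdiff f z := exists d, cderiv f z d.

Lemma cdiff_continuous f z : cdiff f z -> {for z, continuous f}.
Proof. by case=> d /cderiv_continuous. Qed.

Lemma cdiff_near f g z (del : R) : 0 < del ->
  (forall w, cmod (w - z) < del -> f w = g w) -> cdiff f z -> cdiff g z.
Proof.
move=> del0 fg [d fd]; exists d => e e0; have [del' del'0 H] := fd e e0.
exists (Num.min del del'); first by rewrite lt_min del0.
move=> w; rewrite lt_min => /andP[wd wd']; rewrite -!fg//; first exact: H.
by rewrite subrr cmod0.
Qed.

Lemma cdiff_cst (c : Cx R) z : cdiff (fun=> c) z.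
Proof. by exists 0 => e e0; exists 1 => // w _; rewrite subrr mul0r subr0 cmod0 mulr_ge0 ?cmod_ge0// ltW. Qed.

Lemma cdiff_id z : cdiff (fun w => w) z.
Proof. by exists 1 => e e0; exists 1 => // w _; rewrite mul1r subrr cmod0 mulr_ge0 ?cmod_ge0// ltW. Qed.

Lemma cdiffD f g z : cdiff f z -> cdiff g z -> cdiff (fun w => f w + g w) z.
Proof. by move=> /derivable_cderiv fd /derivable_cderiv gd; apply/derivable_cderiv/derivableD. Qed.

Lemma cdiffB f g z : cdiff f z -> cdiff g z -> cdiff (fun w => f w - g w) z.
Proof. by move=> /derivable_cderiv fd /derivable_cderiv gd; apply/derivable_cderiv/derivableB. Qed.

Lemma cdiffM f g z : cdiff f z -> cdiff g z -> cdiff (fun w => f w * g w) z.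
Proof.
move=> /derivable_cderiv fd /derivable_cderiv gd; apply/derivable_cderiv.
exact (@derivableM _ _ (f : R[i]^o -> R[i]) (g : R[i]^o -> R[i]) z 1 fd gd).
Qed.

Lemma cdiffV f z : f z != 0 -> cdiff f z -> cdiff (fun w => (f w)^-1) z.
Proof.
move=> f0 /derivable_cderiv fd; apply/derivable_cderiv.
exact (@derivableV _ _ (f : R[i]^o -> R[i]) z 1 f0 fd).
Qed.

Lemma cdiff_div f g z : g z != 0 -> cdiff f z -> cdiff g z -> cdiff (fun w => f w / g w) z.
Proof. by move=> g0 fd gd; apply: cdiffM => //; exact: cdiffV. Qed.

Lemma cdiffX f z n : cdiff f z -> cdiff (fun w => f w ^+ n) z.
Proof.
move=> fd; elim: n => [|n IH]; first exact: cdiff_cst.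
by under [X in cdiff X]eq_fun do rewrite exprS; exact: cdiffM.
Qed.

Lemma cdiff_scale f (c z : Cx R) : cdiff f (c * z) -> cdiff (fun w => f (c * w)) z.
Proof.
move=> [d fd]; exists (d * c) => e e0.
have c0 : 0 < cmod c + 1 by rewrite ltr_wpDl ?cmod_ge0.
have [del del0 H] := fd _ (divr_gt0 e0 c0).
exists (del / (cmod c + 1)); first exact: divr_gt0.
move=> w wz; have E : c * w - c * z = c * (w - z) by rewrite mulrBr.
have := H (c * w); rewrite E -mulrA => /(_ _)/le_trans; apply.
  rewrite cmodM; apply: le_lt_trans (_ : (cmod c + 1) * cmod (w - z) < _).
    by rewrite ler_wpM2r ?cmod_ge0// lerDl.
  by rewrite mulrC -ltr_pdivlMr.
rewrite cmodM mulrA ler_wpM2r ?cmod_ge0// -mulrA mulrC.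
by rewrite -[leRHS]mul1r ler_wpM2r ?(ltW e0)// mulrC ler_pdivrMr// mul1r lerDl.
Qed.

Lemma continuous_cmod z : {for z, continuous (@cmod R)}.
Proof.
apply/(@cvgrPdist_lt _ _ _ (nbhs z)) => e e0.
have := nbhs_cmod_ball z e0; apply: filterS => w /=; apply: le_lt_trans.
rewrite ler_norml; have := cmod_ger_dist z w; have := cmod_ger_dist w z.
by rewrite (cmod_distC z w); lra.
Qed.

Lemma integrable_circle (g : Cx R -> R) r : 0 <= r ->
  (forall z, cmod z = r -> {for z, continuous g}) ->
  leb.-integrable `[0, 2 * pi] (EFin \o (fun th => g (polar r th))).
Proof.
move=> r0 gc; apply: continuous_compact_integrable; first exact: segment_compact.
apply: continuous_subspaceT => th.
apply: (@continuous_comp _ _ _ (polar r) g); last by apply: gc; rewrite cmod_polar.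
by apply: continuous_polar => //; exact: cvg_cst.
Qed.

(** The chain rule for h(exp(s + i th)): the exponential is its own derivative, so the derivative of
    the composite is [d] times the point [polar (expR s0) th0]. *)
Lemma polar_chain h s0 th0 d : cderiv h (polar (expR s0) th0) d ->
  forall e : R, 0 < e -> exists2 del : R, 0 < del & forall s th,
    `|s - s0| < del -> `|th - th0| < del ->
    cmod (h (polar (expR s) th) - h (polar (expR s0) th0) -
          d * polar (expR s0) th0 * ((s - s0) +i* (th - th0))%C)
    <= e * (`|s - s0| + `|th - th0|).
Proof.
set z0 := polar (expR s0) th0 => hd e e0.
pose m := expR s0; have m0 : 0 < m by exact: expR_gt0.
have cz0 : cmod z0 = m by rewrite cmod_polar// ltW.
have D0 : 0 <= cmod d * m by rewrite mulr_ge0 ?cmod_ge0// ltW.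
have e10 : 0 < e / (4 * m) by rewrite divr_gt0// mulr_gt0.
have [x1 x10 H1] := hd _ e10.
pose e2 := Num.min 1 (e / (2 * (cmod d * m + 1))).
have D1 : 0 < 2 * (cmod d * m + 1) by lra.
have e20 : 0 < e2 by rewrite lt_min ltr01 divr_gt0.
have e21 : e2 <= 1 by rewrite ge_min lexx.
have e22 : cmod d * m * e2 <= e / 2.
  have : e2 <= e / (2 * (cmod d * m + 1)) by rewrite ge_min lexx orbT.
  rewrite ler_pdivlMr// => h1; have := mulr_ge0 D0 (ltW e20); lra.
have [x2 x20 H2] := polar_expR_near0 e20.
exists (Num.min x2 (x1 / (4 * m))).
  by rewrite lt_min x20 divr_gt0// mulr_gt0.
move=> s th; rewrite !lt_min => /andP[s1 s2] /andP[t1 t2].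
set u := s - s0; set v := th - th0.
have zE : polar (expR s) th = z0 * polar (expR u) v.
  by rewrite polarM -expRD /u /v (addrC s0) (addrC th0) !subrK.
set S := `|u| + `|v|.
have S0 : 0 <= S by rewrite addr_ge0.
have cuv : cmod (u +i* v)%C <= S by exact: cmod_le_ReIm.
have A1 : cmod (polar (expR u) v - 1 - (u +i* v)%C) <= e2 * S by exact: H2.
have A2 : cmod (polar (expR u) v - 1) <= 2 * S.
  rewrite -[X in cmod X](subrK (u +i* v)%C); apply: le_trans (cmodD _ _) _.
  have := ler_wpM2r S0 e21; lra.
have A3 : cmod (polar (expR s) th - z0) <= 2 * m * S.
  rewrite zE -[X in _ - X]mulr1 -mulrBr cmodM cz0.
  by have := ler_wpM2l (ltW m0) A2; lra.
have A4 : cmod (polar (expR s) th - z0) < x1.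
  apply: le_lt_trans A3 _.
  by move: s2 t2; rewrite !ltr_pdivlMr ?mulr_gt0// -/u -/v /S; lra.
have {}H1 := H1 _ A4.
have -> : h (polar (expR s) th) - h z0 - d * z0 * (u +i* v)%C =
   (h (polar (expR s) th) - h z0 - d * (polar (expR s) th - z0)) +
   d * z0 * (polar (expR u) v - 1 - (u +i* v)%C) by rewrite zE; ring.
apply: le_trans (cmodD _ _) _; rewrite !cmodM cz0.
have B1 : e / (4 * m) * cmod (polar (expR s) th - z0) <= e / 2 * S.
  apply: le_trans (ler_wpM2l (ltW e10) A3) _.
  by rewrite le_eqVlt; apply/orP; left; apply/eqP; field; rewrite gt_eqF.
have B2 : cmod d * m * cmod (polar (expR u) v - 1 - (u +i* v)%C) <= e / 2 * S.
  apply: le_trans (ler_wpM2l D0 A1) _; rewrite mulrA ler_wpM2r//.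
lra.
Qed.

(** In logarithmic polar coordinates the Cauchy-Riemann equations keep their Cartesian form. The
    equation [p = q'] is the one that makes [Re h dth + Im h ds] a closed form. *)
Lemma polar_diff2 h s0 th0 dom : cdiff h (polar (expR s0) th0) ->
  exists p p' q q', [/\ p = q',
    diff2 (fun s th => complex.Re (h (polar (expR s) th))) s0 th0 p p' dom &
    diff2 (fun s th => complex.Im (h (polar (expR s) th))) s0 th0 q q' dom].
Proof.
move=> [d /polar_chain]; move: (d * polar (expR s0) th0) => D H.
exists (complex.Re D), (- complex.Im D), (complex.Im D), (complex.Re D); split=> //.
- move=> e /H[del del0 {}H]; exists del => // s th _ /H /[apply].
  apply: le_trans; apply: le_trans (Re_le_cmod _).
  by rewrite !ReB ReM /= le_eqVlt; apply/orP; left; apply/eqP; congr `|_|; ring.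
- move=> e /H[del del0 {}H]; exists del => // s th _ /H /[apply].
  apply: le_trans; apply: le_trans (Im_le_cmod _).
  by rewrite !ImB ImM /= le_eqVlt; apply/orP; left; apply/eqP; congr `|_|; ring.
Qed.

Section invariance.
Variables (h : Cx R -> Cx R) (a b : R).
Hypothesis ab : a < b.
Hypothesis hc : forall z, expR a <= cmod z <= expR b -> {for z, continuous h}.

Let annulus s th : a <= s <= b -> expR a <= cmod (polar (expR s) th) <= expR b.
Proof. by rewrite cmod_polar ?expR_ge0// !ler_expR. Qed.

Let Pi s : a <= s <= b ->
  leb.-integrable `[0, 2 * pi] (EFin \o (fun th => complex.Re (h (polar (expR s) th)))).
Proof.
move=> sab; apply: (@integrable_circle (fun z => complex.Re (h z))); rewrite ?expR_ge0//.
move=> z zs; have hz : {for z, continuous h} by apply: hc; rewrite zs !ler_expR.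
exact: (cvg_Re _ hz).
Qed.

Let Qi th : leb.-integrable `[a, b] (EFin \o (fun s => complex.Im (h (polar (expR s) th)))).
Proof.
apply: continuous_compact_integrable; first exact: segment_compact.
apply: continuous_in_subspaceT => s; rewrite inE/= in_itv/= => sab.
have ch : {for s, continuous (h \o (fun s => polar (expR s) th))}.
  apply: continuous_comp; last by apply: hc; exact: annulus.
  by apply: continuous_polar; [exact: continuous_expR|exact: cvg_cst].
exact: (cvg_Im _ ch).
Qed.

(** The sides [th = 0] and [th = 2 * pi] are the same segment of the disc, so the integrals of the
    imaginary part along them cancel and the means over the two circles remain. *)
Let close : green_defect (fun s th => complex.Re (h (polar (expR s) th)))
      (fun s th => complex.Im (h (polar (expR s) th))) a b 0 (2 * pi) = 0 ->
  \int[leb]_(th in `[0, 2 * pi]) complex.Re (h (polar (expR b) th)) =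
  \int[leb]_(th in `[0, 2 * pi]) complex.Re (h (polar (expR a) th)).
Proof.
rewrite /green_defect.
under [X in _ - X]eq_Rintegral do rewrite polar2pi polar0 subrr.
have Pa := Pi (ltac:(by rewrite lexx ltW) : a <= a <= b).
have Pb := Pi (ltac:(by rewrite lexx ltW) : a <= b <= b).
rewrite Rintegral_cst; last exact: measurable_itv.
rewrite mul0r subr0 (RintegralB _ Pb Pa); last exact: measurable_itv.
by move/eqP; rewrite subr_eq0 => /eqP.
Qed.

Lemma circle_invariance_expR :
  (forall z, expR a <= cmod z <= expR b -> cdiff h z) ->
  \int[leb]_(th in `[0, 2 * pi]) complex.Re (h (polar (expR b) th)) =
  \int[leb]_(th in `[0, 2 * pi]) complex.Re (h (polar (expR a) th)).
Proof.
move=> hd; apply: close; apply: green_defect_eq0.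
- exact: ltW.
- by apply: mulr_ge0 => //; exact: pi_ge0.
- exact: Pi.
- by move=> th _; exact: Qi.
- by move=> s th sab _; apply: polar_diff2; apply: hd; exact: annulus.
Qed.

Lemma circle_invariance_exception_expR t : a < t < b ->
  (forall z, expR a <= cmod z <= expR b -> z != rC (expR t) -> cdiff h z) ->
  \int[leb]_(th in `[0, 2 * pi]) complex.Re (h (polar (expR b) th)) =
  \int[leb]_(th in `[0, 2 * pi]) complex.Re (h (polar (expR a) th)).
Proof.
move=> /andP[a_t tb] hd; have pi2 : 0 < 2 * pi :> R by apply: mulr_gt0 => //; exact: pi_gt0.
apply: close; apply: (@green_defect_exception _ _ _ _ _ _ _ t).
- exact: ltW.
- exact: pi2.
- exact: a_t.
- exact: tb.
- exact: Pi.
- by move=> th _; exact: Qi.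
- move=> s th sab thpi ne; apply: polar_diff2; apply: hd; first exact: annulus.
  apply/negP => /eqP E; apply: ne.
  have [/expR_inj-> H] := polar_eq_rC (expR_gt0 _) (expR_gt0 _) thpi E.
  by split.
pose z0 := rC (expR t).
have cz0 : {for z0, continuous h}.
  by apply: hc; rewrite cmod_rC ger0_norm ?expR_ge0// !ler_expR !ltW.
have /(@cvg_cxP _ _ (nbhs z0)) /(_ 1 ltr01) nz0 : h @ z0 --> h z0 by exact: cz0.
(* The exceptional point is seen at both (t, 0) and (t, 2 pi); continuity of [h] bounds the two
   components near each of them. *)
have c1 : {for (t, 0), continuous (fun x : R * R => polar (expR x.1) x.2)}.
  apply: continuous_polar; last exact: cvg_snd.
  by apply: continuous_comp; [exact: cvg_fst|exact: continuous_expR].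
have c2 : {for (t, 2 * pi), continuous (fun x : R * R => polar (expR x.1) x.2)}.
  apply: continuous_polar; last exact: cvg_snd.
  by apply: continuous_comp; [exact: cvg_fst|exact: continuous_expR].
have N1 : nbhs (polar (expR t) 0) [set w | cmod (h w - h z0) < 1].
  by rewrite polar0; exact: nz0.
have N2 : nbhs (polar (expR t) (2 * pi)) [set w | cmod (h w - h z0) < 1].
  rewrite polar2pi; exact: nz0.
have M1 : nbhs ((t, 0) : R * R) [set x | cmod (h (polar (expR x.1) x.2) - h z0) < 1].
  exact: (c1 _ N1).
have M2 : nbhs ((t, 2 * pi) : R * R) [set x | cmod (h (polar (expR x.1) x.2) - h z0) < 1].
  exact: (c2 _ N2).
have [d1 /= d10 H1] := (@nbhs_ballP R _ _ _).1 M1.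
have [d2 /= d20 H2] := (@nbhs_ballP R _ _ _).1 M2.
have bnd w : cmod (h w - h z0) < 1 -> `|complex.Re (h w)| <= cmod (h z0) + 1 /\
    `|complex.Im (h w)| <= cmod (h z0) + 1.
  move=> hw; have : cmod (h w) <= cmod (h z0) + 1.
    by have := cmod_ger_dist (h w) (h z0); lra.
  by move=> hw'; split; apply: le_trans hw'; [exact: Re_le_cmod|exact: Im_le_cmod].
exists (Num.min (d1 / 2) (d2 / 2)), (cmod (h z0) + 1); split.
  by rewrite lt_min !divr_gt0.
move=> s th [sab th2]; rewrite !le_min => /andP[s1 s2] [/andP[t1 t1']|/andP[t2' t2]].
  apply: bnd; apply: (H1 (s, th)); split => /=; rewrite /ball/= distrC; first lra.
  by rewrite subr0 ger0_norm; lra.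
apply: bnd; apply: (H2 (s, th)); split => /=; rewrite /ball/=; first by rewrite distrC; lra.
by rewrite ger0_norm; lra.
Qed.

End invariance.

(** The integral over th is, up to the factor i, the integral of h(z)/z dz over the circle, so this
    is Cauchy's theorem on an annulus, with [s = ln r] as the radial coordinate. *)
Lemma circle_invariance h r1 r2 : 0 < r1 -> r1 <= r2 ->
  (forall z, r1 <= cmod z <= r2 -> cdiff h z) ->
  \int[leb]_(th in `[0, 2 * pi]) complex.Re (h (polar r2 th)) =
  \int[leb]_(th in `[0, 2 * pi]) complex.Re (h (polar r1 th)).
Proof.
move=> r10; rewrite le_eqVlt => /predU1P[->//|r12] hd.
have r20 : 0 < r2 by exact: lt_trans r12.
rewrite -(lnK r10) -(lnK r20); apply: circle_invariance_expR.
- by rewrite ltr_ln.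
- by move=> z; rewrite !lnK// => /hd /cdiff_continuous.
- by move=> z; rewrite !lnK// => /hd.
Qed.

Lemma circle_invariance_exception h r1 r2 t : 0 < r1 -> r1 < t -> t < r2 ->
  (forall z, r1 <= cmod z <= r2 -> {for z, continuous h}) ->
  (forall z, r1 <= cmod z <= r2 -> z != rC t -> cdiff h z) ->
  \int[leb]_(th in `[0, 2 * pi]) complex.Re (h (polar r2 th)) =
  \int[leb]_(th in `[0, 2 * pi]) complex.Re (h (polar r1 th)).
Proof.
move=> r10 r1t tr2 hc hd.
have t0 : 0 < t by exact: lt_trans r1t. have r20 : 0 < r2 by exact: lt_trans tr2.
rewrite -(lnK r10) -(lnK r20); apply: (@circle_invariance_exception_expR _ _ _ _ _ (ln t)).
- by rewrite ltr_ln// (lt_trans r1t).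
- by move=> z; rewrite !lnK// => /hc.
- by rewrite !ltr_ln// r1t.
- by move=> z; rewrite !lnK// => /hd.
Qed.

End CircleMeans.

(** * Cauchy's formula on an annulus *)

Section AnnulusBound.
Variable R : realType.
Notation leb := (@lebesgue_measure R).
Implicit Types (r s th t : R) (h f g : Cx R -> Cx R) (z w : Cx R).
Local Notation circle_int g r := (\int[leb]_(th in `[0, 2 * pi]) g (polar r th)).

Let pi2_gt0 : 0 < 2 * pi :> R.
Proof. by rewrite mulr_gt0// pi_gt0. Qed.

Lemma sub_rC_neq0 z t : 0 <= t -> cmod z != t -> z - rC t != 0.
Proof. by move=> t0; apply: contra; rewrite subr_eq0 => /eqP ->; rewrite cmod_rC ger0_norm. Qed.

Lemma cdiff_kernel z t : 0 <= t -> cmod z != t -> cdiff (fun w => w / (w - rC t)) z.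
Proof.
move=> t0 zt; apply: cdiff_div; [exact: sub_rC_neq0|exact: cdiff_id|].
by apply: cdiffB; [exact: cdiff_id|exact: cdiff_cst].
Qed.

Lemma le_circle_int (g1 g2 : Cx R -> R) r : 0 <= r ->
  (forall z, cmod z = r -> {for z, continuous g1}) ->
  (forall z, cmod z = r -> {for z, continuous g2}) ->
  (forall z, cmod z = r -> g1 z <= g2 z) -> circle_int g1 r <= circle_int g2 r.
Proof.
move=> r0 c1 c2 g12; apply: le_Rintegral; [exact: measurable_itv|exact: integrable_circle..|].
by move=> th _; apply: g12; rewrite cmod_polar.
Qed.

Lemma circle_int_dist (g : Cx R -> R) r (k e : R) : 0 <= r ->
  (forall z, cmod z = r -> {for z, continuous g}) ->
  (forall z, cmod z = r -> `|g z - k| <= e) ->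
  `|circle_int g r - k * (2 * pi)| <= e * (2 * pi).
Proof.
move=> r0 gc gk; rewrite -[X in k * X]subr0 -[X in e * X]subr0.
apply: (Rintegral_itv_bound (ltW pi2_gt0)); first exact: integrable_circle.
by move=> th _; apply: gk; rewrite cmod_polar.
Qed.

Lemma continuous_Re h z : {for z, continuous h} -> {for z, continuous (fun w => complex.Re (h w))}.
Proof. by move=> hz; exact: (cvg_Re _ hz). Qed.

Lemma continuous_cmod_comp h z : {for z, continuous h} -> {for z, continuous (fun w => cmod (h w))}.
Proof. by move=> hz; apply: (continuous_comp hz); exact: continuous_cmod. Qed.

(** The circle can be enlarged without changing the integral, and far away the kernel is close to 1.
    The radius [S] is chosen so large that the deviation, at most [t / (S - t) * (2 * pi)], falls
    below the assumed error [e]. *)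
Lemma kernel_mean_outer t s : 0 <= t -> t < s ->
  circle_int (fun z => complex.Re (z / (z - rC t))) s = 2 * pi.
Proof.
move=> t0 ts; set I := circle_int _ _.
apply/eqP; rewrite -subr_eq0 -normr_le0 leNgt; apply/negP => J0; set e := `|_| in J0.
pose S := s + 2 * pi * t / e.
have sS : s <= S by rewrite /S lerDl divr_ge0// ?(ltW J0)// mulr_ge0// ltW.
have s0 : 0 < s by exact: le_lt_trans ts.
have tS : 0 < S - t by lra.
have IE : I = circle_int (fun z => complex.Re (z / (z - rC t))) S.
  apply: esym; apply: (@circle_invariance _ (fun z => z / (z - rC t)) s S) => // z /andP[sz _].
  by apply: cdiff_kernel => //; rewrite gt_eqF// (lt_le_trans ts).
have : `|I - 1 * (2 * pi)| <= t / (S - t) * (2 * pi).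
  rewrite IE; apply: (@circle_int_dist (fun z => complex.Re (z / (z - rC t))) S 1); first by lra.
    move=> z zS; apply/continuous_Re/cdiff_continuous/cdiff_kernel => //.
    by rewrite zS gt_eqF//; lra.
  move=> z zS; have zt : z - rC t != 0 by apply: sub_rC_neq0 => //; rewrite zS gt_eqF//; lra.
  rewrite -[1]/(complex.Re (1 : Cx R)) -ReB; apply: le_trans (Re_le_cmod _) _.
  have -> : z / (z - rC t) - 1 = rC t / (z - rC t).
    by rewrite -[X in _ - X](divff zt) -mulrBl opprB addrC subrK.
  rewrite cmod_div cmod_rC ger0_norm// ler_wpM2l// lef_pV2 ?posrE//.
    by have := cmod_ger_dist z (rC t); rewrite zS cmod_rC ger0_norm.
  by rewrite cmod_gt0.
rewrite mul1r -/e mulrAC ler_pdivlMr// /S.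
have -> : e * (s + 2 * pi * t / e - t) = e * (s - t) + 2 * pi * t.
  by field; rewrite gt_eqF.
have : 0 < e * (s - t) by rewrite mulr_gt0// subr_gt0.
lra.
Qed.

(** Here the circle is shrunk towards 0, where the kernel vanishes; [S] makes the integral at most
    [e / 2]. *)
Lemma kernel_mean_inner t s : 0 < s -> s < t ->
  circle_int (fun z => complex.Re (z / (z - rC t))) s = 0.
Proof.
move=> s0 st; set I := circle_int _ _.
have t0 : 0 < t by exact: lt_trans st.
apply/eqP; rewrite -normr_le0 leNgt; apply/negP => e0; set e := `|_| in e0.
pose S := Num.min s (e * (t - s) / (4 * pi)).
have pi4 : 0 < 4 * pi :> R by rewrite mulr_gt0// pi_gt0.
have ts : 0 < t - s by lra.
have S0 : 0 < S by rewrite lt_min s0 divr_gt0// mulr_gt0.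
have Ss : S <= s by rewrite ge_min lexx.
have IE : I = circle_int (fun z => complex.Re (z / (z - rC t))) S.
  apply: (@circle_invariance _ (fun z => z / (z - rC t)) S s) => // z /andP[_ zs].
  by apply: cdiff_kernel; [exact: ltW|rewrite lt_eqF// (le_lt_trans zs)].
have : `|I - 0 * (2 * pi)| <= S / (t - s) * (2 * pi).
  rewrite IE; apply: (@circle_int_dist (fun z => complex.Re (z / (z - rC t))) S 0); first exact: ltW.
    move=> z zS; apply/continuous_Re/cdiff_continuous/cdiff_kernel; first exact: ltW.
    by rewrite zS lt_eqF//; lra.
  move=> z zS; rewrite subr0; apply: le_trans (Re_le_cmod _) _.
  rewrite cmod_div zS; apply: ler_wpM2l; first exact: ltW.
  have B : t - s <= cmod (z - rC t).
    rewrite cmod_distC; have := cmod_ger_dist (rC t) z.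
    by rewrite zS cmod_rC gtr0_norm//; lra.
  by rewrite lef_pV2 ?posrE// (lt_le_trans ts).
rewrite mul0r subr0 -/e.
have SE : S <= e * (t - s) / (4 * pi) by rewrite ge_min lexx orbT.
have : S / (t - s) * (2 * pi) <= e * (t - s) / (4 * pi) / (t - s) * (2 * pi).
  by rewrite ler_wpM2r ?(ltW pi2_gt0)// ler_wpM2r// invr_ge0 ltW.
have -> : e * (t - s) / (4 * pi) / (t - s) * (2 * pi) = e / 2.
  have aux (x y p : R) : y != 0 -> p != 0 -> x * y / (4 * p) / y * (2 * p) = x / 2.
    by move=> y0 p0; field; rewrite y0 p0.
  by apply: aux; rewrite gt_eqF// pi_gt0.
lra.
Qed.

(** The function [z (h z - h t) / (z - t)] has equal means over both circles. The kernel
    [z / (z - t)] has mean 1 over the outer circle and 0 over the inner one, so the difference of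
    the means of [h z * (z / (z - t))] is [h t]. *)
Lemma annulus_bound h r1 r2 t : 0 < r1 -> r1 < t -> t < r2 ->
  (forall z, r1 <= cmod z <= r2 -> cdiff h z) ->
  cmod (h (rC t)) * (2 * pi) <=
    circle_int (fun z => cmod (h z * (z / (z - rC t)))) r2 +
    circle_int (fun z => cmod (h z * (z / (z - rC t)))) r1.
Proof.
move=> r10 r1t tr2 hd.
have t0 : 0 < t by lra. have r20 : 0 < r2 by lra.
have ctt : cmod (rC t) = t by rewrite cmod_rC gtr0_norm.
have [->|ht0] := eqVneq (h (rC t)) 0.
  by rewrite cmod0 mul0r addr_ge0//; apply: Rintegral_ge0 => th _; exact: cmod_ge0.
pose m := cmod (h (rC t)); have m0 : 0 < m by rewrite cmod_gt0.
(* Multiplying by the unimodular [c] makes [h t] real, so that real parts suffice. *)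
pose c := rC m / h (rC t).
have cc : cmod c = 1 by rewrite cmod_div cmod_rC gtr0_norm// divff// gt_eqF.
have cht : c * h (rC t) = rC m by rewrite /c divfK.
have [d hdt] : cdiff h (rC t) by apply: hd; rewrite ctt !ltW.
(* With the value [d] at [t] the quotient is continuous there, but its differentiability at [t] is
   not yet known; this is the point that [circle_invariance_exception] leaves out. *)
pose q z := if z == rC t then d else (h z - h (rC t)) / (z - rC t).
pose G z := c * z * q z.
have qd z : r1 <= cmod z <= r2 -> z != rC t -> cdiff q z.
  move=> zr zt; have del0 : 0 < cmod (z - rC t) by rewrite cmod_gt0 subr_eq0.
  apply: (@cdiff_near _ (fun w => (h w - h (rC t)) / (w - rC t)) _ _ _ del0).
    move=> w wz; rewrite /q ifF//; apply/eqP => wt.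
    by move: wz; rewrite wt cmod_distC ltxx.
  apply: cdiff_div; first by rewrite subr_eq0.
    by apply: cdiffB; [exact: hd|exact: cdiff_cst].
  by apply: cdiffB; [exact: cdiff_id|exact: cdiff_cst].
have qc : {for rC t, continuous q}.
  apply/(@cvg_cxP _ _ (nbhs (rC t))) => e e0.
  have e20 : 0 < e / 2 by rewrite divr_gt0.
  have [del del0 H] := hdt _ e20.
  have := nbhs_cmod_ball (rC t) del0; apply: filterS => w /= wt.
  rewrite /q eqxx; case: eqVneq => [_|wtn]; first by rewrite subrr cmod0.
  have wt0 : w - rC t != 0 by rewrite subr_eq0.
  have -> : (h w - h (rC t)) / (w - rC t) - d = (h w - h (rC t) - d * (w - rC t)) / (w - rC t).
    by rewrite [RHS]mulrBl mulfK.
  rewrite cmod_div ltr_pdivrMr ?cmod_gt0//; apply: le_lt_trans (H _ wt) _.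
  by rewrite ltr_pM2r ?cmod_gt0//; lra.
have Gd z : r1 <= cmod z <= r2 -> z != rC t -> cdiff G z.
  move=> zr zt; apply: cdiffM; last exact: qd.
  by apply: cdiffM; [exact: cdiff_cst|exact: cdiff_id].
have Gc z : r1 <= cmod z <= r2 -> {for z, continuous G}.
  move=> zr; have [->|zt] := eqVneq z (rC t); last exact/cdiff_continuous/Gd.
  have cz : {for rC t, continuous (fun z => c * z)}.
    by apply/cdiff_continuous/cdiffM; [exact: cdiff_cst|exact: cdiff_id].
  exact (@cvgM R[i] _ (nbhs (rC t)) _ _ _ _ _ cz qc).
pose k z := z / (z - rC t).
have kd z : cmod z != t -> cdiff k z by move=> zt; apply: cdiff_kernel => //; exact: ltW.
have cknd r : (r == r1) || (r == r2) -> [/\ 0 <= r, r != t & r1 <= r <= r2].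
  have r12 : r1 <= r2 by lra.
  move=> /orP[]/eqP->; split; rewrite ?lexx ?r12 ?(ltW r10) ?(ltW r20)//.
    by rewrite lt_eqF.
  by rewrite gt_eqF.
have split r : (r == r1) || (r == r2) ->
    circle_int (fun z => complex.Re (G z)) r =
    circle_int (fun z => complex.Re (c * (h z * k z))) r - m * circle_int (fun z => complex.Re (k z)) r.
  move=> /cknd[r0 rt rr].
  have ik : leb.-integrable `[0, 2 * pi] (EFin \o (fun th => complex.Re (k (polar r th)))).
    apply: (@integrable_circle _ (fun z => complex.Re (k z)) _ r0) => z zr.
    by apply/continuous_Re/cdiff_continuous/kd; rewrite zr.
  rewrite -RintegralZl//.
  rewrite -RintegralB//; last 2 first.
  - apply: (@integrable_circle _ (fun z => complex.Re (c * (h z * k z))) _ r0) => z zr.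
    apply/continuous_Re/cdiff_continuous/cdiffM; first exact: cdiff_cst.
    by apply: cdiffM; [apply: hd; rewrite zr|apply: kd; rewrite zr].
  - apply: (@integrable_circle _ (fun z => m * complex.Re (k z)) _ r0) => z zr.
    have ck : {for z, continuous (fun z => complex.Re (k z))}.
      by apply/continuous_Re/cdiff_continuous/kd; rewrite zr.
    exact (@cvgM R _ (nbhs z) _ (fun=> m) _ _ _ (cvg_cst m) ck).
  apply: eq_Rintegral => th _; set z := polar r th.
  have zt : z != rC t.
    by apply: contra rt => /eqP /(congr1 (@cmod R)); rewrite cmod_polar// ctt => ->.
  have -> : m * complex.Re (k z) = complex.Re (rC m * k z).
    by case: (k z) => x y /=; rewrite mul0r subr0.
  rewrite -ReB; congr complex.Re; rewrite /G /q (negbTE zt) -cht /k.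
  by ring.
have E : circle_int (fun z => complex.Re (G z)) r2 = circle_int (fun z => complex.Re (G z)) r1.
  exact: (@circle_invariance_exception _ G _ _ t).
move: E; rewrite !split ?eqxx ?orbT// kernel_mean_outer ?(ltW t0)// kernel_mean_inner//.
rewrite mulr0 subr0 -/m => E.
have B r : (r == r1) || (r == r2) ->
    `|circle_int (fun z => complex.Re (c * (h z * k z))) r| <= circle_int (fun z => cmod (h z * k z)) r.
  move=> /cknd[r0 rt rr].
  have hk z : cmod z = r -> cdiff (fun z => h z * k z) z.
    by move=> zr; apply: cdiffM; [apply: hd; rewrite zr|apply: kd; rewrite zr].
  have chk z : cmod z = r -> cdiff (fun z => c * (h z * k z)) z.
    by move=> zr; apply: cdiffM; [exact: cdiff_cst|exact: hk].
  apply: le_trans (le_normr_Rintegral _ _) _; first exact: measurable_itv.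
    apply: (@integrable_circle _ (fun z => complex.Re (c * (h z * k z))) _ r0) => z zr.
    exact/continuous_Re/cdiff_continuous/chk.
  apply: (@le_circle_int (fun z => `|complex.Re (c * (h z * k z))|) (fun z => cmod (h z * k z))) => // z zr.
  - have cRe : {for z, continuous (fun z => complex.Re (c * (h z * k z)))}.
      exact/continuous_Re/cdiff_continuous/chk.
    exact: (cvg_norm cRe).
  - exact/continuous_cmod_comp/cdiff_continuous/hk.
  - by apply: le_trans (Re_le_cmod _) _; rewrite cmodM cc mul1r.
have := B r1; have := B r2; rewrite !eqxx orbT => /(_ isT) B2 /(_ isT) B1.
move: B1 B2; rewrite !ler_norml => /andP[B1 _] /andP[_ B2].
have -> : m * (2 * pi) = circle_int (fun z => complex.Re (c * (h z * k z))) r2 -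
    circle_int (fun z => complex.Re (c * (h z * k z))) r1 by rewrite -E; ring.
by rewrite lerD// lerNl.
Qed.

End AnnulusBound.

(** * Three circles and minorizing monomials *)

Section ThreeCircles.
Variable R : realType.
Notation leb := (@lebesgue_measure R).

Lemma expr_unbounded (x K : R) : 1 < x -> exists n, K < x ^+ n.
Proof.
move=> x1; pose y := x - 1; have y0 : 0 < y by rewrite subr_gt0.
have [n Kn] : exists n : nat, `|K| / y < n%:R.
  by eexists; apply: archi_boundP; rewrite divr_ge0// ltW.
have B k : k%:R * y <= x ^+ k.
  elim: k => [|k IH]; first by rewrite mul0r.
  have xk1 : 1 <= x ^+ k by rewrite exprn_ege1// ltW.
  have -> : x ^+ k.+1 = x ^+ k + y * x ^+ k by rewrite exprS /y; ring.
  by rewrite -natr1 mulrDl mul1r lerD// ler_peMr// ltW.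
exists n; apply: lt_le_trans (B n); apply: le_lt_trans (ler_norm K) _.
by rewrite -ltr_pdivrMr.
Qed.

Lemma le_of_exprn_le (x B K : R) : 0 <= B -> (forall n, x ^+ n <= K * B ^+ n) -> x <= B.
Proof.
move=> B0 H; rewrite leNgt; apply/negP => Bx.
have [B0'|B0'] := eqVneq B 0.
  by have := H 1%N; rewrite !expr1 B0' mulr0; move: Bx; rewrite B0'; lra.
have Bp : 0 < B by rewrite lt_def B0'.
have [n] : exists n, K < (x / B) ^+ n by apply: expr_unbounded; rewrite ltr_pdivlMr// mul1r.
by rewrite expr_div_n ltr_pdivlMr ?exprn_gt0// ltNge H.
Qed.

(* [annulus_bound] for the powers [(f / z^k)^n]: its constant disappears in the
   n-th root. *)
Lemma three_circles (f : Cx R -> Cx R) (r1 r2 t : R) (k : nat) (B : R) :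
  0 < r1 -> r1 < t -> t < r2 ->
  (forall z, r1 <= cmod z <= r2 -> cdiff f z) ->
  (forall z, cmod z = r1 -> cmod (f z) <= B * r1 ^+ k) ->
  (forall z, cmod z = r2 -> cmod (f z) <= B * r2 ^+ k) ->
  cmod (f (rC t)) <= B * t ^+ k.
Proof.
move=> r10 r1t tr2 fd f1 f2.
have t0 : 0 < t by lra. have r20 : 0 < r2 by lra.
have pi2 : 0 < 2 * pi :> R by rewrite mulr_gt0// pi_gt0.
pose g z := f z / z ^+ k.
have zk z : 0 < cmod z -> z ^+ k != 0 by rewrite cmod_gt0 => z0; exact: expf_neq0.
have gd z : r1 <= cmod z <= r2 -> cdiff g z.
  move=> zr; apply: cdiff_div; last by apply: cdiffX; exact: cdiff_id.
    by apply: zk; move: zr; lra.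
  exact: fd.
have gn z r : 0 < r -> cmod z = r -> cmod (f z) <= B * r ^+ k -> cmod (g z) <= B.
  by move=> r0 zr; rewrite /g cmod_div cmodX zr ler_pdivrMr ?exprn_gt0.
have B0 : 0 <= B.
  apply: le_trans (gn (rC r1) r1 r10 _ _); first exact: cmod_ge0.
    by rewrite cmod_rC gtr0_norm.
  by apply: f1; rewrite cmod_rC gtr0_norm.
have ct : cmod (rC t) = t by rewrite cmod_rC gtr0_norm.
rewrite -ler_pdivrMr ?exprn_gt0//.
have -> : cmod (f (rC t)) / t ^+ k = cmod (g (rC t)) by rewrite /g cmod_div cmodX ct.
(* The constant is the sum of the maxima of the Cauchy kernel over the two circles and does not
   depend on [n]. *)
apply: (@le_of_exprn_le _ _ (r2 / (r2 - t) + r1 / (t - r1))) => // n.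
have := @annulus_bound R (fun z => g z ^+ n) r1 r2 t r10 r1t tr2.
move=> /(_ (fun z zr => cdiffX n (gd z zr))).
have bnd r (e : R) : 0 < r -> (r == r1) || (r == r2) -> r != t -> 0 <= e ->
    (forall z, cmod z = r -> cmod (z / (z - rC t)) <= e) ->
    \int[leb]_(th in `[0, 2 * pi]) cmod (g (polar r th) ^+ n * (polar r th / (polar r th - rC t)))
    <= B ^+ n * e * (2 * pi).
  move=> r0 rr rt e0 ke.
  have -> : B ^+ n * e * (2 * pi) = \int[leb]_(th in `[0, 2 * pi]) (B ^+ n * e).
    by rewrite Rintegral_itv_cst ?subr0// ltW.
  have r12 : r1 <= r <= r2 by move: rr => /orP[]/eqP->; lra.
  apply: (@le_circle_int _ (fun z => cmod (g z ^+ n * (z / (z - rC t)))) (fun=> B ^+ n * e)).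
  - exact: ltW.
  - move=> z zr; apply/continuous_cmod_comp/cdiff_continuous/cdiffM.
      by apply/cdiffX/gd; rewrite zr.
    by apply: cdiff_kernel; [exact: ltW|rewrite zr].
  - by move=> z zr; exact: cst_continuous.
  - move=> z zr; rewrite cmodM cmodX; apply: ler_pM; rewrite ?exprn_ge0 ?cmod_ge0//; last exact: ke.
    apply: lerXn2r; rewrite ?nnegrE ?cmod_ge0//; apply: (gn _ _ r0 zr).
    by move: rr zr => /orP[]/eqP-> zr; [exact: f1|exact: f2].
have b2 : (forall z, cmod z = r2 -> cmod (z / (z - rC t)) <= r2 / (r2 - t)).
  move=> z zr; rewrite cmod_div zr ler_wpM2l ?(ltW r20)// lef_pV2 ?posrE ?subr_gt0//.
    by have := cmod_ger_dist z (rC t); rewrite ct zr.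
  by rewrite cmod_gt0; apply: sub_rC_neq0; rewrite ?zr ?gt_eqF// ltW.
have b1 : (forall z, cmod z = r1 -> cmod (z / (z - rC t)) <= r1 / (t - r1)).
  move=> z zr; rewrite cmod_div zr ler_wpM2l ?(ltW r10)// lef_pV2 ?posrE ?subr_gt0//.
    by have := cmod_ger_dist (rC t) z; rewrite ct zr cmod_distC.
  by rewrite cmod_gt0; apply: sub_rC_neq0; rewrite ?zr ?lt_eqF// ltW.
have e2 : 0 <= r2 / (r2 - t) by rewrite divr_ge0 ?subr_ge0 ?(ltW r20) ?(ltW tr2).
have e1 : 0 <= r1 / (t - r1) by rewrite divr_ge0 ?subr_ge0 ?(ltW r10) ?(ltW r1t).
have o1 : (r1 == r1) || (r1 == r2) by rewrite eqxx.
have o2 : (r2 == r1) || (r2 == r2) by rewrite eqxx orbT.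
have n1 : r1 != t by rewrite lt_eqF.
have n2 : r2 != t by rewrite gt_eqF.
have := bnd r2 _ r20 o2 n2 e2 b2; have := bnd r1 _ r10 o1 n1 e1 b1.
move=> B1 B2 /le_trans /(_ (lerD B2 B1)).
by rewrite cmodX -mulrDl -mulrDr ler_pM2r// mulrC.
Qed.

Variables (f : Cx R -> Cx R) (u : R -> R) (t : R).
Hypotheses (f_holo : forall z, disc z -> cdiff f z)
  (fu : forall z, disc z -> cmod (f z) <= u (cmod z)) (t01 : 0 < t < 1).
Let m := cmod (f (rC t)).

(** If the monomial [m * (s / t) ^+ k] exceeded [u] at some [s1 < t] and some [s2 > t], the three
    circles theorem on [s1 < t < s2] would give [|f(t)| < m], against the definition of [m]. *)
Lemma power_dichotomy k :
  (forall s, 0 < s -> s <= t -> m * (s / t) ^+ k <= u s) \/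
  (forall s, t <= s -> s < 1 -> m * (s / t) ^+ k <= u s).
Proof.
have /andP[t0 t1] := t01.
have ct : cmod (rC t) = t by rewrite cmod_rC gtr0_norm.
have mu : m <= u t by have := fu (z := rC t); rewrite /disc/= ct; apply.
have [|/existsNP[s1 /not_implyP[s10 /not_implyP[s1t]]]] := pselect (forall s, 0 < s -> s <= t -> m * (s / t) ^+ k <= u s).
  by left.
move=> /negP; rewrite -ltNge => us1; right => s2 ts2 s21.
rewrite leNgt; apply/negP => us2.
have ne s : u s < m * (s / t) ^+ k -> s != t.
  by apply: contraTneq => ->; rewrite divff ?gt_eqF// expr1n mulr1 -leNgt.
have {}s1t : s1 < t by rewrite lt_neqAle ne.
have {}ts2 : t < s2 by rewrite lt_neqAle eq_sym ne.
have s20 : 0 < s2 by lra.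
have tk : 0 < t ^+ k by exact: exprn_gt0.
have s1k : 0 < s1 ^+ k by exact: exprn_gt0.
have s2k : 0 < s2 ^+ k by exact: exprn_gt0.
pose B := Num.max (u s1 / s1 ^+ k) (u s2 / s2 ^+ k).
have B1 : u s1 <= B * s1 ^+ k by rewrite -ler_pdivrMr// le_max lexx.
have B2 : u s2 <= B * s2 ^+ k by rewrite -ler_pdivrMr// le_max lexx orbT.
have : m <= B * t ^+ k.
  apply: (three_circles s10 s1t ts2).
  - by move=> z zr; apply: f_holo; rewrite /disc/=; move: zr; lra.
  - by move=> z zr; apply: le_trans B1; rewrite -zr; apply: fu; rewrite /disc/= zr; lra.
  - by move=> z zr; apply: le_trans B2; rewrite -zr; apply: fu; rewrite /disc/= zr; lra.
apply/negP; rewrite -ltNge -ltr_pdivlMr// /B gt_max !ltr_pdivrMr//.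
move: us1 us2; rewrite !expr_div_n.
have E (s : R) : m * (s ^+ k / t ^+ k) = m / t ^+ k * s ^+ k by rewrite mulrCA mulrC.
by rewrite !E => -> ->.
Qed.

(** Take the first [k] such that degree [k] works to the right of [t] and degree [k + 1] does not;
    the latter then works to the left by [power_dichotomy]. The monomial [t * m * (s / t) ^+ k.+1]
    equals [s * m * (s / t) ^+ k], so it is a minorant on both sides, at the cost of the factor [t]
    in the value at [t]. *)
Lemma power_minorant : (forall x y, 0 <= x -> x <= y -> y < 1 -> u x <= u y) -> 0 < m ->
  exists A k, [/\ 0 <= A, forall s, 0 <= s -> s < 1 -> A * s ^+ k <= u s & t * m <= A * t ^+ k].
Proof.
have /andP[t0 t1] := t01.
move=> u_mono m0.
have ct : cmod (rC t) = t by rewrite cmod_rC gtr0_norm.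
have mu : m <= u t by have := fu (z := rC t); rewrite /disc/= ct; apply.
have u0 s : 0 <= s -> s < 1 -> 0 <= u s.
  move=> s0 s1; apply: le_trans (cmod_ge0 (f (rC s))) _.
  by have := fu (z := rC s); rewrite /disc/= cmod_rC ger0_norm//; apply.
pose r k := `[< forall s, t <= s -> s < 1 -> m * (s / t) ^+ k <= u s >].
have r0 : r 0%N.
  apply/asboolP => s ts s1; rewrite expr0 mulr1 (le_trans mu)//.
  by apply: u_mono => //; exact: ltW.
(* High degrees fail at the fixed point [s = (1 + t) / 2], where [(s / t) ^+ K] is unbounded in
   [K]. *)
have [K rK] : exists K, ~~ r K.
  pose s := (1 + t) / 2.
  have [K HK] : exists K, u s / m < (s / t) ^+ K.
    by apply: expr_unbounded; rewrite ltr_pdivlMr// /s; lra.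
  have ts : t <= s by rewrite /s; lra.
  have s1 : s < 1 by rewrite /s; lra.
  exists K; apply/negP => /asboolP /(_ s ts s1).
  by rewrite leNgt mulrC -ltr_pdivrMr// HK.
have [k [rk rk1]] : exists k, r k /\ ~~ r k.+1.
  elim: K rK => [|K IH] rK; first by rewrite r0 in rK.
  by have [rK'|/IH//] := boolP (r K); exists K.
move/asboolP : rk => rk.
have lk : forall s, 0 < s -> s <= t -> m * (s / t) ^+ k.+1 <= u s.
  by case: (power_dichotomy k.+1) => // /asboolP h; rewrite /r h in rk1.
exists (t * m / t ^+ k.+1), k.+1; split.
- by rewrite divr_ge0 ?exprn_ge0// ?mulr_ge0// ltW.
- move=> s s0 s1.
  have -> : t * m / t ^+ k.+1 * s ^+ k.+1 = t * (m * (s / t) ^+ k.+1).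
    by rewrite expr_div_n; field; rewrite expf_neq0 ?gt_eqF.
  have [st|ts] := leP s t.
    move: s0; rewrite le_eqVlt => /predU1P[<-|s0].
      by rewrite mul0r expr0n /= !mulr0 u0.
    apply: le_trans (_ : t * u s <= _); first by rewrite ler_wpM2l ?(ltW t0)// lk.
    by rewrite ler_piMl// ?(ltW t1)// u0// ltW.
  have -> : t * (m * (s / t) ^+ k.+1) = s * (m * (s / t) ^+ k).
    by rewrite exprS; field; rewrite gt_eqF.
  apply: le_trans (_ : s * u s <= _); first by rewrite ler_wpM2l// rk// ltW.
  by rewrite ler_piMl// ?(ltW s1)// u0.
- by rewrite divfK// expf_neq0// gt_eqF.
Qed.

End ThreeCircles.

(** * Radial estimates in the Hardy space *)

Section RadialEstimate.
Variable R : realType.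
Notation leb := (@lebesgue_measure R).
Local Notation circle_int g r := (\int[leb]_(th in `[0, 2 * pi]) g (polar r th)).
Variable f : Cx R -> Cx R.
Hypothesis f_diff : forall z, disc z -> cdiff f z.

Lemma sub1_mul_neq0 (t : R) (z : Cx R) : 0 <= t -> t < 1 -> cmod z <= 1 -> 1 - rC t * z != 0.
Proof.
move=> t0 t1 z1; rewrite subr_eq0; apply/negP => /eqP E.
have : cmod (rC t * z) < 1.
  by rewrite cmodM cmod_rC ger0_norm// (le_lt_trans _ t1)// ler_piMr.
by rewrite -E cmod1 ltxx.
Qed.

(** On the unit circle [|z - t| = |1 - t conj(z)|], the modulus of the conjugate of [1 - t z]. Thus
    the Cauchy kernel and the denominator of [h] combine into a square. *)
Lemma unit_reflection (t : R) (z : Cx R) : cmod z = 1 -> cmod (z - rC t) = cmod (1 - rC t * z).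
Proof.
move=> z1; have z2 : complex.Re z ^+ 2 + complex.Im z ^+ 2 = 1 by rewrite -sqr_cmod z1 expr1n.
rewrite /cmod; congr Num.sqrt; rewrite !ReB !ImB !ReM !ImM /=.
have -> : (complex.Re z - t) ^+ 2 + (complex.Im z - 0) ^+ 2 =
  (complex.Re z ^+ 2 + complex.Im z ^+ 2) - 2 * t * complex.Re z + t ^+ 2 by ring.
have -> : (1 - (t * complex.Re z - 0 * complex.Im z)) ^+ 2 +
    (0 - (t * complex.Im z + 0 * complex.Re z)) ^+ 2 =
  1 - 2 * t * complex.Re z + t ^+ 2 * (complex.Re z ^+ 2 + complex.Im z ^+ 2) by ring.
by rewrite z2; ring.
Qed.

Lemma rho_disc (rho : R) (z : Cx R) : 0 < rho -> rho < 1 -> cmod z <= 1 -> disc (rC rho * z).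
Proof.
move=> r0 r1 z1; rewrite /disc/= cmodM cmod_rC gtr0_norm//.
by apply: le_lt_trans r1; rewrite ler_piMr// ltW.
Qed.

Section kernel.
Variables (rho t : R).
Hypotheses (rho0 : 0 < rho) (rho1 : rho < 1) (t0 : 0 < t) (t1 : t < 1).

(* [h t = f (rho t)]; the factor [1 - z] makes the Cauchy kernel bounded against
   Carleson measures on the radius. *)
Let h z := f (rC rho * z) * (1 - z) * rC (1 + t) / (1 - rC t * z).

Let h_diff z : cmod z <= 1 -> cdiff h z.
Proof.
move=> z1; apply: cdiff_div; first by apply: sub1_mul_neq0 => //; exact: ltW.
  apply: cdiffM; last exact: cdiff_cst.
  apply: cdiffM; first by apply/cdiff_scale/f_diff/rho_disc.
  by apply: cdiffB; [exact: cdiff_cst|exact: cdiff_id].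
apply: cdiffB; first exact: cdiff_cst.
by apply: cdiffM; [exact: cdiff_cst|exact: cdiff_id].
Qed.

Let h_t : h (rC t) = f (rC (rho * t)).
Proof.
rewrite /h; have -> : 1 - rC t * rC t = (1 - rC t) * rC (1 + t) by rewrite rCD rC1; ring.
rewrite -[f _ * _ * _]mulrA mulfK; first by rewrite rCM.
rewrite -[1]rC1 -rCB -rCM -cmod_eq0 cmod_rC normr_eq0 mulf_neq0//.
  by rewrite subr_eq0 gt_eqF.
by rewrite gt_eqF// ltr_wpDl// ltW.
Qed.

Let kern z := cmod (f (rC rho * z)) * (2 * cmod (1 - z) / cmod (1 - rC t * z) ^+ 2).

Let h_unit z : cmod z = 1 -> cmod (h z * (z / (z - rC t))) <= kern z.
Proof.
move=> z1; rewrite !cmodM !cmodV cmod_rC z1 unit_reflection// /kern.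
rewrite gtr0_norm; last by rewrite ltr_wpDl// ltW.
have -> : cmod (f (rC rho * z)) * cmod (1 - z) * (1 + t) / cmod (1 - rC t * z) *
    (1 / cmod (1 - rC t * z)) =
  cmod (f (rC rho * z)) * ((1 + t) * cmod (1 - z) / cmod (1 - rC t * z) ^+ 2).
  by rewrite expr2 invfM; ring.
apply: ler_wpM2l; first exact: cmod_ge0.
rewrite ler_wpM2r ?invr_ge0 ?exprn_ge0 ?cmod_ge0// ler_wpM2r ?cmod_ge0//.
by have t1' := t1; lra.
Qed.

Let kern_cont z : cmod z <= 1 -> {for z, continuous kern}.
Proof.
move=> z1; pose k z := f (rC rho * z) * (rC 2 * (1 - z) / (1 - rC t * z) ^+ 2).
have -> : kern = (fun z => cmod (k z)).
  apply/funext => w; by rewrite /kern /k !cmodM cmodV cmodX cmod_rC ger0_norm.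
apply/continuous_cmod_comp/cdiff_continuous/cdiffM; first by apply/cdiff_scale/f_diff/rho_disc.
apply: cdiff_div.
- by apply/expf_neq0/sub1_mul_neq0 => //; exact: ltW.
- by apply: cdiffM; [exact: cdiff_cst|apply: cdiffB; [exact: cdiff_cst|exact: cdiff_id]].
- apply/cdiffX/cdiffB; first exact: cdiff_cst.
  by apply: cdiffM; [exact: cdiff_cst|exact: cdiff_id].
Qed.

(** The annulus bound for [h] with outer circle [|z| = 1]; the inner circle of radius [sg]
    contributes at most an arbitrary [e], because [z / (z - t)] is of size [sg / t] there. *)
Lemma radial_kernel_bound : cmod (f (rC (rho * t))) * (2 * pi) <= circle_int kern 1.
Proof.
have pi2 : 0 < 2 * pi :> R by rewrite mulr_gt0// pi_gt0.
have T0 := t0; have T1 := t1.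
rewrite -h_t; apply/ler_addgt0Pr => e e0.
have h0d : cdiff h 0 by apply: h_diff; rewrite cmod0.
have [d hd] := h0d; have [del del0 Hdel] := cderiv_cont hd ltr01.
pose H := cmod (h 0) + 1; have H0 : 0 < H by rewrite ltr_wpDl ?cmod_ge0.
have c0 : 0 < t * e / (2 * H * (2 * pi)) by apply: divr_gt0; apply: mulr_gt0 => //; exact: mulr_gt0.
(* The three bounds ensure [|h z| <= H], [|z - t| >= t / 2], and [H * sg / (t / 2) <= e / (2 pi)] on
   the inner circle. *)
pose sg := Num.min (Num.min (del / 2) (t / 2)) (t * e / (2 * H * (2 * pi))).
have sg0 : 0 < sg by rewrite !lt_min c0 !divr_gt0.
have sg1 : sg <= del / 2 by rewrite /sg !ge_min lexx.
have sg2 : sg <= t / 2 by rewrite /sg !ge_min lexx !orbT.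
have sg3 : sg <= t * e / (2 * H * (2 * pi)) by rewrite /sg !ge_min lexx !orbT.
have sgt : sg < t by lra.
apply: le_trans (annulus_bound sg0 sgt T1 _) _.
  by move=> z /andP[_]; exact: h_diff.
apply: lerD.
  apply: (@le_circle_int _ (fun z => cmod (h z * (z / (z - rC t)))) kern) => //.
  - move=> z z1; apply/continuous_cmod_comp/cdiff_continuous/cdiffM.
      by apply: h_diff; rewrite z1.
    by apply: cdiff_kernel; [exact: ltW|rewrite z1 gt_eqF].
  - by move=> z z1; apply: kern_cont; rewrite z1.
have E : e = \int[leb]_(th in `[0, 2 * pi]) (e / (2 * pi)).
  rewrite Rintegral_itv_cst; last exact: ltW.
  by rewrite subr0 divfK// gt_eqF.
rewrite E.
apply: (@le_circle_int _ (fun z => cmod (h z * (z / (z - rC t)))) (fun=> e / (2 * pi))).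
- exact: ltW.
- move=> z z1; apply/continuous_cmod_comp/cdiff_continuous/cdiffM.
    by apply: h_diff; rewrite z1; lra.
  by apply: cdiff_kernel; [exact: ltW|rewrite z1 lt_eqF].
- by move=> z z1; exact: cst_continuous.
move=> z zs; have hz : cmod (h z) <= H.
  have /Hdel : cmod (z - 0) < del by rewrite subr0 zs; lra.
  by have := cmod_ger_dist (h z) (h 0); rewrite /H; lra.
have zt : t / 2 <= cmod (z - rC t).
  by have := cmod_ger_dist (rC t) z; rewrite cmod_distC cmod_rC gtr0_norm// zs; lra.
have zt0 : 0 < cmod (z - rC t) by lra.
rewrite cmodM cmod_div zs.
apply: le_trans (_ : H * (sg / (t / 2)) <= _).
  apply: ler_pM => //; rewrite ?cmod_ge0// ?divr_ge0 ?cmod_ge0 ?(ltW sg0)//.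
  by rewrite ler_wpM2l ?(ltW sg0)// lef_pV2 ?posrE// divr_gt0.
have -> : H * (sg / (t / 2)) = sg * (2 * H / t) by field; rewrite gt_eqF.
apply: le_trans (_ : t * e / (2 * H * (2 * pi)) * (2 * H / t) <= _).
  by rewrite ler_wpM2r// divr_ge0 ?mulr_ge0 ?(ltW H0) ?(ltW t0).
have aux (x y p : R) : x != 0 -> y != 0 -> p != 0 -> x * e / (2 * y * p) * (2 * y / x) = e / p.
  by move=> x0 y0 p0; field; rewrite x0 y0 p0.
by rewrite aux// gt_eqF.
Qed.

End kernel.

(** Up to constants this dominates the kernel [|1 - z| / |1 - s z|^2] for all [s <= 1 - x] at once,
    so a single integral controls the whole segment of the radius. *)
Definition kappa (x : R) (z : Cx R) : R := cmod (1 - z) / (x + cmod (1 - z)) ^+ 2.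

(** Both [x] and [1 - s] are at most [|1 - s z|], and [|1 - z| <= |1 - s z| + (1 - s)]; this gives
    the factor 3. *)
Lemma sub1_mul_ge (s x : R) (z : Cx R) : 0 <= s -> s <= 1 - x -> 0 < x -> cmod z = 1 ->
  x + cmod (1 - z) <= 3 * cmod (1 - rC s * z).
Proof.
move=> s0 sx x0 z1.
have h1 : 1 - s <= cmod (1 - rC s * z).
  by have := cmod_ger_dist 1 (rC s * z); rewrite cmod1 cmodM cmod_rC z1 mulr1 ger0_norm.
have h2 : cmod (1 - z) <= cmod (1 - rC s * z) + (1 - s).
  have -> : 1 - z = (1 - rC s * z) + (rC s - 1) * z by ring.
  apply: le_trans (cmodD _ _) _; rewrite lerD2l cmodM z1 mulr1 -[X in _ - X]rC1 -rCB cmod_rC.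
  by rewrite distrC ger0_norm; lra.
lra.
Qed.

Lemma kappa_cont (x : R) (z : Cx R) : 0 < x -> {for z, continuous (kappa x)}.
Proof.
move=> x0; have c1 : {for z, continuous (fun w : Cx R => cmod (1 - w))}.
  by apply/continuous_cmod_comp/cdiff_continuous/cdiffB; [exact: cdiff_cst|exact: cdiff_id].
have c2 : {for z, continuous (fun w : Cx R => (x + cmod (1 - w)) ^+ 2)}.
  apply: (@continuous_comp _ _ _ (fun w : Cx R => x + cmod (1 - w)) (fun y => y ^+ 2)).
    exact (@cvgD _ _ _ (nbhs z) _ (fun=> x) _ _ _ (cvg_cst x) c1).
  exact: exprn_continuous.
have n0 : (x + cmod (1 - z)) ^+ 2 != 0 by rewrite expf_neq0// gt_eqF// ltr_wpDr ?cmod_ge0.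
exact (@cvgM R _ (nbhs z) _ _ _ _ _ c1 (cvgV n0 c2)).
Qed.

Lemma kappa_ge0 (x : R) (z : Cx R) : 0 <= x -> 0 <= kappa x z.
Proof. by move=> x0; rewrite divr_ge0 ?exprn_ge0 ?addr_ge0 ?cmod_ge0. Qed.

Lemma f_rho_cont (rho : R) (z : Cx R) : 0 < rho -> rho < 1 -> cmod z <= 1 ->
  {for z, continuous (fun w => cmod (f (rC rho * w)))}.
Proof.
move=> r0 r1 z1; apply/continuous_cmod_comp/cdiff_continuous.
by apply/cdiff_scale/f_diff/rho_disc.
Qed.

(** The constant is [2 * 3 ^+ 2]: the 2 is that of [radial_kernel_bound], and the 3 of [sub1_mul_ge]
    is squared. *)
Lemma radial_kappa_bound (rho s x : R) : 0 < rho -> rho < 1 -> 0 <= s -> 0 < x -> x < 1 -> s <= 1 - x ->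
  cmod (f (rC (rho * s))) * (2 * pi) <= 18 * circle_int (fun z => cmod (f (rC rho * z)) * kappa x z) 1.
Proof.
move=> r0 r1 s0 x0 x1 sx.
have pi2 : 0 < 2 * pi :> R by rewrite mulr_gt0// pi_gt0.
have gc z : cmod z = 1 -> {for z, continuous (fun z => cmod (f (rC rho * z)) * kappa x z)}.
  move=> z1; have c1 := f_rho_cont r0 r1 (ltac:(by rewrite z1) : cmod z <= 1).
  exact (@cvgM R _ (nbhs z) _ _ _ _ _ c1 (kappa_cont (z := z) x0)).
set I := (X in _ <= 18 * X).
have pos y : 0 < y -> y <= 1 - x -> cmod (f (rC (rho * y))) * (2 * pi) <= 18 * I.
  move=> y0 yx; have y1 : y < 1 by lra.
  apply: le_trans (radial_kernel_bound r0 r1 y0 y1) _.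
  rewrite /I -RintegralZl; [|exact: measurable_itv|exact: (integrable_circle ler01 gc)].
  apply: (@le_circle_int _ (fun z => cmod (f (rC rho * z)) * (2 * cmod (1 - z) / cmod (1 - rC y * z) ^+ 2))
    (fun z => 18 * (cmod (f (rC rho * z)) * kappa x z))) => //.
  - move=> z z1; have z1' : cmod z <= 1 by rewrite z1.
    have c1 : {for z, continuous (fun w : Cx R => cmod (1 - w))}.
      by apply/continuous_cmod_comp/cdiff_continuous/cdiffB; [exact: cdiff_cst|exact: cdiff_id].
    have c2 : {for z, continuous (fun w : Cx R => cmod ((1 : Cx R) - rC y * w) ^+ 2)}.
      have -> : (fun w : Cx R => cmod ((1 : Cx R) - rC y * w) ^+ 2) =
          (fun w : Cx R => cmod (((1 : Cx R) - rC y * w) ^+ 2)).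
        by apply/funext => w; rewrite cmodX.
      apply/continuous_cmod_comp/cdiff_continuous/cdiffX/cdiffB; first exact: cdiff_cst.
      by apply: cdiffM; [exact: cdiff_cst|exact: cdiff_id].
    have n0 : cmod ((1 : Cx R) - rC y * z) ^+ 2 != 0.
      by rewrite expf_neq0// cmod_eq0 sub1_mul_neq0// ltW.
    have c3 : {for z, continuous (fun w : Cx R => 2 * cmod (1 - w) / cmod (1 - rC y * w) ^+ 2)}.
      exact (@cvgM R _ (nbhs z) _ _ _ _ _ (@cvgM R _ (nbhs z) _ _ _ _ _ (cvg_cst (2 : R)) c1) (cvgV n0 c2)).
    exact (@cvgM R _ (nbhs z) _ _ _ _ _ (f_rho_cont r0 r1 z1') c3).
  - move=> z z1.
    exact (@cvgM R _ (nbhs z) _ (fun=> (18 : R)) _ _ _ (cvg_cst (18 : R)) (gc z z1)).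
  move=> z z1; rewrite [leRHS]mulrCA; apply: ler_wpM2l; rewrite ?cmod_ge0// /kappa.
  have xz0 : 0 < x + cmod (1 - z) by rewrite ltr_wpDr ?cmod_ge0.
  have K := sub1_mul_ge (ltW y0) yx x0 z1.
  have c0 : 0 < cmod (1 - rC y * z) by lra.
  rewrite [leRHS]mulrA ler_pdivrMr ?exprn_gt0// [leRHS]mulrAC ler_pdivlMr ?exprn_gt0//.
  have -> : 18 * cmod (1 - z) * cmod (1 - rC y * z) ^+ 2 =
     2 * cmod (1 - z) * (3 * cmod (1 - rC y * z)) ^+ 2 by ring.
  by rewrite ler_wpM2l ?mulr_ge0 ?cmod_ge0// lerXn2r ?nnegrE ?(ltW xz0)// mulr_ge0// ltW.
move: s0; rewrite le_eqVlt => /predU1P[s0|s0]; last exact: pos.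
(* The kernel bound asks for a positive point, so the value at 0 is reached by continuity from small
   [y > 0]. *)
rewrite -s0; apply/ler_addgt0Pr => e e0.
have fr0 : cdiff (fun w => f (rC rho * w)) 0 by apply/cdiff_scale/f_diff/rho_disc; rewrite ?cmod0.
have [d hd] := fr0; have [del del0 H] := cderiv_cont hd (divr_gt0 e0 pi2).
pose y := Num.min (del / 2) ((1 - x) / 2).
have y0 : 0 < y by rewrite lt_min !divr_gt0// subr_gt0.
have y1 : y <= del / 2 by rewrite ge_min lexx.
have y2 : y <= (1 - x) / 2 by rewrite ge_min lexx orbT.
have /H : cmod (rC y - 0) < del by rewrite subr0 cmod_rC gtr0_norm//; lra.
rewrite mulr0 -rCM ltr_pdivlMr// => He.
have := pos y y0 ltac:(lra).
have : cmod (f (rC (rho * 0))) * (2 * pi) <=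
    cmod (f (rC (rho * y))) * (2 * pi) + cmod (f (rC (rho * y)) - f 0) * (2 * pi).
  rewrite -mulrDl ler_pM2r// mulr0 rC0.
  by have := cmod_ger_dist (f 0) (f (rC (rho * y))); rewrite cmod_distC; lra.
lra.
Qed.

End RadialEstimate.

(** * Dyadic summation of the kernel over the radius *)

Section DyadicEstimate.
Variable R : realType.
Notation leb := (@lebesgue_measure R).
Local Notation circle_int g r := (\int[leb]_(th in `[0, 2 * pi]) g (polar r th)).

(** The difference on the right is that of [y / (y + th)] between consecutive dyadic scales, so the
    sum over scales telescopes. *)
Lemma ratio_telescope (y th : R) : 0 < y -> 0 <= th ->
  y * th / (y + th) ^+ 2 <= 2 * (y / (y + th) - (y / 2) / (y / 2 + th)).
Proof.
move=> y0 th0; have a0 : 0 < y + th by lra. have b0 : 0 < y / 2 + th by lra.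
have -> : 2 * (y / (y + th) - (y / 2) / (y / 2 + th)) = y * th / ((y + th) * (y / 2 + th)).
  have c0 : 0 < y + 2 * th by lra.
  by field; apply/andP; split; rewrite gt_eqF//; lra.
rewrite ler_wpM2l ?mulr_ge0 ?(ltW y0)// lef_pV2 ?posrE ?exprn_gt0 ?mulr_gt0//.
by rewrite expr2 ler_wpM2l ?(ltW a0)//; lra.
Qed.

Definition kappa_sum (J : nat) (z : Cx R) : R :=
  \sum_(j < J) (2^-1) ^+ j * kappa ((2^-1) ^+ j / 4) z.

(** With [y = 2^-j / 4] each term is [4 * (y * th / (y + th) ^+ 2)], hence at most 8 times a
    telescoping difference of the function [g], whose values lie in [0, 1]. *)
Lemma kappa_sum_le J z : kappa_sum J z <= 8.
Proof.
pose th := cmod (1 - z); have th0 : 0 <= th by exact: cmod_ge0.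
pose x j : R := (2^-1) ^+ j; have x0 j : 0 < x j by rewrite exprn_gt0// invr_gt0.
pose g y := y / (y + th).
suff H : kappa_sum J z <= 8 * (g (1 / 4) - g (x J / 4)).
  apply: le_trans H _.
  have : g (1 / 4) <= 1 by rewrite ler_pdivrMr ?mul1r ?lerDl//; lra.
  have : 0 <= g (x J / 4) by have := x0 J; rewrite /g => ?; rewrite divr_ge0; lra.
  lra.
elim: J => [|J IH]; first by rewrite /kappa_sum big_ord0 /x expr0 subrr mulr0.
rewrite /kappa_sum big_ord_recr /=; apply: le_trans (lerD IH (lexx _)) _.
have := @ratio_telescope (x J / 4) th (divr_gt0 (x0 J) (ltr0n _ 4)) th0.
have -> : x J.+1 / 4 = x J / 4 / 2 by rewrite /x exprSr; field.
rewrite -/(x J) /kappa -/th -!/(g _).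
have -> : x J * (th / (x J / 4 + th) ^+ 2) = 4 * (x J / 4 * th / (x J / 4 + th) ^+ 2).
  field; rewrite gt_eqF//; have := x0 J; lra.
lra.
Qed.

Variables (f : Cx R -> Cx R) (M : R).
Hypothesis f_diff : forall z, disc z -> cdiff f z.
Hypothesis f_mean : forall rho, 0 < rho -> rho < 1 ->
  circle_int (fun z => cmod (f z)) rho <= M * (2 * pi).

Lemma kappa_sum_cont J (z : Cx R) : {for z, continuous (kappa_sum J)}.
Proof.
elim: J => [|J IH].
  have -> : kappa_sum 0 = fun=> 0 by apply/funext => w; rewrite /kappa_sum big_ord0.
  exact: cst_continuous.
have -> : kappa_sum J.+1 = (fun w => kappa_sum J w + (2^-1) ^+ J * kappa ((2^-1) ^+ J / 4) w).
  by apply/funext => w; rewrite /kappa_sum big_ord_recr.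
have kc := kappa_cont (z := z) (ltac:(by rewrite divr_gt0 ?exprn_gt0 ?invr_gt0) : 0 < (2^-1 : R) ^+ J / 4).
have c2 : {for z, continuous (fun w => (2^-1) ^+ J * kappa ((2^-1) ^+ J / 4) w)}.
  exact (@cvgM R _ (nbhs z) _ (fun=> (2^-1 : R) ^+ J) _ _ _ (cvg_cst _) kc).
exact (@cvgD _ _ _ (nbhs z) _ _ _ _ _ IH c2).
Qed.

(** The [B j] are the integrals of [radial_kappa_bound] at [x = 2^-j / 4]. Summed under the integral
    sign, the weighted kernels are at most 8 pointwise, which leaves a circle mean of [|f|]; the
    constant is [144 = 18 * 8]. The family [B] depends on [J] through [rho], the bound on its sum
    does not. *)
Lemma radial_dyadic_bound J : exists B : nat -> R,
  [/\ forall j, 0 <= B j,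
      forall j s, (j < J)%N -> 0 <= s -> s <= 1 - (2^-1) ^+ j / 2 -> cmod (f (rC s)) <= B j &
      \sum_(j < J) (2^-1) ^+ j * B j <= 144 * M].
Proof.
pose x j : R := (2^-1) ^+ j; have x0 j : 0 < x j by rewrite exprn_gt0// invr_gt0.
have x1 j : x j <= 1 by rewrite exprn_ile1// ?invr_ge0// invf_le1// ler1n.
have pi2 : 0 < 2 * pi :> R by rewrite mulr_gt0// pi_gt0.
(* Then [s / rho <= 1 - x j / 4] whenever [s <= 1 - x j / 2] and [j < J]. *)
pose rho := 1 - x J / 8.
have r0 : 0 < rho by have := x1 J; rewrite /rho; lra.
have r1 : rho < 1 by have := x0 J; rewrite /rho; lra.
have fc z : cmod z = 1 -> {for z, continuous (fun w => cmod (f (rC rho * w)))}.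
  by move=> z1; apply: f_rho_cont; rewrite ?z1.
have xq j : 0 < x j / 4 by rewrite divr_gt0.
have kc j z : cmod z = 1 -> {for z, continuous (fun w => cmod (f (rC rho * w)) * kappa (x j / 4) w)}.
  by move=> z1; exact (@cvgM R _ (nbhs z) _ _ _ _ _ (fc z z1) (kappa_cont (z := z) (xq j))).
have ksc n z : cmod z = 1 -> {for z, continuous (fun w => cmod (f (rC rho * w)) * kappa_sum n w)}.
  by move=> z1; exact (@cvgM R _ (nbhs z) _ _ _ _ _ (fc z z1) (@kappa_sum_cont n z)).
pose I j := circle_int (fun w => cmod (f (rC rho * w)) * kappa (x j / 4) w) 1.
pose S n := circle_int (fun w => cmod (f (rC rho * w)) * kappa_sum n w) 1.
have SE n : \sum_(j < n) x j * I j = S n.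
  elim: n => [|n IH].
    rewrite big_ord0 /S; under eq_Rintegral do rewrite /kappa_sum big_ord0 mulr0.
    by rewrite Rintegral_itv_cst ?mul0r// ltW.
  rewrite big_ord_recr /= IH /S /I.
  have i1 := integrable_circle ler01 (ksc n).
  have i2 := integrable_circle ler01 (kc n).
  have i3 : leb.-integrable `[0, 2 * pi] (EFin \o (fun th => x n * (cmod (f (rC rho * polar 1 th)) * kappa (x n / 4) (polar 1 th)))).
    apply: (@integrable_circle _ (fun w => x n * (cmod (f (rC rho * w)) * kappa (x n / 4) w))) => //.
    move=> z z1; exact (@cvgM R _ (nbhs z) _ (fun=> x n) _ _ _ (cvg_cst _) (kc n z z1)).
  rewrite -(RintegralZl (x n) _ i2); last exact: measurable_itv.
  rewrite -(RintegralD _ i1 i3); last exact: measurable_itv.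
  by apply: eq_Rintegral => th _; rewrite /kappa_sum big_ord_recr /= -/(x n); ring.
have Spi : S J <= 8 * (M * (2 * pi)).
  apply: le_trans (_ : 8 * circle_int (fun z => cmod (f z)) rho <= _); last first.
    by rewrite ler_wpM2l// f_mean.
  have -> : circle_int (fun z => cmod (f z)) rho = circle_int (fun z => cmod (f (rC rho * z))) 1.
    by apply: eq_Rintegral => th _; rewrite -polar0 polarM mulr1 add0r.
  have i1 := integrable_circle ler01 fc.
  rewrite -(RintegralZl 8 _ i1); last exact: measurable_itv.
  apply: (@le_circle_int _ (fun w => cmod (f (rC rho * w)) * kappa_sum J w) (fun w => 8 * cmod (f (rC rho * w)))) => //.
  - exact: ksc.
  - move=> z z1; exact (@cvgM R _ (nbhs z) _ (fun=> (8 : R)) _ _ _ (cvg_cst _) (fc z z1)).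
  - by move=> z _; rewrite mulrC; apply: ler_wpM2r; [exact: cmod_ge0|exact: kappa_sum_le].
have I0 j : 0 <= I j.
  apply: Rintegral_ge0 => th _; rewrite mulr_ge0 ?cmod_ge0// kappa_ge0//.
  exact: ltW.
exists (fun j => 18 / (2 * pi) * I j); split.
- by move=> j; rewrite mulr_ge0 ?I0// divr_ge0 // ltW.
- move=> j s jJ s0; rewrite -/(x j) => sx.
  have xJj : x J <= x j.
    by rewrite /x ler_wiXn2l ?invr_ge0 ?invf_le1 ?ler1n// ltnW.
  rewrite mulrAC ler_pdivlMr//.
  have -> : s = rho * (s / rho) by rewrite mulrCA divff ?mulr1// gt_eqF.
  have xj4 : x j / 4 < 1 by have := x1 j; lra.
  apply: (radial_kappa_bound f_diff r0 r1 _ (xq j) xj4); first by rewrite divr_ge0// ltW.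
  rewrite ler_pdivrMr//; apply: le_trans sx _; rewrite /rho.
  have : 0 <= x j * x J by rewrite mulr_ge0// ltW.
  by have := x0 j; lra.
- have -> : \sum_(j < J) (2^-1) ^+ j * (18 / (2 * pi) * I j) = 18 / (2 * pi) * S J.
    by rewrite -SE mulr_sumr; apply: eq_bigr => j _; rewrite mulrCA.
  by rewrite mulrAC ler_pdivrMr//; move: Spi; lra.
Qed.

End DyadicEstimate.

(** * Carleson measures on dyadic intervals *)

Section CarlesonDyadic.
Variables (R : realType) (mu : {measure set R -> \bar R}).
Let x j : R := (2^-1) ^+ j.
Let F j : set R := `[1 - x j, 1 - x j.+1[.

Let x_gt0 j : 0 < x j. Proof. by rewrite exprn_gt0// invr_gt0. Qed.
Let xS j : x j.+1 = x j / 2. Proof. by rewrite /x exprSr. Qed.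
Let x_anti i j : (i <= j)%N -> x j <= x i.
Proof. by move=> ij; rewrite /x ler_wiXn2l ?invr_ge0 ?invf_le1 ?ler1n. Qed.
Let x_le1 j : x j <= 1. Proof. exact: (x_anti (leq0n j)). Qed.

Lemma half_power_lt (e : R) : 0 < e -> exists n, (2^-1) ^+ n < e.
Proof.
move=> e0; have [n ne] : exists n, e^-1 < (2 : R) ^+ n by apply: expr_unbounded; rewrite ltr1n.
by exists n; rewrite exprVn -[ltRHS]invrK ltf_pV2 ?posrE ?invr_gt0 ?exprn_gt0.
Qed.

Let bigcupF : \bigcup_j F j = `[0, 1[%classic.
Proof.
apply/seteqP; split => t /=.
  move=> [j _]; rewrite /F /= !in_itv/= => /andP[h1 h2].
  by have h3 := x_gt0 j.+1; have h4 := x_le1 j; apply/andP; split; lra.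
rewrite in_itv/= => /andP[t0 t1].
have [|n xn min] := @ex_minnP (fun n => x n.+1 < 1 - t).
  have [n ne] := half_power_lt (ltac:(lra) : 0 < 1 - t).
  by exists n; apply: le_lt_trans ne; exact: (x_anti (leqnSn n)).
exists n => //; rewrite /F /= in_itv/=; apply/andP; split; last by lra.
case: n xn min => [|n] xn min; first by rewrite /x expr0 subrr.
by have [|] := leP (1 - x n.+1) t => // tx; have := min n; rewrite ltnn => H; have := H ltac:(lra).
Qed.

Let trivF : trivIset setT F.
Proof.
apply: ltn_trivIset => n m mn; rewrite -subset0 => t [/=].
rewrite /F /= !in_itv/= => /andP[_ h1] /andP[h2 _].
by have := x_anti mn; lra.
Qed.

Lemma nondecreasing_measurable_itv (N : R -> R) :
  (forall s t, 0 <= s -> s <= t -> t < 1 -> N s <= N t) -> measurable_fun (`[0, 1[%classic : set R) N.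
Proof.
move=> Nm; apply: (measurability (@measurable_realfun.RGenCInfty.G R)) => [|/= _ [_] [r] -> <-].
  exact: measurable_realfun.RGenCInfty.measurableE.
apply: measurable_realfun.is_interval_measurable => s t/=; rewrite !in_itv/= !andbT => -[/andP[s0 s1] rs] [/andP[t0 t1] _] y.
move=> /andP[sy yt]; rewrite !in_itv/= andbT; split; first by lra.
by apply: le_trans rs _; apply: Nm => //; lra.
Qed.

(** On [F j] the function [N] is at most its value at the right end [1 - 2^-j / 2], and [F j] has
    measure at most [c * 2^-j]. Since only partial sums enter, the bounds [B] may change with
    [J]. *)
Lemma dyadic_integrable (c K : R) (N : R -> R) : 0 <= c ->
  (forall t, 0 <= t -> t < 1 -> (mu `[t, 1%R[ <= (c * (1 - t))%:E)%E) ->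
  (forall s t, 0 <= s -> s <= t -> t < 1 -> N s <= N t) ->
  (forall t, 0 <= t -> t < 1 -> 0 <= N t) ->
  (forall J, exists B : nat -> R, [/\ forall j, 0 <= B j,
     forall j, (j < J)%N -> N (1 - (2^-1) ^+ j / 2) <= B j &
     \sum_(j < J) (2^-1) ^+ j * B j <= K]) ->
  mu.-integrable `[0, 1[ (EFin \o N) /\ \int[mu]_(t in `[0, 1[) N t <= c * K.
Proof.
move=> c0 muc Nm N0 NB.
have mN := nondecreasing_measurable_itv Nm.
have mEN : measurable_fun (`[0, 1[%classic : set R) (EFin \o N) by exact/measurable_EFinP.
have F01 j t : F j t -> 0 <= t < 1 /\ t <= 1 - x j / 2.
  rewrite /F /= in_itv/= xS => /andP[h1 h2].
  by have h3 := x_le1 j; have h4 := x_gt0 j; split; lra.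
have mF j : measurable (F j) by exact: measurable_itv.
have FN j : (\int[mu]_(t in F j) (N t)%:E <= (N (1 - x j / 2) * (c * x j))%:E)%E.
  have tau0 : 0 <= 1 - x j / 2 by have := x_le1 j; have := x_gt0 j; lra.
  have tau1 : 1 - x j / 2 < 1 by have := x_gt0 j; lra.
  apply: (@le_trans _ _ (\int[mu]_(t in F j) (N (1 - x j / 2))%:E)%E).
    apply: ge0_le_integral => //.
    - by move=> t /F01[/andP[t0 t1] _]; rewrite lee_fin N0.
    - apply: measurable_funS mEN => //; rewrite -bigcupF; exact: bigcup_sup.
    - by move=> t /F01[/andP[t0 t1] tt]; rewrite lee_fin Nm.
  rewrite integral_cst// EFinM; apply: lee_wpmul2l; first by rewrite lee_fin N0.
  apply: (@le_trans _ _ (mu `[1 - x j, 1%R[)).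
    apply: le_measure; rewrite ?inE//.
    by move=> t; rewrite /F /= !in_itv/= => /andP[h1 h2]; have h3 := x_gt0 j.+1; apply/andP; split; lra.
  apply: le_trans (muc _ _ _) _; first by have := x_le1 j; lra.
    by have := x_gt0 j; lra.
  by rewrite lee_fin opprB addrC subrK.
have IN : (\int[mu]_(t in `[0%R, 1%R[) (N t)%:E <= (c * K)%:E)%E.
  rewrite -bigcupF ge0_integral_bigcup//; last 2 first.
  - by rewrite bigcupF.
  - by move=> t; rewrite bigcupF/= in_itv/= => /andP[t0 t1]; rewrite lee_fin N0.
  apply: lime_le.
    apply: is_cvg_nneseries => j _ _; apply: integral_ge0 => t /F01[/andP[t0 t1] _].
    by rewrite lee_fin N0.
  apply: nearW => J.
  apply: (@le_trans _ _ (\sum_(0 <= j < J) (N (1 - x j / 2) * (c * x j))%:E)%E).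
    by apply: lee_sum => j _; exact: FN.
  rewrite sumEFin lee_fin big_mkord; have [B [B0 BN BK]] := NB J.
  apply: le_trans (ler_wpM2l c0 BK); rewrite mulr_sumr; apply: ler_sum => j _.
  rewrite mulrC -mulrA ler_wpM2l// ler_wpM2l ?(ltW (x_gt0 j))//.
  exact: BN.
have N0' (t : R) : `[0, 1[%classic t -> (0 <= (N t)%:E)%E.
  by rewrite /= in_itv/= => /andP[t0 t1]; rewrite lee_fin N0.
split.
  apply/integrableP; split => //.
  apply: le_lt_trans (ltry (c * K)); apply: le_trans IN.
  rewrite le_eqVlt; apply/orP; left; apply/eqP; apply: eq_integral => t.
  by rewrite inE => /N0'; rewrite lee_fin => h; rewrite /= ger0_norm.
rewrite -lee_fin /Rintegral fineK//.
rewrite ge0_fin_numE; last exact: integral_ge0.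
exact: le_lt_trans IN (ltry _).
Qed.

(** At distance at least [d] from 1, the total mass [K] is at most [K / d * (1 - t)]; finiteness of
    the measure thus extends the Carleson bound to the whole interval. *)
Lemma carleson_global : (mu setT < +oo)%E -> carleson mu -> exists2 c : R, 0 <= c &
  forall t, 0 <= t -> t < 1 -> (mu `[t, 1%R[ <= (c * (1 - t))%:E)%E.
Proof.
move=> mufin [c Hc].
have muT : mu setT = (fine (mu setT))%:E by rewrite fineK// ge0_fin_numE.
set K := fine (mu setT) in muT.
have K0 : 0 <= K by rewrite fine_ge0.
move: Hc; rewrite near_withinE => /nbhs_ballP[d /= d0 Hd].
exists (Num.max `|c| (K / d)); first by rewrite le_max normr_ge0.
move=> t t0 t1.
have [td|dt] := ltP (1 - t) d.
  apply: (le_trans (Hd t _ t1)).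
    by rewrite /ball/= ger0_norm//; lra.
  rewrite lee_fin ler_wpM2r//; first by lra.
  by rewrite le_max ler_norm.
apply: (@le_trans _ _ K%:E).
  by rewrite -muT; apply: le_measure; rewrite ?inE.
rewrite lee_fin; apply: (@le_trans _ _ (K / d * (1 - t))).
  by rewrite mulrAC ler_pdivlMr// ler_wpM2l.
by rewrite ler_wpM2r//; [lra|rewrite le_max lexx orbT].
Qed.

End CarlesonDyadic.

(** * The radial maximal function on the Hardy space *)

Section H1Dominant.
Variables (R : realType) (mu : {measure set R -> \bar R}).
Hypotheses (mufin : (mu setT < +oo)%E) (mucar : carleson mu).
Notation leb := (@lebesgue_measure R).

Definition radial_max (f : Cx R -> Cx R) (t : R) : R := sup [set cmod (f (rC s)) | s in `[0, t]].

Lemma circle_mean_le (f : Cx R -> Cx R) (M : R) : holo f -> (H1_norm f < M%:E)%E ->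
  forall rho, 0 < rho -> rho < 1 ->
  \int[leb]_(th in `[0, 2 * pi]) cmod (f (polar rho th)) <= M * (2 * pi).
Proof.
move=> fh fM rho r0 r1.
have pi2 : 0 < 2 * pi :> R by rewrite mulr_gt0// pi_gt0.
have fi : leb.-integrable `[0, 2 * pi] (EFin \o (fun th => cmod (f (polar rho th)))).
  apply: (@integrable_circle _ (fun z => cmod (f z))); first exact: ltW.
  move=> z zr; apply/continuous_cmod_comp/cdiff_continuous/derivable_cderiv/fh.
  by rewrite /disc/= zr.
have : (circle_mean f rho <= M%:E)%E.
  apply: le_trans (ltW fM); apply: ereal_sup_ubound; exists rho => //=.
  by rewrite in_itv/= r0.
have If : ((\int[leb]_(th in `[0%R, (2 * pi)%R]) (cmod (f (polar rho th)))%:E)%E \is a fin_num).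
  by apply: (integrable_fin_num _ fi); exact: measurable_itv.
by rewrite /circle_mean -(fineK If) -EFinM lee_fin mulrC ler_pdivrMr.
Qed.

Lemma H1_dominant : exists2 C : R, 0 <= C & forall f M, holo f -> (H1_norm f < M%:E)%E ->
  exists N : R -> R, [/\ mu.-integrable `[0, 1[ (EFin \o N),
    forall s t, 0 <= s -> s <= t -> t < 1 -> cmod (f (rC s)) <= N t &
    \int[mu]_(t in `[0, 1[) N t <= C * M].
Proof.
have [c c0 muc] := carleson_global mufin mucar.
exists (c * 144); first by rewrite mulr_ge0.
move=> f M fh fM; have fd z : disc z -> cdiff f z by move=> /fh /derivable_cderiv.
have fm := circle_mean_le fh fM.
(* Finiteness of the supremum at [t] follows from the dyadic estimate itself, taken up to an index
   [n] with [2^-n < 1 - t]. *)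
have bnd t : 0 <= t -> t < 1 -> exists b, forall s, 0 <= s -> s <= t -> cmod (f (rC s)) <= b.
  move=> t0 t1; have [n xn] := half_power_lt (ltac:(lra) : 0 < 1 - t).
  have [B [_ HB _]] := radial_dyadic_bound fd fm n.+1.
  exists (B n) => s s0 st; apply: HB => //.
  have : 0 < (2^-1 : R) ^+ n by rewrite exprn_gt0// invr_gt0.
  lra.
have hs t : 0 <= t -> t < 1 -> has_sup [set cmod (f (rC s)) | s in `[0, t]].
  move=> t0 t1; split; first by exists (cmod (f (rC 0))); exists 0 => //=; rewrite in_itv/= lexx.
  have [b Hb] := bnd t t0 t1; exists b => _ [s sI <-]; move: sI => /=; rewrite in_itv/= => /andP[s0 st].
  exact: Hb.
have dom s t : 0 <= s -> s <= t -> t < 1 -> cmod (f (rC s)) <= radial_max f t.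
  move=> s0 st t1; apply: ub_le_sup; first by have [] := hs t (le_trans s0 st) t1.
  by exists s => //=; rewrite in_itv/= s0.
have [] := @dyadic_integrable R mu c (144 * M) (radial_max f) c0 muc.
- move=> s t s0 st t1; apply: ge_sup; first by have [] := hs s s0 (le_lt_trans st t1).
  move=> _ [y yI <-]; move: yI => /=; rewrite in_itv/= => /andP[y0 ys]; apply: dom => //; exact: le_trans st.
- by move=> t t0 t1; apply: le_trans (dom 0 t _ _ _) => //; exact: cmod_ge0.
- move=> J; have [B [B0 HB HS]] := radial_dyadic_bound fd fm J; exists B; split=> // j jJ.
  apply: ge_sup.
    exists (cmod (f (rC 0))); exists 0 => //=; rewrite in_itv/= lexx /=.
    have : (2^-1 : R) ^+ j <= 1 by rewrite exprn_ile1// ?invr_ge0// invf_le1// ler1n.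
    have : 0 <= (2^-1 : R) ^+ j by rewrite exprn_ge0// invr_ge0.
    by move=> h1 h2; lra.
  by move=> _ [s sI <-]; move: sI => /=; rewrite in_itv/= => /andP[s0 st]; exact: HB.
by move=> Ni NI; exists (radial_max f); split => //; rewrite -mulrA.
Qed.

End H1Dominant.

(** * Integrals along the radius *)

Section RadialIntegral.
Variables (R : realType) (mu : {measure set R -> \bar R}).
Implicit Types (f g : Cx R -> Cx R) (G N : R -> R) (z w : Cx R).

Definition radially_diff f := forall t : R, 0 <= t -> t < 1 -> cdiff f (rC t).

(** Moments, dilations and [Imu] itself are all integrals of this kind ([Imu mu f z] by conversion),
    so linearity and dominated convergence are set up once for functions of a complex variable. *)
Definition rint f : Cx R := cintegral mu `[0, 1[ (fun t => f (rC t)).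

Lemma Re_rint f : complex.Re (rint f) = \int[mu]_(t in `[0, 1[) complex.Re (f (rC t)).
Proof. by rewrite /rint /cintegral; simpc. Qed.

Lemma Im_rint f : complex.Im (rint f) = \int[mu]_(t in `[0, 1[) complex.Im (f (rC t)).
Proof. by rewrite /rint /cintegral; simpc. Qed.

Lemma continuous_rC (t : R) : {for t, continuous (@rC R)}.
Proof. by apply: cvg_ReIm => /=; [exact: cvg_id|exact: cvg_cst]. Qed.

Lemma measurable_radial (h : Cx R -> R) :
  (forall t : R, 0 <= t -> t < 1 -> {for rC t, continuous h}) ->
  measurable_fun (`[0, 1[%classic : set R) (fun t => h (rC t)).
Proof.
move=> hc; apply: subspace_continuous_measurable_fun; first exact: measurable_itv.
apply: continuous_in_subspaceT => t; rewrite inE/= in_itv/= => /andP[t0 t1].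
by apply: continuous_comp; [exact: continuous_rC|exact: hc].
Qed.

Lemma continuous_Im f z : {for z, continuous f} -> {for z, continuous (fun w => complex.Im (f w))}.
Proof. by move=> hz; exact: (cvg_Im _ hz). Qed.

(** Differentiability along the radius supplies measurability, through continuity; [G] supplies
    integrability. *)
Definition dominated f G := [/\ radially_diff f, mu.-integrable `[0, 1[ (EFin \o G) &
  forall t, 0 <= t -> t < 1 -> cmod (f (rC t)) <= G t].

Lemma integrable_of_dominated f G (h : Cx R -> R) : dominated f G ->
  (forall t : R, 0 <= t -> t < 1 -> {for rC t, continuous h}) ->
  (forall t : R, 0 <= t -> t < 1 -> `|h (rC t)| <= cmod (f (rC t))) ->
  mu.-integrable `[0, 1[ (EFin \o (fun t => h (rC t))).
Proof.
move=> [fd Gi fG] hc hf; apply: (le_integrable _ _ _ Gi) => //.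
  by apply/measurable_EFinP; exact: measurable_radial.
move=> t; rewrite /= in_itv/= => /andP[t0 t1]; rewrite lee_fin.
by apply: le_trans (hf t t0 t1) _; apply: le_trans (fG t t0 t1) (ler_norm _).
Qed.

Lemma Re_integrable f G : dominated f G ->
  mu.-integrable `[0, 1[ (EFin \o (fun t => complex.Re (f (rC t)))).
Proof.
move=> fG; apply: (@integrable_of_dominated _ _ (fun z => complex.Re (f z)) fG).
  by move=> t t0 t1; apply/continuous_Re/cdiff_continuous; have [fd _ _] := fG; exact: fd.
by move=> t _ _; exact: Re_le_cmod.
Qed.

Lemma Im_integrable f G : dominated f G ->
  mu.-integrable `[0, 1[ (EFin \o (fun t => complex.Im (f (rC t)))).
Proof.
move=> fG; apply: (@integrable_of_dominated _ _ (fun z => complex.Im (f z)) fG).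
  by move=> t t0 t1; apply/continuous_Im/cdiff_continuous; have [fd _ _] := fG; exact: fd.
by move=> t _ _; exact: Im_le_cmod.
Qed.

Lemma cintegrable_dominated f G : dominated f G -> cintegrable mu `[0, 1[ (fun t => f (rC t)).
Proof. by move=> fG; split; [exact: Re_integrable fG|exact: Im_integrable fG]. Qed.

Lemma eq_rint f g : (forall t, 0 <= t -> t < 1 -> f (rC t) = g (rC t)) -> rint f = rint g.
Proof.
move=> fg; apply: Cx_eq; rewrite ?Re_rint ?Im_rint; apply: eq_Rintegral => t;
  by rewrite inE/= in_itv/= => /andP[t0 t1]; rewrite fg.
Qed.

Lemma rintD f g F G : dominated f F -> dominated g G -> rint (fun z => f z + g z) = rint f + rint g.
Proof.
move=> fF gG; apply: Cx_eq.
  rewrite [RHS]ReD !Re_rint -RintegralD//; [|exact: Re_integrable fF|exact: Re_integrable gG].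
  by apply: eq_Rintegral => t _; rewrite ReD.
rewrite [RHS]ImD !Im_rint -RintegralD//; [|exact: Im_integrable fF|exact: Im_integrable gG].
by apply: eq_Rintegral => t _; rewrite ImD.
Qed.

Lemma dominatedD f g F G : dominated f F -> dominated g G ->
  dominated (fun z => f z + g z) (fun t => F t + G t).
Proof.
move=> [fd Fi fF] [gd Gi gG]; split.
- by move=> t t0 t1; apply: cdiffD; [exact: fd|exact: gd].
- by apply: (integrableD _ Fi Gi).
- by move=> t t0 t1; apply: le_trans (cmodD _ _) _; apply: lerD; [exact: fF|exact: gG].
Qed.

Lemma dominatedM f F (h : Cx R -> Cx R) (b : R) : dominated f F -> radially_diff h ->
  (forall t, 0 <= t -> t < 1 -> cmod (h (rC t)) <= b) ->
  dominated (fun z => h z * f z) (fun t => b * F t).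
Proof.
move=> [fd Fi fF] hd hb; split.
- by move=> t t0 t1; apply: cdiffM; [exact: hd|exact: fd].
- by apply: (integrableZl _ b Fi).
- move=> t t0 t1; rewrite cmodM; apply: ler_pM; rewrite ?cmod_ge0//; [exact: hb|exact: fF].
Qed.

Lemma dominatedZ f F (c : Cx R) : dominated f F -> dominated (fun z => c * f z) (fun t => cmod c * F t).
Proof. by move=> fF; apply: dominatedM => // t _ _; exact: cdiff_cst. Qed.

Lemma rintZ f F (c : Cx R) : dominated f F -> rint (fun z => c * f z) = c * rint f.
Proof.
move=> fF; have Ri := Re_integrable fF; have Ii := Im_integrable fF.
apply: Cx_eq.
  rewrite [RHS]ReM !Re_rint !Im_rint -!RintegralZl// -RintegralB//; last 2 first.
  - by apply: (integrableZl _ (complex.Re c) Ri).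
  - by apply: (integrableZl _ (complex.Im c) Ii).
  by apply: eq_Rintegral => t _; rewrite ReM.
rewrite [RHS]ImM !Re_rint !Im_rint -!RintegralZl// -RintegralD//; last 2 first.
- by apply: (integrableZl _ (complex.Re c) Ii).
- by apply: (integrableZl _ (complex.Im c) Ri).
by apply: eq_Rintegral => t _; rewrite ImM.
Qed.

Lemma rintB f g F G : dominated f F -> dominated g G -> rint (fun z => f z - g z) = rint f - rint g.
Proof.
move=> fF gG; have ngG := dominatedZ (-1) gG.
rewrite -mulN1r -(rintZ (-1) gG) -(rintD fF ngG).
by apply: eq_rint => t _ _; rewrite mulN1r.
Qed.

(* The factor 2 comes from bounding real and imaginary parts separately. *)
Lemma rint_bound f G : dominated f G -> cmod (rint f) <= 2 * \int[mu]_(t in `[0, 1[) G t.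
Proof.
move=> fG; have [_ Gi fG'] := fG.
have B (h : Cx R -> R) : mu.-integrable `[0, 1[ (EFin \o (fun t => h (rC t))) ->
    (forall t : R, 0 <= t -> t < 1 -> `|h (rC t)| <= G t) ->
    `|\int[mu]_(t in `[0, 1[) h (rC t)| <= \int[mu]_(t in `[0, 1[) G t.
  move=> hi hG; apply: le_trans (le_normr_Rintegral _ hi) _ => //.
  apply: le_Rintegral => //; first exact: (integrable_norm hi).
  by move=> t; rewrite /= in_itv/= => /andP[]; exact: hG.
apply: le_trans (cmod_le_ReIm _) _; rewrite Re_rint Im_rint mulr_natl mulr2n; apply: lerD.
  apply: (B (fun z => complex.Re (f z))); first exact: Re_integrable fG.
  by move=> t t0 t1; apply: le_trans (Re_le_cmod _) (fG' t t0 t1).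
apply: (B (fun z => complex.Im (f z))); first exact: Im_integrable fG.
by move=> t t0 t1; apply: le_trans (Im_le_cmod _) (fG' t t0 t1).
Qed.

Lemma rint_cvg (f_ : nat -> Cx R -> Cx R) f G :
  (forall n, dominated (f_ n) G) -> dominated f G ->
  (forall t, 0 <= t -> t < 1 -> (fun n => f_ n (rC t)) @ \oo --> f (rC t)) ->
  (fun n => rint (f_ n)) @ \oo --> rint f.
Proof.
move=> fG [fd Gi fG'] cf.
have B (h_ : nat -> Cx R -> R) (h : Cx R -> R) :
    (forall n, mu.-integrable `[0, 1[ (EFin \o (fun t => h_ n (rC t)))) ->
    mu.-integrable `[0, 1[ (EFin \o (fun t => h (rC t))) ->
    (forall n (t : R), 0 <= t -> t < 1 -> `|h_ n (rC t)| <= G t) ->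
    (forall t : R, 0 <= t -> t < 1 -> (fun n => h_ n (rC t)) @ \oo --> h (rC t)) ->
    (fun n => \int[mu]_(t in `[0, 1[) h_ n (rC t)) @ \oo --> \int[mu]_(t in `[0, 1[) h (rC t).
  move=> ih_ ih hG ch.
  apply: fine_cvg; rewrite /Rintegral fineK; last by apply: (integrable_fin_num _ ih).
  apply: (@dominated_cvg _ _ _ mu _ _ (fun n t => (h_ n (rC t))%:E) (fun t => (h (rC t))%:E) (EFin \o G)) => //.
  - by move=> n; exact: (measurable_int mu (ih_ n)).
  - move=> t; rewrite /= in_itv/= => /andP[t0 t1].
    by apply: cvg_EFin; [exact: nearW|exact: ch].
  - by move=> n t; rewrite /= in_itv/= => /andP[t0 t1]; rewrite lee_fin hG.
have fdG : dominated f G by [].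
apply: cvg_ReIm.
  under eq_fun do rewrite Re_rint.
  rewrite Re_rint; apply: (B (fun n z => complex.Re (f_ n z)) (fun z => complex.Re (f z))).
  - by move=> n; exact: Re_integrable (fG n).
  - exact: Re_integrable fdG.
  - by move=> n t t0 t1; have [_ _ h] := fG n; apply: le_trans (Re_le_cmod _) (h t t0 t1).
  - by move=> t t0 t1; apply: (cvg_Re _ (cf t t0 t1)).
under eq_fun do rewrite Im_rint.
rewrite Im_rint; apply: (B (fun n z => complex.Im (f_ n z)) (fun z => complex.Im (f z))).
- by move=> n; exact: Im_integrable (fG n).
- exact: Im_integrable fdG.
- by move=> n t t0 t1; have [_ _ h] := fG n; apply: le_trans (Im_le_cmod _) (h t t0 t1).
- by move=> t t0 t1; apply: (cvg_Im _ (cf t t0 t1)).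
Qed.

End RadialIntegral.

(** * Power series *)

Section PowerSeries.
Variable R : realType.
Implicit Types (s a : nat -> Cx R) (l z w : Cx R).

Lemma cvg_seq_cxP s l : (s @ \oo --> l) <->
  (forall e : R, 0 < e -> exists n0, forall n, (n0 <= n)%N -> cmod (s n - l) < e).
Proof.
rewrite cvg_cxP; split => H e /H.
  by move=> [n0 _ h]; exists n0 => n n0n; exact: h.
by move=> [n0 h]; exists n0 => // n /= n0n; exact: h.
Qed.

Lemma cvg_seq_unique s l l' : s @ \oo --> l -> s @ \oo --> l' -> l = l'.
Proof.
move=> /cvg_seq_cxP sl /cvg_seq_cxP sl'; apply/eqP; rewrite -subr_eq0 -cmod_eq0.
rewrite eq_le cmod_ge0 andbT leNgt; apply/negP => d0.
have d20 : 0 < cmod (l - l') / 2 by rewrite divr_gt0.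
have [n h] := sl _ d20; have [n' h'] := sl' _ d20.
have := h (maxn n n') (leq_maxl _ _); have := h' (maxn n n') (leq_maxr _ _).
have : cmod (l - l') <= cmod (s (maxn n n') - l') + cmod (s (maxn n n') - l).
  have -> : l - l' = (s (maxn n n') - l') - (s (maxn n n') - l) by ring.
  exact: cmodB.
lra.
Qed.

Lemma lim_seqE s l : s @ \oo --> l -> lim (s @ \oo) = l.
Proof.
move=> sl; have sc : cvg (s @ \oo) by apply/cvg_ex; exists l.
exact: (cvg_seq_unique sc sl).
Qed.

Lemma geometric_small (B q e : R) : 0 <= B -> 0 <= q -> q < 1 -> 0 < e ->
  exists n0, forall n, (n0 <= n)%N -> B * q ^+ n < e.
Proof.
move=> B0 q0 q1 e0.
have [q00|qn0] := eqVneq q 0.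
  by exists 1%N => -[//|n] _; rewrite q00 expr0n mulr0.
have qp : 0 < q by rewrite lt_def qn0.
have [n Hn] : exists n, (B + 1) / e < (q^-1) ^+ n.
  by apply: expr_unbounded; rewrite invf_gt1.
exists n => m nm; apply: le_lt_trans (_ : B * q ^+ n < e).
  by rewrite ler_wpM2l// ler_wiXn2l// ltW.
move: Hn; rewrite exprVn ltr_pdivrMr// mulrC ltr_pdivlMr ?exprn_gt0//.
by have := exprn_gt0 n qp; lra.
Qed.

Lemma series_term_bounded s l : series s @ \oo --> l ->
  exists2 B : R, 0 <= B & forall n, cmod (s n) <= B.
Proof.
move=> /cvg_seq_cxP H; have [n0 Hn0] := H (1/2) ltac:(by rewrite divr_gt0).
exists (1 + \sum_(k < n0) cmod (s k)).
  by rewrite addr_ge0// sumr_ge0// => k _; exact: cmod_ge0.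
have S0 : 0 <= \sum_(k < n0) cmod (s k) by rewrite sumr_ge0// => k _; exact: cmod_ge0.
move=> n; have [nn0|n0n] := ltnP n n0.
  rewrite (bigD1 (Ordinal nn0))//=.
  have : 0 <= \sum_(i < n0 | i != Ordinal nn0) cmod (s i) by rewrite sumr_ge0// => k _; exact: cmod_ge0.
  lra.
have h1 := Hn0 n n0n; have h2 := Hn0 n.+1 (leqW n0n).
have -> : s n = (series s n.+1 - l) - (series s n - l).
  by rewrite /series/= big_nat_recr//=; ring.
by apply: le_trans (cmodB _ _) _; lra.
Qed.

(** In [P K - l], the first [n0] errors [E k] carry the factor [1 - r] and the later ones are below
    [e / 2]. The Abel sum [m] enters through its defining convergence, so no [lim] has to be
    computed. *)
Lemma abel_limit s l : series s @ \oo --> l ->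
  forall e : R, 0 < e -> exists2 del : R, 0 < del &
    forall (r : R) m, 0 < r -> r < 1 -> 1 - del < r ->
      series (fun k => s k * rC r ^+ k) @ \oo --> m -> cmod (m - l) <= e.
Proof.
move=> sl e e0; have /cvg_seq_cxP H := sl.
have e20 : 0 < e / 2 by rewrite divr_gt0.
have [n0 Hn0] := H _ e20.
pose E k := series s k - l.
pose A := \sum_(k < n0) cmod (E k.+1).
have A0 : 0 <= A by rewrite sumr_ge0// => k _; exact: cmod_ge0.
(* For [1 - r] below this value the first [n0] errors contribute at most [(1 - r) * A <= e / 2]. *)
exists (e / (2 * (A + 1))).
  by rewrite divr_gt0// mulr_gt0// ltr_wpDl.
move=> r m r0 r1 rdel /cvg_seq_cxP Hm.
pose P K := series (fun k => s k * rC r ^+ k) K.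
(* Summation by parts, with the limit [l] subtracted from the partial sums. *)
have PE K : P K - l = E K * rC r ^+ K + rC (1 - r) * \sum_(k < K) E k.+1 * rC r ^+ k.
  elim: K => [|K IH].
    by rewrite /P /E /series/= !big_nil big_ord0 expr0; ring.
  have -> : P K.+1 = P K + s K * rC r ^+ K by rewrite /P /series/= big_nat_recr.
  have -> : s K = E K.+1 - E K by rewrite /E /series/= big_nat_recr//=; ring.
  rewrite addrAC IH big_ord_recr /= exprS rCB rC1; ring.
have sumB K : cmod (rC (1 - r) * \sum_(k < K) E k.+1 * rC r ^+ k) <= (1 - r) * A + e / 2 * (1 - r ^+ K).
  have T K' : \sum_(k < K') cmod (E k.+1 * rC r ^+ k) <= A + e / 2 * \sum_(k < K') r ^+ k.
    rewrite mulr_sumr.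
    have hk k : cmod (E k.+1 * rC r ^+ k) <= (if (k < n0)%N then cmod (E k.+1) else 0) + e / 2 * r ^+ k.
      have rk0 : 0 <= r ^+ k by rewrite exprn_ge0// ltW.
      have rk1 : r ^+ k <= 1 by rewrite exprn_ile1// ltW.
      rewrite cmodM cmodX cmod_rC gtr0_norm//; case: ifPn => [_|].
        have := ler_wpM2l (cmod_ge0 (E k.+1)) rk1; have := mulr_ge0 (ltW e20) rk0; lra.
      rewrite -leqNgt => n0k; rewrite add0r ler_wpM2r//; apply/ltW/Hn0; exact: leqW.
    apply: le_trans (ler_sum _ (fun (k : 'I_K') _ => hk k)) _; rewrite big_split /= lerD2r.
    rewrite -big_mkcond /= /A -(big_mkord (fun k => (k < n0)%N) (fun k => cmod (E k.+1))) -(big_mkord xpredT (fun k => cmod (E k.+1))).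
    have [K'n|nK'] := leqP K' n0.
      rewrite (@big_cat_nat _ _ _ K' 0 n0)//= big_mkcond /=.
      apply: le_trans (_ : \sum_(0 <= i < K') cmod (E i.+1) <= _).
        by apply: ler_sum => i _; case: ifP => // _; exact: cmod_ge0.
      by rewrite lerDl sumr_ge0// => i _; exact: cmod_ge0.
    rewrite (@big_cat_nat _ _ _ n0 0 K') ?(ltnW nK')//=.
    rewrite [X in _ + X]big_nat_cond [X in _ + X]big1 ?addr0; last first.
      by move=> i /andP[/andP[n0i _]]; rewrite ltnNge n0i.
    by rewrite big_mkcond /=; apply: ler_sum => i _; case: ifP => // _; exact: cmod_ge0.
  have G K' : (1 - r) * \sum_(k < K') r ^+ k = 1 - r ^+ K'.
    elim: K' => [|K' IH]; first by rewrite big_ord0 mulr0 expr0 subrr.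
    by rewrite big_ord_recr /= mulrDr IH exprS; ring.
  have r10 : 0 <= 1 - r by lra.
  have tri K' : cmod (\sum_(k < K') E k.+1 * rC r ^+ k) <= \sum_(k < K') cmod (E k.+1 * rC r ^+ k).
    elim: K' => [|K' IH]; first by rewrite !big_ord0 cmod0.
    rewrite !big_ord_recr /=; apply: le_trans (cmodD _ _) _.
    by rewrite lerD2r.
  rewrite cmodM cmod_rC ger0_norm//.
  apply: le_trans (ler_wpM2l r10 (le_trans (tri K) (T K))) _.
  by rewrite mulrDr mulrCA G.
apply/ler_addgt0Pr => e' e'0.
have e'40 : 0 < e' / 4 by rewrite divr_gt0.
have [n1 Hn1] := Hm _ e'40.
have [n2 Hn2] := geometric_small (ltW e20) (ltW r0) r1 e'40.
pose K := maxn n0 (maxn n1 n2).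
have h1 := Hn1 K (leq_trans (leq_maxl n1 n2) (leq_maxr _ _)).
have h2 := Hn2 K (leq_trans (leq_maxr n1 n2) (leq_maxr _ _)).
have h0 := Hn0 K (leq_maxl _ _).
have hA : (1 - r) * A <= e / 2.
  have : 1 - r <= e / (2 * (A + 1)) by lra.
  rewrite ler_pdivlMr; last by rewrite mulr_gt0// ltr_wpDl.
  by have := mulr_ge0 (ltac:(lra) : 0 <= 1 - r) A0; lra.
have -> : m - l = (P K - l) - (P K - m) by ring.
apply: le_trans (cmodB _ _) _; rewrite PE.
have : cmod (E K * rC r ^+ K) <= e / 2 * r ^+ K.
  rewrite cmodM cmodX cmod_rC gtr0_norm// ler_wpM2r ?exprn_ge0 ?(ltW r0)//.
  exact: ltW h0.
have := cmodD (E K * rC r ^+ K) (rC (1 - r) * \sum_(k < K) E k.+1 * rC r ^+ k).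
have := sumB K; rewrite -/(P K) in h1.
lra.
Qed.

(** The terms are bounded at the larger radius [rho], hence decay like [(r / rho) ^+ k] for
    [|w| <= r]. Uniformity in [w] is what permits integrating the Taylor series along the radius. *)
Lemma taylor_tail a (f : Cx R -> Cx R) (r : R) : taylor_coeffs a f -> 0 < r -> r < 1 ->
  exists B q : R, [/\ 0 <= B, 0 <= q, q < 1 & forall w, cmod w <= r -> forall K,
    cmod (f w - \sum_(k < K) a k * w ^+ k) <= B * q ^+ K].
Proof.
move=> af r0 r1; pose rho := (1 + r) / 2.
have rho0 : 0 < rho by rewrite /rho; lra.
have rho1 : rho < 1 by rewrite /rho; lra.
have rr : r < rho by rewrite /rho; lra.
have [B B0 HB] := series_term_bounded (af (rC rho) (ltac:(by rewrite /disc/= cmod_rC gtr0_norm))).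
pose q := r / rho.
have q0 : 0 <= q by rewrite divr_ge0// ltW.
have q1 : q < 1 by rewrite ltr_pdivrMr// mul1r.
have d0 : 0 < 1 - q by lra.
exists (B / (1 - q)), q; split=> //; first by rewrite divr_ge0// ltW.
move=> w wr K.
have tk k : cmod (a k * w ^+ k) <= B * q ^+ k.
  rewrite cmodM cmodX; apply: le_trans (_ : cmod (a k) * r ^+ k <= _).
    by rewrite ler_wpM2l ?cmod_ge0// lerXn2r ?nnegrE ?cmod_ge0// ltW.
  have -> : cmod (a k) * r ^+ k = cmod (a k * rC rho ^+ k) * q ^+ k.
    rewrite cmodM cmodX cmod_rC gtr0_norm// -mulrA -exprMn /q mulrCA mulfV ?mulr1//.
    by rewrite gt_eqF.
  by rewrite ler_wpM2r ?exprn_ge0.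
(* The factor [1 - q ^+ L] makes the inductive step an exact geometric identity. *)
have diff L : cmod (\sum_(k < K + L) a k * w ^+ k - \sum_(k < K) a k * w ^+ k) <= B / (1 - q) * q ^+ K * (1 - q ^+ L).
  elim: L => [|L IH]; first by rewrite addn0 subrr cmod0 expr0 subrr mulr0.
  rewrite addnS big_ord_recr /= addrAC; apply: le_trans (cmodD _ _) _.
  apply: le_trans (lerD IH (tk _)) _; rewrite exprD exprS le_eqVlt; apply/orP; left; apply/eqP.
  by field; rewrite gt_eqF.
apply/ler_addgt0Pr => e e0.
have wd : disc w by rewrite /disc/=; lra.
have /cvg_seq_cxP /(_ e e0) [n0 Hn0] := af w wd.
have := Hn0 (K + n0)%N (leq_addl _ _); rewrite /series/= big_mkord => h1.
have -> : f w - \sum_(k < K) a k * w ^+ k =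
  (\sum_(k < K + n0) a k * w ^+ k - \sum_(k < K) a k * w ^+ k) -
  (\sum_(k < K + n0) a k * w ^+ k - f w) by ring.
apply: le_trans (cmodB _ _) _; apply: lerD; last exact: ltW.
apply: le_trans (diff n0) _; rewrite ler_piMr//; last by rewrite gerBl exprn_ge0.
by rewrite mulr_ge0 ?exprn_ge0// divr_ge0// ltW.
Qed.

End PowerSeries.

(** * Well-definedness, continuity and the Abel expansion *)

Section Conclusions.
Variables (R : realType) (mu : {measure set R -> \bar R}).
Hypothesis mufin : (mu setT < +oo)%E.
Implicit Types (f g : Cx R -> Cx R) (N : R -> R) (z w : Cx R).

Lemma integrable_cst_itv (c : R) : mu.-integrable `[0, 1[ (EFin \o (fun=> c)).
Proof.
apply: measurable_bounded_integrable => //.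
- by apply: le_lt_trans mufin; apply: le_measure; rewrite ?inE.
- by exists `|c|; split => // M cM t _; exact: ltW.
Qed.

Lemma radially_diffX n : radially_diff (fun w : Cx R => w ^+ n).
Proof. by move=> t _ _; apply: cdiffX; exact: cdiff_id. Qed.

Lemma cmod_rCX_le1 n (t : R) : 0 <= t -> t < 1 -> cmod (rC t ^+ n) <= 1.
Proof. by move=> t0 t1; rewrite cmodX cmod_rC ger0_norm// exprn_ile1// ltW. Qed.

Lemma dominatedX n : dominated mu (fun w : Cx R => w ^+ n) (fun=> 1).
Proof.
split; [exact: radially_diffX|exact: integrable_cst_itv|].
by move=> t t0 t1; exact: cmod_rCX_le1.
Qed.

Lemma rintX n : rint mu (fun w => w ^+ n) = rC (moment mu n).
Proof.
apply: Cx_eq; rewrite ?Re_rint ?Im_rint /=.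
  by apply: eq_Rintegral => t _; rewrite -rCX.
under eq_Rintegral do rewrite -rCX /=.
by rewrite Rintegral_cst// mul0r.
Qed.

Lemma one_sub_bound (t rho : R) z : 0 <= t -> t < 1 -> cmod z <= rho -> 1 - rho <= cmod (1 - rC t * z).
Proof.
move=> t0 t1 zr; have := cmod_ger_dist 1 (rC t * z).
rewrite cmod1 cmodM cmod_rC ger0_norm//.
have : t * cmod z <= cmod z by rewrite ler_piMl ?cmod_ge0// ltW.
lra.
Qed.

Lemma inv_one_sub_bound (t rho : R) z : 0 <= t -> t < 1 -> rho < 1 -> cmod z <= rho ->
  cmod (1 - rC t * z)^-1 <= (1 - rho)^-1.
Proof.
move=> t0 t1 r1 zr; have h := one_sub_bound t0 t1 zr.
by rewrite cmodV lef_pV2 ?posrE//; lra.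
Qed.

Lemma one_sub_neq0 (t : R) z : 0 <= t -> t < 1 -> disc z -> 1 - rC t * z != 0.
Proof. by move=> t0 t1 zd; apply: sub1_mul_neq0 => //; exact: ltW. Qed.

Lemma cdiff_one_sub (t : R) z : cdiff (fun w => 1 - w * z) (rC t).
Proof.
apply: cdiffB; first exact: cdiff_cst.
by apply: cdiffM; [exact: cdiff_id|exact: cdiff_cst].
Qed.

Section dominant.
Variables (f : Cx R -> Cx R) (N : R -> R).
Hypotheses (fh : holo f) (fN : forall s t, 0 <= s -> s <= t -> t < 1 -> cmod (f (rC s)) <= N t)
  (Ni : mu.-integrable `[0, 1[ (EFin \o N)).

Let fd : radially_diff f.
Proof. by move=> t t0 t1; apply/derivable_cderiv/fh; rewrite /disc/= cmod_rC ger0_norm. Qed.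

Let fN' t : 0 <= t -> t < 1 -> cmod (f (rC t)) <= N t.
Proof. by move=> t0 t1; apply: fN. Qed.

Let N0 t : 0 <= t -> t < 1 -> 0 <= N t.
Proof. by move=> t0 t1; apply: le_trans (fN' t0 t1); exact: cmod_ge0. Qed.

(** Here the monotone form of the majorant is used: [r * t <= t] gives [|f(rt)| <= N t], uniformly
    in [r]. *)
Lemma dominated_dilation n (r : R) : 0 < r -> r <= 1 ->
  dominated mu (fun w => w ^+ n * f (rC r * w)) (fun t => 1 * N t).
Proof.
move=> r0 r1.
have rt (t : R) : 0 <= t -> t < 1 -> 0 <= r * t /\ r * t <= t.
  by move=> t0 t1; rewrite mulr_ge0 ?(ltW r0)// ler_piMl.
apply: (@dominatedM _ _ (fun w => f (rC r * w))); last 2 first.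
- exact: radially_diffX.
- by move=> t t0 t1; exact: cmod_rCX_le1.
split=> //.
- move=> t t0 t1; have [h1 h2] := rt t t0 t1; apply: cdiff_scale; rewrite -rCM.
  by apply: fd => //; exact: le_lt_trans h2 t1.
- by move=> t t0 t1; have [h1 h2] := rt t t0 t1; rewrite -rCM; exact: fN.
Qed.

Lemma kernel_dominated (rho : R) z : rho < 1 -> cmod z <= rho ->
  dominated mu (fun w => f w / (1 - w * z)) (fun t => (1 - rho)^-1 * N t).
Proof.
move=> r1 zr; have zd : disc z by rewrite /disc/=; lra.
split.
- move=> t t0 t1; apply: cdiff_div; [exact: one_sub_neq0|exact: fd|exact: cdiff_one_sub].
- by apply: (integrableZl _ _ Ni).
- move=> t t0 t1; rewrite cmodM mulrC; apply: ler_pM; rewrite ?cmod_ge0//.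
    exact: inv_one_sub_bound.
  exact: fN'.
Qed.

(** Differentiation under the integral with an explicit remainder: with [D] the derivative of the
    kernel in [z] at [z0], the error [Phi] is [(z - z0)^2 w^2 f(w) / ((1 - wz) (1 - w z0)^2)], which
    is integrable and quadratic in [z - z0]. *)
Lemma Imu_holo : holo (Imu mu f).
Proof.
move=> z0 z0d; apply/derivable_cderiv.
pose rho := (1 + cmod z0) / 2.
have r1 : rho < 1 by move: z0d; rewrite /disc/= /rho; lra.
have z0r : cmod z0 < rho by move: z0d; rewrite /disc/= /rho; lra.
pose q : R := (1 - rho)^-1; have q0 : 0 < q by rewrite invr_gt0; lra.
pose D w := w * f w / (1 - w * z0) ^+ 2.
have Dd (t : R) : 0 <= t -> t < 1 -> cdiff D (rC t).
  move=> t0 t1; apply: cdiff_div; first by rewrite expf_neq0// one_sub_neq0.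
    by apply: cdiffM; [exact: cdiff_id|exact: fd].
  by apply: cdiffX; exact: cdiff_one_sub.
have tC (t : R) : 0 <= t -> t < 1 -> cmod (rC t) <= 1.
  by move=> t0 t1; have := cmod_rCX_le1 1 t0 t1; rewrite expr1.
have DN : dominated mu D (fun t => q ^+ 2 * N t).
  split => //; first by apply: (integrableZl _ _ Ni).
  move=> t t0 t1; have h := inv_one_sub_bound t0 t1 r1 (ltW z0r).
  have -> : D (rC t) = (1 - rC t * z0)^-1 ^+ 2 * (rC t * f (rC t)) by rewrite /D exprVn mulrC.
  rewrite (cmodM (_ ^+ 2)) (cmodM (rC t)) cmodX; apply: ler_pM; rewrite ?exprn_ge0 ?mulr_ge0 ?cmod_ge0//.
    by rewrite lerXn2r ?nnegrE ?cmod_ge0// ltW.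
  by apply: le_trans (fN' t0 t1); rewrite ler_piMl ?cmod_ge0// tC.
set K := 2 * \int[mu]_(t in `[0, 1[) N t.
have K0 : 0 <= K.
  rewrite mulr_ge0//; apply: Rintegral_ge0 => t; rewrite /= in_itv/= => /andP[t0 t1].
  exact: N0.
exists (rint mu D) => e e0.
(* The first bound keeps [z] in the disc of radius [rho], where the inverse denominators are at most
   [q]; the second gives [|z - z0| * (q ^+ 3 * K) <= e]. *)
pose del := Num.min (rho - cmod z0) (e / (q ^+ 3 * K + 1)).
have c0 : 0 < q ^+ 3 * K + 1 by rewrite ltr_wpDl// mulr_ge0// exprn_ge0// ltW.
exists del; first by rewrite lt_min subr_gt0 z0r divr_gt0.
move=> z; rewrite lt_min => /andP[zz zz'].
have zr : cmod z <= rho by have := cmod_ger_dist z z0; lra.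
have zd : disc z by rewrite /disc/=; lra.
have kz := kernel_dominated r1 zr; have kz0 := kernel_dominated r1 (ltW z0r).
pose Phi w := f w / (1 - w * z) - f w / (1 - w * z0) - (z - z0) * D w.
have -> : Imu mu f z - Imu mu f z0 - rint mu D * (z - z0) = rint mu Phi.
  rewrite /Imu -/(rint mu (fun w => f w / (1 - w * z))) -/(rint mu (fun w => f w / (1 - w * z0))).
  rewrite mulrC -(rintZ (z - z0) DN) -(rintB kz kz0).
  have kk : dominated mu (fun w => f w / (1 - w * z) - f w / (1 - w * z0))
      (fun t => (1 - rho)^-1 * N t + cmod (-1 : Cx R) * ((1 - rho)^-1 * N t)).
    have := dominatedD kz (dominatedZ (-1) kz0).
    congr (dominated mu _ _); apply/funext => w; by rewrite mulN1r.
  by rewrite -(rintB kk (dominatedZ (z - z0) DN)).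
have PN : dominated mu Phi (fun t => (cmod (z - z0) ^+ 2 * q ^+ 3) * N t).
  split.
  - move=> t t0 t1; apply: cdiffB; first apply: cdiffB.
    + by apply: cdiff_div; [exact: one_sub_neq0|exact: fd|exact: cdiff_one_sub].
    + by apply: cdiff_div; [exact: one_sub_neq0|exact: fd|exact: cdiff_one_sub].
    + by apply: cdiffM; [exact: cdiff_cst|exact: Dd].
  - by apply: (integrableZl _ _ Ni).
  move=> t t0 t1.
  have n1 := one_sub_neq0 t0 t1 zd; have n0 := one_sub_neq0 t0 t1 z0d.
  have -> : Phi (rC t) = (z - z0) ^+ 2 * ((1 - rC t * z)^-1 * (1 - rC t * z0)^-1 ^+ 2) * (rC t ^+ 2 * f (rC t)).
    by rewrite /Phi /D; field; rewrite n1 n0.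
  rewrite (cmodM (_ * _)) (cmodM (_ ^+ 2) (_ * _)) (cmodM _^-1) (cmodM (rC t ^+ 2)) !cmodX; apply: ler_pM; rewrite ?mulr_ge0 ?exprn_ge0 ?cmod_ge0//.
    apply: ler_wpM2l; first by rewrite exprn_ge0// cmod_ge0.
    rewrite [q ^+ 3]exprS; apply: ler_pM; rewrite ?exprn_ge0 ?cmod_ge0//.
      exact: inv_one_sub_bound.
    rewrite lerXn2r ?nnegrE ?cmod_ge0 ?(ltW q0)//.
    by apply: inv_one_sub_bound => //; exact: ltW.
  apply: le_trans (fN' t0 t1); rewrite ler_piMl ?cmod_ge0//.
  by rewrite exprn_ile1 ?cmod_ge0// tC.
apply: le_trans (rint_bound PN) _; rewrite RintegralZl//.
have -> : 2 * (cmod (z - z0) ^+ 2 * q ^+ 3 * \int[mu]_(t in `[0, 1[) N t) =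
  cmod (z - z0) * (cmod (z - z0) * (q ^+ 3 * K)) by rewrite /K; ring.
rewrite mulrC ler_wpM2r ?cmod_ge0//.
move: zz'; rewrite ltr_pdivlMr//; have := cmod_ge0 (z - z0); lra.
Qed.

Variable a : nat -> Cx R.
Hypothesis af : taylor_coeffs a f.

(** The partial sums are integrals of [t^n] times Taylor polynomials of [f(rt)], which converge
    geometrically and uniformly on the radius because [r < 1]; the finite measure does the rest. *)
Lemma moment_series_dilation n (r : R) : 0 < r -> r < 1 ->
  series (fun k => rC (moment mu (n + k)) * a k * rC r ^+ k) @ \oo -->
  rint mu (fun w => w ^+ n * f (rC r * w)).
Proof.
move=> r0 r1.
pose T K w := \sum_(k < K) (a k * rC r ^+ k) * w ^+ (n + k).
have TE K : exists G, dominated mu (T K) G /\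
    \sum_(k < K) rC (moment mu (n + k)) * a k * rC r ^+ k = rint mu (T K).
  elim: K => [|K [G [TG IH]]].
    have E : T 0%N = (fun w => 0 * w ^+ 0) by apply/funext => w; rewrite /T big_ord0 mul0r.
    exists (fun t => cmod (0 : Cx R) * 1); rewrite big_ord0 E.
    split; first exact: dominatedZ (dominatedX 0).
    by rewrite (rintZ 0 (dominatedX 0)) mul0r.
  have h := dominatedZ (a K * rC r ^+ K) (dominatedX (n + K)).
  exists (fun t => G t + cmod (a K * rC r ^+ K) * 1).
  have E : T K.+1 = (fun w => T K w + (a K * rC r ^+ K) * w ^+ (n + K)).
    by apply/funext => w; rewrite /T big_ord_recr.
  rewrite E; split; first exact: dominatedD.
  rewrite (rintD TG h) (rintZ _ (dominatedX (n + K))) big_ord_recr /= IH rintX.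
  by congr (_ + _); ring.
have [B [q [B0 q0 q1 HB]]] := taylor_tail af r0 r1.
pose V := \int[mu]_(t in `[0, 1[) (1 : R).
have V0 : 0 <= V by apply: Rintegral_ge0.
apply/cvg_seq_cxP => e e0.
have [n0 Hn0] := geometric_small (mulr_ge0 (ler0n _ 2) (mulr_ge0 B0 V0)) q0 q1 e0.
exists n0 => K n0K; rewrite /series/= big_mkord; have [G [TG ->]] := TE K.
have fdil := dominated_dilation n r0 (ltW r1).
rewrite -(rintB TG fdil).
have D : dominated mu (fun z => T K z - z ^+ n * f (rC r * z)) (fun t => B * q ^+ K * 1).
  split.
  - have [h1 _ _] := TG; have [h2 _ _] := fdil.
    by move=> t t0 t1; apply: cdiffB; [exact: h1|exact: h2].
  - by apply: (integrableZl _ _ (integrable_cst_itv 1)).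
  move=> t t0 t1; rewrite mulr1.
  have -> : T K (rC t) - rC t ^+ n * f (rC r * rC t) =
      - (rC t ^+ n * (f (rC r * rC t) - \sum_(k < K) a k * (rC r * rC t) ^+ k)).
    rewrite mulrBr opprB; congr (_ - _); rewrite /T mulr_sumr; apply: eq_bigr => k _.
    by rewrite exprMn exprD; ring.
  rewrite cmodN cmodM; apply: le_trans (_ : 1 * cmod (f (rC r * rC t) - \sum_(k < K) a k * (rC r * rC t) ^+ k) <= _).
    by apply: ler_wpM2r; [exact: cmod_ge0|exact: cmod_rCX_le1].
  rewrite mul1r; apply: HB; rewrite -rCM cmod_rC ger0_norm ?mulr_ge0 ?(ltW r0)//.
  by rewrite ler_piMr ?(ltW r0)// ltW.
apply: le_lt_trans (rint_bound D) _; rewrite RintegralZl//; last exact: integrable_cst_itv.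
by have := Hn0 K n0K; rewrite -/V; lra.
Qed.

Let b n := rint mu (fun w => w ^+ n * f w).

Lemma dominated_moment n : dominated mu (fun w => w ^+ n * f w) (fun t => 1 * N t).
Proof.
have := @dominated_dilation n 1 ltr01 (lexx _).
by congr (dominated mu _ _); apply/funext => w; rewrite rC1 mul1r.
Qed.

Lemma rint_dilation_cvg n :
  (fun r : R => rint mu (fun w => w ^+ n * f (rC r * w))) r @[r --> (1:R)^'-] --> b n.
Proof.
(* Dominated convergence is sequential, so the left limit at 1 is tested along sequences; the shift
   by [k0] discards the terms that are not yet positive. *)
have seqc (u : nat -> R) : (forall k, u k < 1) -> u @ \oo --> (1 : R) ->
    (fun k => rint mu (fun w => w ^+ n * f (rC (u k) * w))) @ \oo --> b n.
  move=> u1 uc.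
  have [k0 _ Hk0] : \forall k \near \oo, 0 < u k.
    by move/cvgrPdist_lt : uc => /(_ 1 ltr01); apply: filterS => k; rewrite ltr_norml; lra.
  rewrite -(cvg_shiftn k0).
  apply: (@rint_cvg _ _ (fun k w => w ^+ n * f (rC (u (k + k0)%N) * w)) _ (fun t => 1 * N t)).
  - move=> k; apply: dominated_dilation; last by apply: ltW; exact: u1.
    by apply: Hk0; rewrite /= leq_addl.
  - exact: dominated_moment.
  move=> t t0 t1; have td : disc (rC t) by rewrite /disc/= cmod_rC ger0_norm.
  have [d hd] := fd t0 t1.
  apply/cvg_seq_cxP => e e0; have [del del0 Hdel] := cderiv_cont hd e0.
  move/cvgrPdist_lt : uc => /(_ _ del0)[k1 _ Hk1].
  exists k1 => k k1k; rewrite -mulrBr cmodM.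
  apply: le_lt_trans (_ : 1 * cmod (f (rC (u (k + k0)%N) * rC t) - f (rC t)) < e).
    by apply: ler_wpM2r; [exact: cmod_ge0|exact: cmod_rCX_le1].
  rewrite mul1r; apply: Hdel.
  have -> : rC (u (k + k0)%N) * rC t - rC t = rC ((u (k + k0)%N - 1) * t).
    by rewrite -rCM -rCB; congr rC; ring.
  have := Hk1 (k + k0)%N; rewrite /= => /(_ (leq_trans k1k (leq_addr _ _))).
  rewrite distrC cmod_rC normrM (ger0_norm t0); apply: le_lt_trans.
  by rewrite ler_piMr// ltW.
apply: cvg_ReIm; apply/cvg_at_leftP => u [u1 uc].
  by apply: (cvg_Re _ (seqc u u1 uc)).
by apply: (cvg_Im _ (seqc u u1 uc)).
Qed.

Lemma abel_summable_moments n : abel_summable (fun k => rC (moment mu (n + k)) * a k) (b n).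
Proof.
split.
  by move=> r /andP[r0 r1]; apply/cvg_ex; eexists; exact: moment_series_dilation r0 r1.
apply: cvg_trans (rint_dilation_cvg (n := n)); apply: near_eq_cvg.
near=> r; apply: esym; apply: lim_seqE; apply: moment_series_dilation.
  by near: r; apply: nbhs_left_gt.
by near: r; apply: nbhs_left_lt.
Unshelve. all: by end_near.
Qed.

(** Summing the finite geometric series under the integral leaves the remainder
    [(tz)^K f(t) / (1 - tz)], of size at most [|z|^K N(t) / (1 - |z|)]. *)
Lemma moment_power_series z : disc z -> series (fun n => b n * z ^+ n) @ \oo --> Imu mu f z.
Proof.
move=> zd; pose rho := cmod z; have r1 : rho < 1 by [].
have r0 : 0 <= rho by exact: cmod_ge0.
have kz := kernel_dominated r1 (lexx rho).
pose T K w := \sum_(k < K) z ^+ k * (w ^+ k * f w).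
have TE K : exists G, dominated mu (T K) G /\ \sum_(k < K) b k * z ^+ k = rint mu (T K).
  elim: K => [|K [G [TG IH]]].
    have E : T 0%N = (fun w => 0 * (w ^+ 0 * f w)) by apply/funext => w; rewrite /T big_ord0 mul0r.
    exists (fun t => cmod (0 : Cx R) * (1 * N t)); rewrite big_ord0 E.
    split; first exact: dominatedZ (dominated_moment 0).
    by rewrite (rintZ 0 (dominated_moment 0)) mul0r.
  have h := dominatedZ (z ^+ K) (dominated_moment K).
  exists (fun t => G t + cmod (z ^+ K) * (1 * N t)).
  have E : T K.+1 = (fun w => T K w + z ^+ K * (w ^+ K * f w)).
    by apply/funext => w; rewrite /T big_ord_recr.
  rewrite E; split; first exact: dominatedD.
  by rewrite (rintD TG h) (rintZ _ (dominated_moment K)) big_ord_recr /= IH mulrC.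
set V := \int[mu]_(t in `[0, 1[) N t.
have V0 : 0 <= V.
  apply: Rintegral_ge0 => t; rewrite /= in_itv/= => /andP[t0 t1]; exact: N0.
have i0 : 0 <= (1 - rho)^-1 by rewrite invr_ge0; lra.
apply/cvg_seq_cxP => e e0.
have [n0 Hn0] := geometric_small (mulr_ge0 (ler0n _ 2) (mulr_ge0 i0 V0)) r0 r1 e0.
exists n0 => K n0K; rewrite /series/= big_mkord; have [G [TG ->]] := TE K.
rewrite /Imu -/(rint mu (fun w => f w / (1 - w * z))) cmod_distC -(rintB kz TG).
have D : dominated mu (fun w => f w / (1 - w * z) - T K w) (fun t => (1 - rho)^-1 * rho ^+ K * N t).
  split.
  - have [h1 _ _] := TG; have [h2 _ _] := kz.
    by move=> t t0 t1; apply: cdiffB; [exact: h2|exact: h1].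
  - by apply: (integrableZl _ _ Ni).
  move=> t t0 t1.
  have n1 := one_sub_neq0 t0 t1 zd.
  have geo k : (1 - rC t * z) * \sum_(i < k) z ^+ i * (rC t ^+ i * f (rC t)) =
      f (rC t) - (rC t * z) ^+ k * f (rC t).
    elim: k => [|k IH]; first by rewrite big_ord0 mulr0 expr0 mul1r subrr.
    by rewrite big_ord_recr /= mulrDr IH exprS !exprMn; ring.
  have -> : f (rC t) / (1 - rC t * z) - T K (rC t) = (1 - rC t * z)^-1 * (rC t * z) ^+ K * f (rC t).
    apply: (mulfI n1); rewrite mulrBr geo mulrCA mulfV// mulr1 !mulrA mulfV// mul1r.
    by ring.
  rewrite !cmodM; apply: ler_pM; rewrite ?mulr_ge0 ?cmod_ge0//; last exact: fN'.
  apply: ler_pM; rewrite ?cmod_ge0//; first exact: inv_one_sub_bound.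
  rewrite cmodX cmodM cmod_rC ger0_norm// lerXn2r ?nnegrE ?mulr_ge0//.
  by rewrite ler_piMl// ltW.
apply: le_lt_trans (rint_bound D) _; rewrite RintegralZl//.
by have := Hn0 K n0K; rewrite -/V; lra.
Qed.

Lemma moment_series_sum n l : series (fun k => rC (moment mu (n + k)) * a k) @ \oo --> l -> l = b n.
Proof.
move=> sl; have := rint_dilation_cvg (n := n); rewrite cvg_cxP => H.
apply/eqP; rewrite -subr_eq0 -cmod_eq0 eq_le cmod_ge0 andbT leNgt; apply/negP => d0.
have d30 : 0 < cmod (l - b n) / 3 by rewrite divr_gt0.
have [del del0 Hdel] := abel_limit sl d30.
have {}H := H _ d30; near (1 : R)^'- => r.
have r0 : 0 < r by near: r; apply: nbhs_left_gt.
have r1 : r < 1 by near: r; apply: nbhs_left_lt.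
have rd : 1 - del < r by near: r; apply: nbhs_left_gt; lra.
have h1 := Hdel r _ r0 r1 rd (moment_series_dilation r0 r1).
have h2 : cmod (rint mu (fun w => w ^+ n * f (rC r * w)) - b n) < cmod (l - b n) / 3 by near: r.
have : cmod (l - b n) <= cmod (rint mu (fun w => w ^+ n * f (rC r * w)) - b n) +
    cmod (rint mu (fun w => w ^+ n * f (rC r * w)) - l).
  set m := rint mu _; have -> : l - b n = (m - b n) - (m - l) by ring.
  exact: cmodB.
lra.
Unshelve. all: by end_near.
Qed.

End dominant.

(** The continuous function [1 / (1 - |z|)] is bounded on [K], by [M'] say, and then [1 - 1 / M']
    bounds [|z|]. *)
Lemma compact_disc_bound (K : set (Cx R)) : compact K -> K `<=` disc (R := R) ->
  exists2 rho : R, rho < 1 & forall z, K z -> cmod z <= rho.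
Proof.
move=> cK KD; pose g z := (1 - cmod z)^-1.
have gc : {in K, continuous g}.
  move=> z; rewrite inE => /KD zd.
  have n0 : 1 - cmod z != 0 by rewrite subr_eq0 gt_eqF.
  have c1 : {for z, continuous (fun w : Cx R => 1 - cmod w)}.
    exact (@cvgB _ _ _ (nbhs z) _ (fun=> (1 : R)) _ _ _ (cvg_cst _) (@continuous_cmod R z)).
  exact (cvgV n0 c1).
have := continuous_compact (continuous_in_subspaceT gc) cK.
move=> /compact_bounded[M [_ HM]].
pose M' := Num.max 1 (M + 1).
have M'0 : 0 < M' by rewrite lt_max ltr01.
exists (1 - M'^-1); first by rewrite ltrBlDr ltrDl invr_gt0.
move=> z Kz; have zd := KD z Kz; have h0 : 0 < 1 - cmod z by rewrite subr_gt0.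
have : `|g z| <= M' by apply: HM; [rewrite lt_max ltrDl ltr01 orbT|exists z].
rewrite ger0_norm ?invr_ge0 ?(ltW h0)// /g -[leRHS]invrK lef_pV2 ?posrE ?invr_gt0//.
lra.
Qed.

(** Common to both cases. The bound [C * M] on the integral of the majorant gives continuity: it is
    applied to [g \- f] with [M] equal to delta. *)
Lemma Imu_conclusions_of_dominant (nrm : (Cx R -> Cx R) -> \bar R) (C : R) : 0 <= C ->
  (forall f M, holo f -> (nrm f < M%:E)%E ->
    exists N : R -> R, [/\ mu.-integrable `[0, 1[ (EFin \o N),
    forall s t, 0 <= s -> s <= t -> t < 1 -> cmod (f (rC s)) <= N t &
    \int[mu]_(t in `[0, 1[) N t <= C * M]) ->
  Imu_conclusions mu [set f | holo f /\ (nrm f < +oo)%E] nrm.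
Proof.
move=> C0 H.
have bound (x : \bar R) : (x < +oo)%E -> exists M : R, (x < M%:E)%E.
  case: x => [r| |] // _; first by exists (r + 1); rewrite lte_fin ltrDl.
  by exists 0; exact: ltNyr.
have dom f : holo f -> (nrm f < +oo)%E -> exists N : R -> R, [/\ mu.-integrable `[0, 1[ (EFin \o N) &
    forall s t, 0 <= s -> s <= t -> t < 1 -> cmod (f (rC s)) <= N t].
  by move=> fh /bound[M fM]; have [N [Ni fN _]] := H f M fh fM; exists N.
split.
- move=> f [fh fX]; have [N [Ni fN]] := dom f fh fX; split; last exact: (Imu_holo fh fN Ni).
  move=> z zd; exact: (cintegrable_dominated (kernel_dominated fh fN Ni zd (lexx _))).
- move=> f [fh fX] K cK KD e e0.
  have [rho r1 Hrho] := compact_disc_bound cK KD.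
  have q0 : 0 < (1 - rho)^-1 by rewrite invr_gt0; lra.
  have c0 : 0 < 2 * (1 - rho)^-1 * C + 1 by rewrite ltr_wpDl// !mulr_ge0// ltW.
  exists (e / (2 * (1 - rho)^-1 * C + 1)); first exact: divr_gt0.
  move=> g [gh gX] gf z Kz.
  have gfh : holo (g \- f) by move=> w wd; apply: derivableB; [exact: gh|exact: fh].
  have [N [Ni gfN NC]] := H _ _ gfh gf.
  have [N1 [N1i fN1]] := dom f fh fX; have [N2 [N2i gN2]] := dom g gh gX.
  have zr := Hrho z Kz.
  rewrite /Imu -/(rint mu (fun w => g w / (1 - w * z))) -/(rint mu (fun w => f w / (1 - w * z))).
  rewrite -(rintB (kernel_dominated gh gN2 N2i r1 zr) (kernel_dominated fh fN1 N1i r1 zr)).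
  rewrite (@eq_rint _ _ _ (fun w => (g \- f) w / (1 - w * z))); last first.
    by move=> t _ _; rewrite -mulrBl.
  apply: le_trans (rint_bound (kernel_dominated gfh gfN Ni r1 zr)) _.
  rewrite RintegralZl// mulrA.
  apply: le_trans (_ : 2 * (1 - rho)^-1 * (C * (e / (2 * (1 - rho)^-1 * C + 1))) <= _).
    by rewrite ler_wpM2l// mulr_ge0// ltW.
  rewrite !mulrA ler_pdivrMr//; have := ltW e0.
  by rewrite mulrDr mulr1 [e * _]mulrC; lra.
- move=> f [fh fX] a af; have [N [Ni fN]] := dom f fh fX.
  exists (fun n => rint mu (fun w => w ^+ n * f w)); split.
    by move=> n; exact: (abel_summable_moments fh fN Ni af).
  by move=> z zd; exact: (moment_power_series fh fN Ni).
- move=> f [fh fX] a af sc z zd; have [N [Ni fN]] := dom f fh fX.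
  have E : (fun n => lim (series (fun k => rC (moment mu (n + k)) * a k) @ \oo) * z ^+ n) =
      (fun n => rint mu (fun w => w ^+ n * f w) * z ^+ n).
    apply/funext => n; congr (_ * _).
    have /cvg_ex[l sl] := sc n.
    rewrite (lim_seqE sl); exact: (moment_series_sum fh fN Ni af sl).
  by rewrite E; exact: (moment_power_series fh fN Ni).
Qed.

End Conclusions.

(** * A sparse sequence of monomials comparable to 1/v *)

Section MonomialMinorants.
Variable R : realType.

(** For [a <= b] the quotient [x^b / x^a] is nondecreasing, so a comparison at [r] propagates to the
    left; [monomial_cmp_ge] is its mirror image, to the right. *)
Lemma monomial_cmp_le (A B k : R) (a b : nat) (r x : R) : 0 <= A -> 0 < r -> 0 <= x -> x <= r ->
  (a <= b)%N -> 0 <= k * A -> B * r ^+ b <= k * A * r ^+ a -> B * x ^+ b <= k * A * x ^+ a.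
Proof.
move=> A0 r0 x0 xr ab kA H; pose z := x / r.
have z0 : 0 <= z by rewrite divr_ge0// ltW.
have z1 : z <= 1 by rewrite ler_pdivrMr// mul1r.
have xE : x = r * z by rewrite /z mulrCA divff ?mulr1// gt_eqF.
clearbody z; rewrite xE !exprMn !mulrA; apply: le_trans (_ : k * A * r ^+ a * z ^+ b <= _).
  by rewrite ler_wpM2r// exprn_ge0.
apply: ler_wpM2l; last exact: ler_wiXn2l.
by apply: mulr_ge0 => //; exact/exprn_ge0/ltW.
Qed.

Lemma monomial_cmp_ge (A B k : R) (a b : nat) (r x : R) : 0 < r -> r <= x ->
  (a <= b)%N -> 0 <= k * B -> A * r ^+ a <= k * B * r ^+ b -> A * x ^+ a <= k * B * x ^+ b.
Proof.
move=> r0 rx ab kB H; pose z := x / r.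
have z1 : 1 <= z by rewrite ler_pdivlMr// mul1r.
have z0 : 0 <= z by lra.
have xE : x = r * z by rewrite /z mulrCA divff ?mulr1// gt_eqF.
clearbody z; rewrite xE !exprMn !mulrA; apply: le_trans (_ : k * B * r ^+ b * z ^+ a <= _).
  by rewrite ler_wpM2r// exprn_ge0.
apply: ler_wpM2l; last exact: ler_weXn2l.
by apply: mulr_ge0 => //; exact/exprn_ge0/ltW.
Qed.

Variables (u : R -> R) (c : R).
Hypotheses (c0 : 0 < c)
  (u_gt0 : forall x, 0 <= x -> x < 1 -> 0 < u x)
  (u_mono : forall x y, 0 <= x -> x <= y -> y < 1 -> u x <= u y)
  (u_cont : forall x, 0 <= x -> x < 1 -> {for x, continuous u})
  (u_infty : forall K : R, exists2 y, y < 1 & forall x, y <= x -> x < 1 -> K < u x).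

Definition minorant (A : R) (k : nat) := 0 <= A /\ forall s, 0 <= s -> s < 1 -> A * s ^+ k <= u s.

Hypothesis u_minorant : forall r, 1 / 2 <= r -> r < 1 ->
  exists A k, minorant A k /\ c * u r <= A * r ^+ k.

(** With [c / 4] each of the two later monomials is at most a quarter of [A x^a] to the left of [r].
    With [e = c c' / 8] the earlier ones are each at most an eighth of [A' x^a'] to the right of
    [r'], and [e / c' = c / 8 < c] forces the exponents to grow. *)
Let c' := c / 4.
Let e := c * c' / 8.

Let c_le1 : c <= 1.
Proof.
have [A [k [[_ H] H2]]] := u_minorant (lexx (1 / 2)) ltac:(lra).
have h := H (1 / 2) ltac:(lra) ltac:(lra).
have := u_gt0 (ltac:(lra) : 0 <= 1 / 2) ltac:(lra).
by move=> u0; rewrite -(ler_pM2r u0) [leRHS]mul1r; exact: le_trans H2 h.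
Qed.

Let c'0 : 0 < c'. Proof. by rewrite divr_gt0. Qed.
Let e0 : 0 < e. Proof. by rewrite divr_gt0// mulr_gt0. Qed.

Let state : Type := (R * (R * nat) * (R * nat))%type.

(* A point [r], a monomial whose value at [r] is within [c] of [u r], and the
   steepest monomial whose value at [r] is within [c' < c].  All later monomials
   are steeper than the latter, hence below [c' u r] at [r]: they decay
   geometrically to the left of [r] compared with the first one. *)
Let good (s : state) := let: (r, (A, a), (B, b)) := s in
  [/\ 1 / 2 <= r < 1, minorant A a, minorant B b, c * u r <= A * r ^+ a &
      c' * u r <= B * r ^+ b /\
      forall D d, minorant D d -> c' * u r <= D * r ^+ d -> (d <= b)%N].

(** A steepest monomial exists: one of degree [k] with value at least [c' * u r] at [r] is at least
    [(s / r) ^+ k * (c' * u r)] at a fixed [s > r], which exceeds [u s] for large [k]. *)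
Lemma exists_good r : 1 / 2 <= r -> r < 1 -> exists q p, good (r, q, p).
Proof.
move=> r2 r1; have r0 : 0 < r by lra.
have [A [a [mA hA]]] := u_minorant r2 r1.
have ur := u_gt0 (ltW r0) r1.
pose P k := `[< exists B, minorant B k /\ c' * u r <= B * r ^+ k >].
have Pa : P a.
  apply/asboolP; exists A; split=> //; apply: le_trans hA; rewrite ler_wpM2r ?(ltW ur)//.
  by have := c0; rewrite /c'; lra.
pose s := (1 + r) / 2.
have rs : r < s by rewrite /s; lra.
have s1 : s < 1 by rewrite /s; lra.
have s0 : 0 < s by lra.
have cu0 : 0 < c' * u r by rewrite mulr_gt0.
have [M HM] : exists M, u s / (c' * u r) < (s / r) ^+ M.
  by apply: expr_unbounded; rewrite ltr_pdivlMr// mul1r.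
have Pb k : P k -> (k <= M)%N.
  move=> /asboolP[B [[B0 mB] hB]]; rewrite leqNgt; apply/negP => Mk.
  have := mB s (ltW s0) s1; apply/negP; rewrite -ltNge.
  move: HM; rewrite ltr_pdivrMr// => /lt_le_trans; apply.
  have sr : 1 <= s / r by rewrite ler_pdivlMr// mul1r ltW.
  apply: le_trans (_ : (s / r) ^+ k * (c' * u r) <= _).
    by rewrite ler_wpM2r ?(ltW cu0)// ler_weXn2l// ltnW.
  apply: le_trans (_ : (s / r) ^+ k * (B * r ^+ k) <= _).
    by rewrite ler_wpM2l// exprn_ge0//; lra.
  by rewrite mulrCA -exprMn divfK// gt_eqF.
have exP : exists k, P k by exists a.
have [b /asboolP[B [mB hB]] max] := ex_maxnP exP Pb.
exists (A, a), (B, b); split=> //; first by rewrite r2.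
by split=> // D d mD hD; apply: max; apply/asboolP; exists D.
Qed.

(* The next point is where the current steepest monomial has dropped to [e u]. *)
Let next (s s' : state) := let: (r, _, (B, b)) := s in let: (r', _, _) := s' in
  r < r' /\ B * r' ^+ b = e * u r'.

(** The function [h] is positive at [r] because [e < c'], and negative near 1 because [u] is
    unbounded there while [B x^b <= B]; the intermediate value theorem gives [r']. *)
Lemma exists_next s : exists s', good s -> good s' /\ next s s'.
Proof.
case: s => [[r [A a]] [B b]].
have [H|nH] := pselect (good (r, (A, a), (B, b))); last by exists (r, (A, a), (B, b)).
have [/andP[r2 r1] mA [B0 mB] hA [hB _]] := H.
have r0 : 0 <= r by lra.
have [y y1 Hy] := u_infty (B / e).
pose z := Num.max y ((1 + r) / 2).
have zr : r <= z by rewrite le_max; apply/orP; right; lra.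
have z1 : z < 1 by rewrite gt_max y1 /=; lra.
have yz : y <= z by rewrite le_max lexx.
have z0 : 0 <= z by lra.
pose h x := B * x ^+ b - e * u x.
have hr : 0 < h r.
  rewrite subr_gt0; apply: lt_le_trans hB; rewrite ltr_pM2r ?u_gt0//.
  rewrite /e mulrAC gtr_pMl// ltr_pdivrMr// mul1r; have := c_le1; lra.
have hz : h z < 0.
  rewrite subr_lt0; have := Hy z yz z1; rewrite ltr_pdivrMr// mulrC; apply: le_lt_trans.
  by rewrite ler_piMr// exprn_ile1// ltW.
have hc : {within `[r, z], continuous h}.
  apply: continuous_in_subspaceT => x; rewrite inE/= in_itv/= => /andP[rx xz].
  have cu := u_cont (le_trans r0 rx) (le_lt_trans xz z1).
  apply: (@cvgB _ _ _ (nbhs x)); apply: (@cvgM _ _ (nbhs x)) => //; try exact: cvg_cst.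
  exact: exprn_continuous.
have [|r' r'I hr'] := IVT zr hc (v := 0).
  by rewrite ge_min le_max (ltW hz) (ltW hr) orbT.
have /andP[rr' r'z] : r <= r' <= z by move: r'I; rewrite in_itv.
have {}rr' : r < r'.
  by rewrite lt_neqAle rr' andbT; apply/eqP => E; move: hr; rewrite E hr' ltxx.
have [q [p G]] := exists_good (ltac:(lra) : 1 / 2 <= r') (le_lt_trans r'z z1).
exists (r', q, p) => _; split=> //; split=> //.
by apply/eqP; rewrite -subr_eq0; apply/eqP.
Qed.

Section step.
Variables (r A B r' A' B' : R) (a b a' b' : nat).
Hypotheses (G : good (r, (A, a), (B, b))) (G' : good (r', (A', a'), (B', b')))
  (N : next (r, (A, a), (B, b)) (r', (A', a'), (B', b'))).

Let basics : [/\ 1 / 2 <= r, r < r', r' < 1, 0 < u r & 0 < u r'].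
Proof.
have [/andP[r2 r1] _ _ _ _] := G; have [/andP[r2' r1'] _ _ _ _] := G'; have [rr' _] := N.
by split=> //; apply: u_gt0 => //; lra.
Qed.

Lemma exponent_le : (a <= b)%N.
Proof.
have [_ mA _ hA [_ max]] := G; apply: max mA _; apply: le_trans hA.
have [_ _ _ ur _] := basics; rewrite ler_wpM2r ?(ltW ur)//.
by have := c0; rewrite /c'; lra.
Qed.

(** Otherwise [A' x^a' <= B x^b / c'], true at [r], would persist to the right; at [r'] it would
    read [c * u r' <= (c / 8) * u r']. *)
Lemma exponent_lt : (b < a')%N.
Proof.
have [r2 rr' r1' ur ur'] := basics; have [_ BE] := N.
have [_ _ [B0 mB] hA [hB _]] := G; have [_ [A'0 mA'] _ hA' _] := G'.
rewrite ltnNge; apply/negP => a'b.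
have r0 : 0 < r by lra.
have h1 : A' * r ^+ a' <= c'^-1 * B * r ^+ b.
  apply: le_trans (mA' r (ltW r0) (lt_trans rr' r1')) _.
  by rewrite -mulrA mulrC ler_pdivlMr// mulrC.
have kB : 0 <= c'^-1 * B by rewrite mulr_ge0// invr_ge0 ltW.
have := monomial_cmp_ge r0 (ltW rr') a'b kB h1.
rewrite -mulrA BE => h2.
have : c * u r' <= c'^-1 * (e * u r') by apply: le_trans h2.
have -> : c'^-1 * (e * u r') = c / 8 * u r' by rewrite /e; field; rewrite gt_eqF.
by rewrite ler_pM2r//; have := c0; lra.
Qed.

Let exponent_lt' : (b < b')%N.
Proof.
apply: leq_trans exponent_lt _; have [_ mA' _ hA' [_ max]] := G'; apply: max mA' _.
apply: le_trans hA'; have [_ _ _ _ ur'] := basics; rewrite ler_wpM2r ?(ltW ur')//.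
by have := c0; rewrite /c'; lra.
Qed.

Lemma step_exponent : (b < b')%N. Proof. exact: exponent_lt'. Qed.

(** To the left of [r] the pairs of monomials at least halve at each step, and [step_above] gives
    the same decay backwards in the index to the right of [r']; sums over all steps are thus
    geometric. *)
Lemma step_below x : 0 <= x -> x <= r ->
  A' * x ^+ a' + B' * x ^+ b' <= (A * x ^+ a + B * x ^+ b) / 2.
Proof.
move=> x0 xr; have [r2 rr' r1' ur ur'] := basics; have r0 : 0 < r by lra.
have [_ [A0 mA] [B0 mB] hA [hB max]] := G; have [_ mA' mB' _ _] := G'.
have K D d : minorant D d -> (b < d)%N -> D * x ^+ d <= 4^-1 * A * x ^+ a.
  move=> mD bd; apply: (@monomial_cmp_le A D 4^-1 a d r) => //.
  - exact: leq_trans exponent_le (ltnW bd).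
  - by rewrite mulr_ge0// invr_ge0.
  have : D * r ^+ d < c' * u r.
    by rewrite ltNge; apply/negP => /(max D d mD); rewrite leqNgt bd.
  have := hA; rewrite /c'; lra.
have h1 := K A' a' mA' exponent_lt; have h2 := K B' b' mB' exponent_lt'.
have : 0 <= B * x ^+ b by rewrite mulr_ge0// exprn_ge0.
lra.
Qed.

Lemma step_above x : r' <= x ->
  A * x ^+ a + B * x ^+ b <= (A' * x ^+ a' + B' * x ^+ b') / 2.
Proof.
move=> r'x; have [r2 rr' r1' ur ur'] := basics; have r0 : 0 < r by lra.
have [_ [A0 mA] [B0 mB] hA [hB max]] := G; have [_ [A'0 mA'] [B'0 mB'] hA' _] := G'.
have [_ BE] := N; have x0 : 0 <= x by lra.
have h1 : B * x ^+ b <= (c' / 8) * A' * x ^+ a'.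
  apply: (@monomial_cmp_ge B A' (c' / 8) b a' r') => //.
  - by lra.
  - exact: ltnW exponent_lt.
  - by rewrite mulr_ge0// divr_ge0// ltW.
  rewrite BE -mulrA /e.
  have := ler_wpM2l (ltW c'0) hA'; lra.
have h2 : A * x ^+ a <= c'^-1 * B * x ^+ b.
  apply: (@monomial_cmp_ge A B c'^-1 a b r) => //.
  - by lra.
  - exact: exponent_le.
  - by rewrite mulr_ge0// invr_ge0 ltW.
  apply: le_trans (mA r (ltW r0) (lt_trans rr' r1')) _.
  by rewrite -mulrA mulrC ler_pdivlMr// mulrC.
have h3 : c'^-1 * B * x ^+ b <= A' * x ^+ a' / 8.
  rewrite -mulrA mulrC ler_pdivrMr//.
  by apply: le_trans h1 _; rewrite le_eqVlt; apply/orP; left; apply/eqP; ring.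
have p1 : 0 <= A' * x ^+ a' by rewrite mulr_ge0// exprn_ge0.
have p2 : 0 <= B' * x ^+ b' by rewrite mulr_ge0// exprn_ge0.
have h4 : c' / 8 * A' * x ^+ a' <= A' * x ^+ a' / 8.
  have := c_le1; have := ler_wpM2r p1 (ltac:(rewrite /c'; have := c_le1; lra) : c' <= 1); lra.
lra.
Qed.

(** Compare [B x^b] with a monomial [D x^d] that nearly attains [u] at [x]: from [r] rightwards if
    [d <= b], from [r'] leftwards otherwise. At either end [D] is below [u], hence below
    [B x^b / e]. *)
Lemma step_cover x : r <= x -> x <= r' -> c * e * u x <= B * x ^+ b.
Proof.
move=> rx xr'; have [r2 rr' r1' ur ur'] := basics; have r0 : 0 < r by lra.
have [_ [A0 mA] [B0 mB] hA [hB max]] := G; have [_ BE] := N.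
have x0 : 0 < x by lra.
have [D [d [[D0 mD] hD]]] := u_minorant (ltac:(lra) : 1 / 2 <= x) (le_lt_trans xr' r1').
have ke : 0 <= e^-1 * B by rewrite mulr_ge0// invr_ge0 ltW.
have ec' : e <= c' by rewrite /e; have := ler_wpM2r (ltW c'0) c_le1; have := c'0; lra.
suff h : D * x ^+ d <= e^-1 * B * x ^+ b.
  have : c * u x <= e^-1 * (B * x ^+ b) by apply: le_trans hD _; rewrite mulrA.
  by rewrite [X in _ <= X -> _]mulrC ler_pdivlMr// => h'; apply: le_trans h'; rewrite mulrAC.
have [db|bd] := leqP d b.
  apply: (@monomial_cmp_ge D B e^-1 d b r) => //.
  apply: le_trans (mD r (ltW r0) (lt_trans rr' r1')) _.
  rewrite -mulrA mulrC ler_pdivlMr// mulrC; apply: le_trans hB.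
  by rewrite ler_wpM2r// ltW.
apply: (@monomial_cmp_le B D e^-1 b d r') => //.
- by lra.
- by lra.
- exact: ltnW.
apply: le_trans (mD r' _ r1') _; first by lra.
by rewrite -mulrA BE mulrA mulVf ?mul1r// gt_eqF.
Qed.

End step.

(** The sum retains the steepest monomials [B n], which cover the intervals; the [A n] serve to
    control the decay. If [r j] is the first point beyond [x], the terms before [j] and those from
    [j] on each add up to at most [4 * u x]. *)
Lemma monomial_sequence : exists (B : nat -> R) (b : nat -> nat) (K : R),
  [/\ 0 < K, forall n, 0 <= B n,
    forall x n, 0 <= x -> x < 1 -> \sum_(i < n) B i * x ^+ b i <= 8 * u x &
    forall x, 1 / 2 <= x -> x < 1 -> exists n, u x <= K * (B n * x ^+ b n)].
Proof.
have [q0 [p0 G0]] := exists_good (lexx (1 / 2)) ltac:(lra).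
have [stp stpP] := choice exists_next.
pose S := fix S n : state := if n is m.+1 then stp (S m) else (1 / 2, q0, p0).
have GS n : good (S n) by elim: n => [//|n IH]; have [] := stpP _ IH.
have NS n : next (S n) (S n.+1) by have [] := stpP _ (GS n).
pose r n := (S n).1.1; pose A n := (S n).1.2.1; pose a n := (S n).1.2.2.
pose B n := (S n).2.1; pose b n := (S n).2.2.
have SE n : S n = (r n, (A n, a n), (B n, b n)).
  by rewrite /r /A /a /B /b; case: (S n) => [[? [? ?]] [? ?]].
have G n : good (r n, (A n, a n), (B n, b n)) by rewrite -SE.
have N n : next (r n, (A n, a n), (B n, b n)) (r n.+1, (A n.+1, a n.+1), (B n.+1, b n.+1)).
  by rewrite -!SE.
pose t x n := A n * x ^+ a n + B n * x ^+ b n.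
have r2 n : 1 / 2 <= r n < 1 by have [] := G n.
have rS n : r n <= r n.+1 by have [/ltW] := N n.
have rm m n : (m <= n)%N -> r m <= r n.
  move: m n; apply: (homo_leq (r := fun x y => x <= y)) => //.
  by move=> y x z; exact: le_trans.
have bn n : (n <= b n)%N.
  by elim: n => // n IH; apply: leq_ltn_trans IH (step_exponent (G n) (G n.+1) (N n)).
have mA n : minorant (A n) (a n) by have [] := G n.
have mB n : minorant (B n) (b n) by have [] := G n.
have B0 n : 0 <= B n by have [] := mB n.
have A0 n : 0 <= A n by have [] := mA n.
have t2 x n : 0 <= x -> x < 1 -> t x n <= 2 * u x.
  by move=> x0 x1; have [_ /(_ x x0 x1)] := mA n; have [_ /(_ x x0 x1)] := mB n; rewrite /t; lra.
have t0 x n : 0 <= x -> 0 <= t x n by move=> x0; rewrite addr_ge0// mulr_ge0// exprn_ge0.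
(* If all [r n] stayed below [x < 1], the [B n], of exponent at least [n] and value at least
   [c' * u 0] at [r n], would exceed [u] at a point [y] beyond [x]. *)
have rlim x : x < 1 -> exists n, x < r n.
  move=> x1; apply: contrapT => /forallNP H.
  have {}H n : r n <= x by rewrite leNgt; apply/negP/H.
  have x0 : 0 < x by have := H 0%N; have := r2 0%N; lra.
  pose y := (1 + x) / 2; have y1 : y < 1 by rewrite /y; lra.
  have xy : x < y by rewrite /y; lra. have y0 : 0 < y by lra.
  have u0 := u_gt0 (lexx 0) ltr01.
  have cu0 : 0 < c' * u 0 by rewrite mulr_gt0.
  have yx : 1 <= y / x by rewrite ler_pdivlMr// mul1r ltW.
  have [n Hn] : exists n, u y / (c' * u 0) < (y / x) ^+ n.
    by apply: expr_unbounded; rewrite ltr_pdivlMr// mul1r.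
  have [_ /(_ y (ltW y0) y1)] := mB n; apply/negP; rewrite -ltNge.
  move: Hn; rewrite ltr_pdivrMr// => /lt_le_trans; apply.
  have rn0 : 0 < r n by have := r2 n; lra.
  have rn1 : r n < 1 by have := r2 n; lra.
  have -> : B n * y ^+ b n = (y / r n) ^+ b n * (B n * r n ^+ b n).
    by rewrite mulrCA -exprMn divfK// gt_eqF.
  apply: ler_pM; rewrite ?exprn_ge0 ?(ltW cu0)//; first by lra.
    apply: le_trans (_ : (y / x) ^+ b n <= _); first by rewrite ler_weXn2l.
    have h2 : y / x <= y / r n by apply: ler_wpM2l; rewrite ?(ltW y0)// lef_pV2.
    by apply: lerXn2r => //; rewrite nnegrE; lra.
  have [_ _ _ _ [hB _]] := G n; apply: le_trans hB; rewrite ler_wpM2l ?(ltW c'0)//.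
  by apply: u_mono => //; exact: ltW.
exists B, b, ((c * e)^-1); split=> //.
- by rewrite invr_gt0 mulr_gt0.
- move=> x n x0 x1.
  have [j xj minj] := ex_minnP (rlim x x1).
  have S1 : \sum_(i < j) t x i <= 4 * u x.
    case: j xj minj => [|j] xj minj; first by rewrite big_ord0 mulr_ge0// ltW// u_gt0.
    have rx i : (i <= j)%N -> r i <= x.
      move=> ij; rewrite leNgt; apply/negP => /minj; rewrite ltnNge ij //.
    suff H i : (i <= j)%N -> \sum_(k < i.+1) t x k <= 2 * t x i.
      by apply: le_trans (H j (leqnn j)) _; have := t2 x j x0 x1; lra.
    elim: i => [_|i IH ij]; first by rewrite big_ord_recr big_ord0 /=; have := t0 x 0%N x0; lra.
    rewrite big_ord_recr /=; have := IH (ltnW ij).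
    have := step_above (G i) (G i.+1) (N i) (rx _ ij); rewrite -!/(t x _); lra.
  have S2 k : \sum_(i < k) t x (j + i)%N <= 2 * t x j - 2 * t x (j + k)%N.
    elim: k => [|k IH]; first by rewrite big_ord0 addn0 subrr.
    rewrite big_ord_recr /= addnS.
    have := step_below (G (j + k)%N) (G (j + k).+1) (N (j + k)%N) x0
      (ltW (lt_le_trans xj (rm _ _ (leq_addr k j)))).
    rewrite -!/(t x _); lra.
  apply: le_trans (_ : \sum_(i < n) t x i <= _).
    by apply: ler_sum => i _; rewrite /t lerDr mulr_ge0// exprn_ge0.
  apply: le_trans (_ : \sum_(i < j + n) t x i <= _).
    rewrite -!(big_mkord xpredT (t x)) (@big_cat_nat _ _ _ n 0 (j + n)) ?leq_addl//= lerDl.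
    by rewrite sumr_ge0// => i _; exact: t0.
  rewrite big_split_ord /=; have := S2 n; have := t2 x j x0 x1; have := t0 x (j + n)%N x0; move: S1; lra.
move=> x x2 x1; have [j xj minj] := ex_minnP (rlim x x1).
case: j xj minj => [|j] xj minj.
  by move: xj; have -> : r 0%N = 1 / 2 by []; lra.
have rx : r j <= x by rewrite leNgt; apply/negP => /minj; rewrite ltnn.
exists j; rewrite mulrC ler_pdivlMr ?mulr_gt0// mulrC.
exact: (step_cover (G j) (G j.+1) (N j) rx (ltW xj)).
Qed.

End MonomialMinorants.

(** * Weighted spaces and the theorem *)

Section MonomialSeries.
Variable R : realType.
Implicit Types (s : nat -> Cx R) (z w : Cx R).

Lemma cmod_lim_le s l (B : R) : s @ \oo --> l -> (forall n, cmod (s n) <= B) -> cmod l <= B.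
Proof.
move=> /cvg_seq_cxP sl sB; apply/ler_addgt0Pr => e e0.
have [n Hn] := sl e e0; have := Hn n (leqnn n); have := sB n.
by have := cmod_ger_dist l (s n); rewrite cmod_distC; lra.
Qed.

Lemma series_cx_cvg s (m : nat -> R) (U : R) : (forall i, cmod (s i) <= m i) ->
  (forall n, \sum_(i < n) m i <= U) -> cvg (series s @ \oo).
Proof.
move=> sm mU; have m0 i : 0 <= m i by apply: le_trans (sm i); exact: cmod_ge0.
have cm : cvgn (series m).
  apply: nondecreasing_is_cvgn.
    apply/nondecreasing_seqP => n.
    by rewrite /series/= big_nat_recr//= lerDl.
  by exists U => _ [n _ <-]; rewrite /series/= big_mkord.
have part (g : Cx R -> R) : (forall z, `|g z| <= cmod z) -> cvgn (series (fun i => g (s i))).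
  move=> gz; apply: normed_cvg; apply: series_le_cvg cm => // i; first by rewrite /= normr_ge0.
  by rewrite /=; apply: le_trans (gz _) (sm i).
have /cvg_ex[lr hr] := part _ (@Re_le_cmod R); have /cvg_ex[li hi] := part _ (@Im_le_cmod R).
have ReS n : complex.Re (series s n) = series (fun i => complex.Re (s i)) n.
  by elim: n => [|n IH]; rewrite /series/= ?big_nil// !big_nat_recr//= ReD; congr (_ + _).
have ImS n : complex.Im (series s n) = series (fun i => complex.Im (s i)) n.
  by elim: n => [|n IH]; rewrite /series/= ?big_nil// !big_nat_recr//= ImD; congr (_ + _).
apply/cvg_ex; exists (lr +i* li)%C; apply: cvg_ReIm.
  by under eq_fun do rewrite ReS.
by under eq_fun do rewrite ImS.
Qed.

Section power_estimates.
Variables (r r' : R).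
Hypotheses (r0 : 0 <= r) (rr' : r < r').

Lemma exprn_slope n : n%:R * r ^+ n.-1 <= r' ^+ n / (r' - r).
Proof.
have [R0 RR] := (r0, rr').
have d0 : 0 < r' - r by lra.
have r'0 : 0 <= r' by lra.
rewrite ler_pdivlMr//; elim: n => [|n IH]; first by rewrite !mul0r expr0 ler01.
rewrite -natr1 /=; case: n IH => [|n] IH; first by rewrite add0r mul1r expr0 expr1 mul1r; lra.
have h1 : r ^+ n.+1 <= r' ^+ n.+1 by rewrite lerXn2r ?nnegrE// ltW.
have E : (n.+1%:R + 1) * r ^+ n.+1 * (r' - r) =
  r * (n.+1%:R * r ^+ n * (r' - r)) + (r' - r) * r ^+ n.+1 by rewrite exprS; ring.
rewrite E; have := ler_wpM2l r0 IH; have := ler_wpM2l (ltW d0) h1.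
by rewrite [r' ^+ n.+2]exprS; lra.
Qed.

(** Passing from [r] to [r'] absorbs the polynomial factors in [n], so the remainders of the
    monomials can be summed against the same coefficients. *)
Lemma exprn_taylor2 n z w : cmod z <= r -> cmod w <= r ->
  cmod (z ^+ n - w ^+ n - n%:R * w ^+ n.-1 * (z - w)) <= cmod (z - w) ^+ 2 * (r' ^+ n / (r' - r) ^+ 2).
Proof.
move=> zr wr; have [R0 RR] := (r0, rr').
have d0 : 0 < r' - r by lra.
have r'0 : 0 <= r' by lra.
elim: n => [|n IH].
  by rewrite !expr0 subrr mul0r mul0r subr0 cmod0 mulr_ge0 ?exprn_ge0 ?cmod_ge0// divr_ge0// exprn_ge0// ltW.
have -> : z ^+ n.+1 - w ^+ n.+1 - n.+1%:R * w ^+ n.+1.-1 * (z - w) =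
   z * (z ^+ n - w ^+ n - n%:R * w ^+ n.-1 * (z - w)) + n%:R * w ^+ n.-1 * (z - w) ^+ 2.
  by case: n {IH} => [|n] /=; rewrite -?natr1 ?exprS ?expr0; ring.
apply: le_trans (cmodD _ _) _; rewrite (cmodM z) (cmodM (_ * _)) (cmodM n%:R) !cmodX.
have nn : cmod (n%:R : Cx R) = n%:R.
  have -> : (n%:R : Cx R) = rC n%:R by rewrite /rC rmorph_nat.
  by rewrite cmod_rC ger0_norm.
rewrite nn.
have h1 : cmod z * cmod (z ^+ n - w ^+ n - n%:R * w ^+ n.-1 * (z - w)) <=
    r * (cmod (z - w) ^+ 2 * (r' ^+ n / (r' - r) ^+ 2)).
  by apply: ler_pM; rewrite ?cmod_ge0.
have h2 : n%:R * cmod w ^+ n.-1 <= r' ^+ n / (r' - r).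
  apply: le_trans (exprn_slope n); rewrite ler_wpM2l// lerXn2r ?nnegrE ?cmod_ge0//.
have h3 := ler_wpM2r (exprn_ge0 2 (cmod_ge0 (z - w))) h2.
apply: le_trans (lerD h1 h3) _; rewrite [r' ^+ n.+1]exprS le_eqVlt; apply/orP; left; apply/eqP.
by field; rewrite gt_eqF.
Qed.

End power_estimates.

Variables (A : nat -> R) (b : nat -> nat).
Hypothesis A0 : forall n, 0 <= A n.

Definition monomial_series z : Cx R := lim (series (fun i => rC (A i) * z ^+ b i) @ \oo).

Hypothesis A_bounded : forall x : R, 0 <= x -> x < 1 ->
  exists U, forall n, \sum_(i < n) A i * x ^+ b i <= U.

Lemma monomial_series_cvg z : disc z ->
  series (fun i => rC (A i) * z ^+ b i) @ \oo --> monomial_series z.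
Proof.
move=> zd; have [U HU] := A_bounded (cmod_ge0 z) zd.
apply: (@series_cx_cvg _ (fun i => A i * cmod z ^+ b i) U) => // i.
by rewrite cmodM cmodX cmod_rC ger0_norm.
Qed.

Lemma monomial_series_bound z (U : R) : disc z ->
  (forall n, \sum_(i < n) A i * cmod z ^+ b i <= U) -> cmod (monomial_series z) <= U.
Proof.
move=> zd HU; apply: (cmod_lim_le (monomial_series_cvg zd)) => n.
apply: le_trans (HU n); rewrite /series/= big_mkord.
elim: n => [|n IH]; first by rewrite !big_ord0 cmod0.
rewrite !big_ord_recr /=; apply: le_trans (cmodD _ _) _; apply: lerD => //.
by rewrite cmodM cmodX cmod_rC ger0_norm.
Qed.

Lemma monomial_series_ge (x : R) n : 0 <= x -> x < 1 ->
  A n * x ^+ b n <= complex.Re (monomial_series (rC x)).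
Proof.
move=> x0 x1; have xd : disc (rC x) by rewrite /disc/= cmod_rC ger0_norm.
apply/ler_addgt0Pr => e e0.
have /cvg_seq_cxP /(_ e e0) [n0 Hn0] := monomial_series_cvg xd.
have := Hn0 (n0 + n.+1)%N (leq_addr _ _) => /(le_lt_trans (Re_le_cmod _)).
rewrite ReB ltr_norml => /andP[_].
have -> : complex.Re (series (fun i => rC (A i) * rC x ^+ b i) (n0 + n.+1)%N) =
    \sum_(i < n0 + n.+1) A i * x ^+ b i.
  rewrite /series/= big_mkord; elim: (n0 + n.+1)%N => [|k IH]; first by rewrite !big_ord0.
  by rewrite !big_ord_recr /= ReD IH -rCX -rCM.
have nk : (n < n0 + n.+1)%N by rewrite addnS ltnS leq_addl.
rewrite (bigD1 (Ordinal nk))//=.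
have : 0 <= \sum_(i < n0 + n.+1 | i != Ordinal nk) A i * x ^+ b i.
  by rewrite sumr_ge0// => i _; rewrite mulr_ge0// exprn_ge0.
lra.
Qed.

(** The second-order remainder of each partial sum is at most [Q * |z - w|^2] with [Q] independent
    of [n]; this passes to the limit. The radii [r] and [r'] cut the interval from [|w|] to 1 into
    thirds. *)
Lemma monomial_series_holo : holo monomial_series.
Proof.
move=> w wd; apply/derivable_cderiv; have w1 : cmod w < 1 by [].
pose r := (1 + 2 * cmod w) / 3; pose r' := (2 + cmod w) / 3.
have cw0 := cmod_ge0 w.
have r0 : 0 <= r by rewrite /r; lra.
have wr : cmod w < r by rewrite /r; lra.
have rr' : r < r' by rewrite /r /r'; lra.
have r'1 : r' < 1 by rewrite /r'; lra.
have d0 : 0 < r' - r by lra.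
have r'0 : 0 <= r' by lra.
have [U HU] := A_bounded r'0 r'1.
pose D i := rC (A i) * ((b i)%:R * w ^+ (b i).-1).
have nn n : cmod (n%:R : Cx R) = n%:R.
  have -> : (n%:R : Cx R) = rC n%:R by rewrite /rC rmorph_nat.
  by rewrite cmod_rC ger0_norm.
have Dc : cvg (series D @ \oo).
  apply: (@series_cx_cvg _ (fun i => (r' - r)^-1 * (A i * r' ^+ b i)) ((r' - r)^-1 * U)).
    move=> i; rewrite /D !cmodM cmodX cmod_rC ger0_norm// nn [leRHS]mulrCA; apply: ler_wpM2l => //; rewrite [leRHS]mulrC.
    apply: le_trans (exprn_slope r0 rr' (b i)); rewrite ler_wpM2l// lerXn2r ?nnegrE//.
    exact: ltW.
  by move=> n; rewrite -mulr_sumr ler_wpM2l// invr_ge0 ltW.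
have /cvg_ex[d hd] := Dc.
pose Q := U / (r' - r) ^+ 2.
have Q0 : 0 <= Q.
  by have := HU 0%N; rewrite big_ord0 => U0; rewrite divr_ge0// exprn_ge0// ltW.
exists d => e e0.
exists (Num.min (r - cmod w) (e / (Q + 1))).
  by rewrite lt_min subr_gt0 wr divr_gt0// ltr_wpDl.
move=> z; rewrite lt_min => /andP[z1 z2].
have zr : cmod z <= r by have := cmod_ger_dist z w; lra.
have zd : disc z by rewrite /disc/=; lra.
have S n : cmod (series (fun i => rC (A i) * z ^+ b i) n - series (fun i => rC (A i) * w ^+ b i) n
     - series D n * (z - w)) <= Q * cmod (z - w) ^+ 2.
  have -> : series (fun i => rC (A i) * z ^+ b i) n - series (fun i => rC (A i) * w ^+ b i) n
     - series D n * (z - w) =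
     \sum_(i < n) rC (A i) * (z ^+ b i - w ^+ b i - (b i)%:R * w ^+ (b i).-1 * (z - w)).
    rewrite /series/= !big_mkord mulr_suml -!sumrB; apply: eq_bigr => i _.
    by rewrite /D; ring.
  apply: le_trans (_ : \sum_(i < n) A i * (cmod (z - w) ^+ 2 * (r' ^+ b i / (r' - r) ^+ 2)) <= _).
    elim: n => [|n IH]; first by rewrite !big_ord0 cmod0.
    rewrite !big_ord_recr /=; apply: le_trans (cmodD _ _) _; apply: lerD => //.
    rewrite cmodM cmod_rC ger0_norm// ler_wpM2l//.
    by apply: (exprn_taylor2 r0 rr') => //; exact: ltW.
  have -> : \sum_(i < n) A i * (cmod (z - w) ^+ 2 * (r' ^+ b i / (r' - r) ^+ 2)) =
      cmod (z - w) ^+ 2 / (r' - r) ^+ 2 * \sum_(i < n) A i * r' ^+ b i.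
    by rewrite mulr_sumr; apply: eq_bigr => i _; ring.
  have -> : Q * cmod (z - w) ^+ 2 = cmod (z - w) ^+ 2 / (r' - r) ^+ 2 * U by rewrite /Q; ring.
  by rewrite ler_wpM2l// divr_ge0 ?exprn_ge0 ?cmod_ge0// ltW.
have lim : (fun n => series (fun i => rC (A i) * z ^+ b i) n - series (fun i => rC (A i) * w ^+ b i) n
     - series D n * (z - w)) @ \oo --> monomial_series z - monomial_series w - d * (z - w).
  apply: cvgB; first by apply: cvgB; exact: monomial_series_cvg.
  exact (@cvgM R[i] _ \oo _ _ _ _ _ hd (cvg_cst (z - w))).
apply: le_trans (cmod_lim_le lim S) _.
rewrite expr2 mulrA ler_wpM2r ?cmod_ge0//.
move: z2; rewrite ltr_pdivlMr; last by rewrite ltr_wpDl.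
by have := cmod_ge0 (z - w); lra.
Qed.

End MonomialSeries.

(** * Sufficiency and necessity for weighted spaces *)

Section WeightedSpaces.
Variables (R : realType) (mu : {measure set R -> \bar R}) (v : Cx R -> R).
Hypotheses (mufin : (mu setT < +oo)%E) (wv : weight v).

Let v_gt0 z : disc z -> 0 < v z. Proof. by have [h _ _ _ _] := wv; exact: h. Qed.
Let v_radial z w : disc z -> disc w -> cmod z = cmod w -> v z = v w.
Proof. by have [_ h _ _ _] := wv; exact: h. Qed.
Let v_cont z : disc z -> {for z, continuous v}.
Proof. by have [_ _ h _ _] := wv; exact: h. Qed.
Let v_anti z w : disc z -> disc w -> cmod z <= cmod w -> v w <= v z.
Proof. by have [_ _ _ h _] := wv; exact: h. Qed.

Let u (t : R) : R := (v (rC t))^-1.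

Let disc_rC (t : R) : 0 <= t -> t < 1 -> disc (rC t).
Proof. by move=> t0 t1; rewrite /disc/= cmod_rC ger0_norm. Qed.

Let u_gt0 x : 0 <= x -> x < 1 -> 0 < u x.
Proof. by move=> x0 x1; rewrite invr_gt0 v_gt0//; exact: disc_rC. Qed.

Let u_mono x y : 0 <= x -> x <= y -> y < 1 -> u x <= u y.
Proof.
move=> x0 xy y1; have y0 : 0 <= y by exact: le_trans xy.
have x1 : x < 1 by exact: le_lt_trans xy y1.
have dx := disc_rC x0 x1; have dy := disc_rC y0 y1.
by rewrite /u lef_pV2 ?posrE ?v_gt0//; apply: v_anti; rewrite // !cmod_rC !ger0_norm.
Qed.

Let vinv_cont z : disc z -> {for z, continuous (fun w => (v w)^-1)}.
Proof.
move=> zd; have n0 : v z != 0 by rewrite gt_eqF// v_gt0.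
exact (cvgV n0 (v_cont zd)).
Qed.

Let u_cont x : 0 <= x -> x < 1 -> {for x, continuous u}.
Proof.
move=> x0 x1; apply: (@continuous_comp _ _ _ (@rC R) (fun w => (v w)^-1)).
  exact: continuous_rC.
by apply: vinv_cont; exact: disc_rC.
Qed.

Let u_infty (K : R) : exists2 y, y < 1 & forall x, y <= x -> x < 1 -> K < u x.
Proof.
have [_ _ _ _ vlim] := wv.
have K0 : 0 < (`|K| + 1)^-1 by rewrite invr_gt0 ltr_wpDl.
move/cvgrPdist_lt : vlim => /(_ _ K0); rewrite near_withinE => /nbhs_ballP[d /= d0 Hd].
pose y := Num.max (1 / 2) (1 - d / 2).
exists y; first by rewrite gt_max; apply/andP; split; lra.
move=> x; rewrite ge_max => /andP[x2 xd] x1.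
have := Hd x; rewrite /ball/= => /(_ _ x1).
rewrite ger0_norm; last by lra.
move=> /(_ ltac:(lra)); rewrite sub0r normrN gtr0_norm; last by apply/v_gt0/disc_rC => //; lra.
move=> vx; have vx0 : 0 < v (rC x) by apply/v_gt0/disc_rC => //; lra.
have : `|K| + 1 < u x by rewrite -[ltLHS]invrK /u ltf_pV2 ?posrE// invr_gt0 ltr_wpDl.
by have := ler_norm K; lra.
Qed.

Lemma Hinfv_bound f (M : R) : (Hinfv_norm v f <= M%:E)%E -> forall z, disc z -> cmod (f z) <= M * u (cmod z).
Proof.
move=> fM z zd; have vz : v z = v (rC (cmod z)).
  apply: v_radial => //; first by apply: disc_rC => //; exact: cmod_ge0.
  by rewrite cmod_rC ger0_norm// cmod_ge0.
rewrite /u -vz ler_pdivlMr ?v_gt0// mulrC -lee_fin; apply: le_trans fM.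
by apply: ereal_sup_ubound; exists z.
Qed.

Lemma Hinfv_conclusions : mu.-integrable `[0, 1[ (fun t => ((v (rC t))^-1)%:E) ->
  Imu_conclusions mu (Hinfv v) (Hinfv_norm v).
Proof.
move=> ui; apply: (@Imu_conclusions_of_dominant _ _ mufin _ (\int[mu]_(t in `[0, 1[) u t)).
  by apply: Rintegral_ge0 => t; rewrite /= in_itv/= => /andP[t0 t1]; exact/ltW/u_gt0.
move=> f M fh /ltW fM; exists (fun t => M * u t).
have M0 : 0 <= M.
  have d0 : disc (0 : Cx R) by rewrite /disc/= cmod0.
  have := le_trans (cmod_ge0 _) (Hinfv_bound fM d0).
  by rewrite pmulr_lge0//; apply: u_gt0; rewrite ?cmod0.
split.
- by apply: (integrableZl _ _ ui).
- move=> s t s0 st t1; have s1 := le_lt_trans st t1.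
  apply: le_trans (Hinfv_bound fM (disc_rC s0 s1)) _.
  by rewrite cmod_rC ger0_norm// ler_wpM2l// u_mono.
- by rewrite RintegralZl// mulrC.
Qed.

(** The constant [c / 4] collects two losses: a factor 1/2 because the supremum in [essential] need
    not be attained, and the factor [r >= 1 / 2] from [power_minorant]. *)
Lemma essential_minorant : essential v -> exists2 c : R, 0 < c &
  forall r, 1 / 2 <= r -> r < 1 -> exists A k, minorant u A k /\ c * u r <= A * r ^+ k.
Proof.
move=> [c c0 ess]; exists (c / 4); first exact: divr_gt0.
move=> r r2 r1; have r0 : 0 < r by lra.
have rd := disc_rC (ltW r0) r1; have ur := u_gt0 (ltW r0) r1.
have /andP[h _] := ess _ rd.
have : ((c / 2 * u r)%:E < (c / v (rC r))%:E)%E by rewrite lte_fin -/(u r) ltr_pM2r//; lra.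
move=> /lt_le_trans/(_ h)/ereal_sup_gt[_ [f [[fh _] f1] <-]]; rewrite lte_fin => fr.
have fd z : disc z -> cdiff f z by move=> /fh /derivable_cderiv.
have fu z : disc z -> cmod (f z) <= u (cmod z).
  by move=> /(Hinfv_bound f1); rewrite mul1r.
have m0 : 0 < cmod (f (rC r)) by apply: lt_trans fr; rewrite mulr_gt0// divr_gt0.
have [|A [k [A0 mA hA]]] := @power_minorant R f u r fd fu _ u_mono m0; first by rewrite r0.
exists A, k; split=> //; apply: le_trans hA.
have := ler_wpM2r (cmod_ge0 (f (rC r))) r2; lra.
Qed.

(** The test function [g] is used at [z = 0], where the kernel of [Imu] is [g] itself. Then [1 / v]
    is at most [K * Re g] on [1/2, 1) and at most its value at 1/2 on [0, 1/2). *)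
Lemma essential_integrable : essential v -> Imu_well_defined mu (Hinfv v) ->
  mu.-integrable `[0, 1[ (fun t => ((v (rC t))^-1)%:E).
Proof.
move=> /essential_minorant[c c0 um] wd.
have [A [b [K [K0 A0 gu ug]]]] := monomial_sequence c0 u_gt0 u_mono u_cont u_infty um.
pose g := monomial_series A b.
have gb x : 0 <= x -> x < 1 -> exists U, forall n, \sum_(i < n) A i * x ^+ b i <= U.
  by move=> x0 x1; exists (8 * u x) => n; exact: gu.
have gX : Hinfv v g.
  split; first exact: monomial_series_holo.
  apply: le_lt_trans (ltry 8); apply: ge_ereal_sup => _ [z zd <-].
  rewrite lee_fin mulrC -ler_pdivlMr ?v_gt0//.
  have -> : v z = v (rC (cmod z)).
    apply: v_radial => //; first by apply: disc_rC => //; exact: cmod_ge0.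
    by rewrite cmod_rC ger0_norm// cmod_ge0.
  by apply: monomial_series_bound => // n; apply: gu => //; exact: cmod_ge0.
have [/(_ 0)gi _] := wd g gX.
have d0 : disc (0 : Cx R) by rewrite /disc/= cmod0.
have [{}gi _] := gi d0.
have gE t : Imu_kernel g 0 t = g (rC t) by rewrite /Imu_kernel mulr0 subr0 divr1.
have {}gi : mu.-integrable `[0, 1[ (EFin \o (fun t => complex.Re (g (rC t)))).
  by move: gi; congr (mu.-integrable _ _); apply/funext => t; rewrite gE.
have Ki : mu.-integrable `[0, 1[ (EFin \o (fun t => K * complex.Re (g (rC t)))).
  by apply: (integrableZl _ K gi).
have Gi : mu.-integrable `[0, 1[ (EFin \o (fun t => K * complex.Re (g (rC t)) + u (1 / 2))).
  by apply: (integrableD _ Ki (integrable_cst_itv mufin (u (1 / 2)))).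
apply: (le_integrable _ _ _ Gi) => //.
  apply/measurable_EFinP; apply: (@measurable_radial _ (fun z => (v z)^-1)) => t t0 t1.
  exact/vinv_cont/disc_rC.
move=> t; rewrite /= in_itv/= => /andP[t0 t1]; rewrite lee_fin.
have ut := u_gt0 t0 t1; rewrite -/(u t) gtr0_norm//; apply: le_trans (ler_norm _).
have u2 : 0 < u (1 / 2) by apply: u_gt0; lra.
have g0 n := monomial_series_ge A0 gb n t0 t1.
have [t2|t2] := leP (1 / 2) t.
  have [n hn] := ug t t2 t1.
  by have := ler_wpM2l (ltW K0) (g0 n); rewrite -/g; lra.
have := u_mono t0 (ltW t2) ltac:(lra).
have : 0 <= K * complex.Re (g (rC t)).
  by apply: mulr_ge0; [exact: ltW|apply: le_trans (g0 0%N); rewrite mulr_ge0// exprn_ge0].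
lra.
Qed.

End WeightedSpaces.

Theorem theorem6 (R : realType) (mu : {measure set R -> \bar R}) :
  mu (~` `[0, 1[) = 0%E -> (mu setT < +oo)%E ->
  (forall v : Cx R -> R, weight v ->
     (mu.-integrable `[0, 1[ (fun t => ((v (rC t))^-1)%:E) ->
        Imu_conclusions mu (Hinfv v) (Hinfv_norm v)) /\
     (essential v -> Imu_well_defined mu (Hinfv v) ->
        mu.-integrable `[0, 1[ (fun t => ((v (rC t))^-1)%:E))) /\
  (carleson mu -> Imu_conclusions mu (@H1 R) (@H1_norm R)).
Proof.
move=> _ mufin; split.
  move=> v wv; split; first exact: Hinfv_conclusions.
  exact: essential_integrable.
move=> mucar; have [C C0 HC] := H1_dominant mufin mucar.
exact: (Imu_conclusions_of_dominant mufin C0 HC).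
Qed.
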